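(* Let $\mathcal{V}=(Q,E)$ be a $d$-dimensional priority vector addition system (PVAS). If its reachability relation $\to_{\mathcal V}^{*}\subseteq\mathbb{N}^d\times\mathbb{N}^d$ is semilinear, then it is flattable, i.e. there exist finitely many transition sequences $w_1,\dots,w_r\in E^{*}$ such that $$\to_{\mathcal V}^{*}\;\subseteq\;\to_{w_1}^{*}\circ\dots\circ\to_{w_r}^{*}.$$
   Context: $\mathbb{N}$ contains $0$. A priority vector addition system with states (PVASS) of dimension $d\in\mathbb{N}$ is a finite directed multigraph $\mathcal V=(Q,E)$ whose edges $e$ are labelled with a pair of a vector $f(e)\in\mathbb{Z}^d$ and a number $g(e)\in\{0,\dots,d\}$. Configurations are elements of $Q\times\mathbb{N}^d$. An edge $e$ from $p$ to $p'$ induces the relation $(q,\mathbf{x})\to_e(q',\mathbf{x}')$ iff $q=p$, $q'=p'$, $\mathbf{x}(j)=0$ for all $1\le j\le g(e)$, and $\mathbf{x}'=\mathbf{x}+f(e)$ (with $\mathbf{x},\mathbf{x}'\in\mathbb{N}^d$). Put $\to_{\mathcal V}=\bigcup_{e\in E}\to_e$, and let $\to_{\mathcal V}^{*}$ be its reflexive transitive closure (the reachability relation). A PVAS is a PVASS with exactly one state; its configurations are identified with vectors in $\mathbb{N}^d$. Composition of relations is $\mathbf{R}_1\circ\mathbf{R}_2=\{(\mathbf v,\mathbf w)\mid\exists \mathbf x:(\mathbf v,\mathbf x)\in\mathbf R_1,(\mathbf x,\mathbf w)\in\mathbf R_2\}$. For $w=(e_1,\dots,e_k)\in E^{*}$ (a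 finite sequence of edges), $\to_w:=\to_{e_1}\circ\dots\circ\to_{e_k}$, and $\to_w^{*}$ is the reflexive transitive closure of $\to_w$. A relation $\mathbf L\subseteq\mathbb{N}^{d'}\times\mathbb{N}^{d''}$ is linear if, viewed as a subset of $\mathbb{N}^{d'+d''}$, it has the form $\mathbf b+\mathbb{N}\mathbf p_1+\dots+\mathbb{N}\mathbf p_r$ with $\mathbf b,\mathbf p_1,\dots,\mathbf p_r\in\mathbb{N}^{d'+d''}$; it is semilinear if it is a finite union of linear relations. *)

(* Defs.v *)
From Stdlib Require Export Relations.
From mathcomp Require Export all_boot all_order all_algebra.

Set Implicit Arguments.
Unset Strict Implicit.
Unset Printing Implicit Defensive.

Import GRing.Theory.
Local Open Scope ring_scope.

(* Edges form an arbitrary finite type, so parallel edges (even with equal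
   labels) are allowed. *)
Record pvass (d : nat) := PVASS {
  state : finType;
  edge : finType;
  source : edge -> state;
  target : edge -> state;
  effect : edge -> 'rV[int]_d;
  priority : edge -> 'I_d.+1
}.

Definition is_pvas (d : nat) (V : pvass d) : Prop := #|state V| = 1%N.

Definition config (d : nat) (V : pvass d) : Type := (state V * 'rV[nat]_d)%type.

(* Coordinates are numbered from 0, so the tested ones 1, ..., g(e) are the
   j : 'I_d with j < g(e).  The update equation is read in Z^d. *)
Definition edge_step (d : nat) (V : pvass d) (e : edge V) : relation (config V) :=
  fun c c' =>
    [/\ c.1 = source e,
        c'.1 = target e,
        forall j : 'I_d, (j < priority e)%N -> c.2 0 j = 0%N
      & map_mx Posz c'.2 = map_mx Posz c.2 + effect e].

Definition step (d : nat) (V : pvass d) : relation (config V) :=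
  fun c c' => exists e : edge V, edge_step e c c'.

Definition reach (d : nat) (V : pvass d) : relation (config V) :=
  clos_refl_trans (config V) (@step d V).

(* Diagrammatic order: first R1, then R2. *)
Definition rel_comp (A : Type) (R1 R2 : relation A) : relation A :=
  fun v w => exists x, R1 v x /\ R2 x w.

(* The empty composition is the identity. *)
Definition rel_comps (A : Type) (Rs : seq (relation A)) : relation A :=
  foldr (@rel_comp A) (@eq A) Rs.

Definition word_step (d : nat) (V : pvass d) (w : seq (edge V)) :
    relation (config V) :=
  rel_comps [seq edge_step e | e <- w].

Definition word_reach (d : nat) (V : pvass d) (w : seq (edge V)) :
    relation (config V) :=
  clos_refl_trans (config V) (word_step w).

Definition flattable (d : nat) (V : pvass d) : Prop :=
  exists ws : seq (seq (edge V)),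
    inclusion (config V) (@reach d V) (rel_comps [seq word_reach w | w <- ws]).

Definition linear_rel (m n : nat) (L : 'rV[nat]_m -> 'rV[nat]_n -> Prop) : Prop :=
  exists (b : 'rV[nat]_(m + n)) (r : nat) (p : 'I_r -> 'rV[nat]_(m + n)),
    forall x y,
      L x y <-> exists c : 'I_r -> nat, row_mx x y = b + \sum_(i < r) p i *+ c i.

Definition semilinear_rel (m n : nat) (R : 'rV[nat]_m -> 'rV[nat]_n -> Prop) : Prop :=
  exists (k : nat) (L : 'I_k -> 'rV[nat]_m -> 'rV[nat]_n -> Prop),
    (forall i, linear_rel (L i)) /\
    (forall x y, R x y <-> exists i, L i x y).

(* Identification of configurations with vectors; it loses no information
   when there is exactly one state, the only case in which it is meant. *)
Definition vector_rel (d : nat) (V : pvass d) (R : relation (config V)) :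
    relation 'rV[nat]_d :=
  fun x y => exists p q : state V, R (p, x) (q, y).

(* Main.v *)
(* It suffices to cover each linear set [b + N p_1 + ... + N p_r] contained in the
   reachability relation by finitely many flat pieces.

   Runs with priorities below [g] are cut at the tests of the highest priority
   and compared, by induction on [g], through Higman's embedding of the
   resulting words.  This is a well-quasi-order with amalgamation, so that the
   increments of a fixed run form a monoid, and finitely many increments can be
   iterated along finitely many words.  The cone generated by these increments
   has a finitely generated closure in every subspace: on the coordinates that
   can be pumped there is room for any cyclic move, and on the remaining,
   bounded, ones the runs decompose into simple cycles of minimal letters.

   The parameters of the linear set inherit this order from the runs.  If no
   finite family of flat pieces covered N^r, an ultrafilter on N^r would avoid
   all of them.  The linear forms are sorted by their growth along the
   ultrafilter.  By induction on the dimension, pumps are known that account for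
   all but the slowest growing forms, and the cone condition provides pumps for
   these; together they describe a flat piece in the ultrafilter. *)

Require Import Defs.
From mathcomp Require Import boolp zify ring lra.
From mathcomp Require filter.

Set Implicit Arguments.
Unset Strict Implicit.
Unset Printing Implicit Defensive.

Import Order.TTheory GRing.Theory Num.Theory.
Local Open Scope ring_scope.

(** * Cones *)

(** The rational cone of the increments of a run need not be closed: a move that uses a token as a
    catalyst may produce arbitrarily much on another coordinate, and nothing without the token. So
    in general no finite set of pumps generates all increments. The proof uses a sandwich instead:
    on each subspace a finitely generated cone contains the increments, and a translate of it
    consists of rational increments. All subspaces are needed because cutting does not commute with
    closing. The translation [s] is harmless in the end: [s + N v] with [N] large points nearly
    along [v], and [N] may be chosen after the growth of the sequence is known.

    A second obstacle is integrality: coordinates in a basis of pumps are rational, with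
    denominators that depend on runs chosen earlier. Multiplicities are therefore kept divisible by
    a prescribed number, and by factorials of an unbounded quantity while that number is still
    unknown.

    Semilinearity makes every vector of [N^r] the parameter of some run. The induction on dimension
    projects the sequence to slices, and these projected vectors must have runs of their own. *)

Definition nonneg m n (u : 'M[rat]_(m, n)) : Prop := forall i j, 0 <= u i j.

Definition cone m n (F : 'M[rat]_(m, n)) (v : 'rV[rat]_n) : Prop :=
  exists2 u : 'rV_m, nonneg u & v = u *m F.

Lemma nonneg0 m n : nonneg (0 : 'M_(m, n)).
Proof. by move=> i j; rewrite mxE. Qed.

Lemma nonnegD m n (u v : 'M_(m, n)) : nonneg u -> nonneg v -> nonneg (u + v).
Proof. by move=> hu hv i j; rewrite mxE addr_ge0. Qed.

Lemma nonnegZ m n (c : rat) (u : 'M_(m, n)) : 0 <= c -> nonneg u -> nonneg (c *: u).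
Proof. by move=> hc hu i j; rewrite mxE mulr_ge0. Qed.

Lemma nonnegM m n p (u : 'M_(m, n)) (v : 'M_(n, p)) :
  nonneg u -> nonneg v -> nonneg (u *m v).
Proof. by move=> hu hv i j; rewrite mxE sumr_ge0 // => k _; rewrite mulr_ge0. Qed.

Lemma nonneg_row_mx m n p (u : 'M_(m, n)) (v : 'M_(m, p)) :
  nonneg (row_mx u v) <-> nonneg u /\ nonneg v.
Proof.
split=> [h|[hu hv] i j]; last by rewrite mxE; case: split.
split=> i j.
  by move: (h i (lshift p j)); rewrite row_mxEl.
by move: (h i (rshift n j)); rewrite row_mxEr.
Qed.

Lemma cone0 m n (F : 'M_(m, n)) : cone F 0.
Proof. by exists 0; [exact: nonneg0 | rewrite mul0mx]. Qed.

Lemma coneD m n (F : 'M_(m, n)) v w : cone F v -> cone F w -> cone F (v + w).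
Proof.
by move=> [a ha ->] [b hb ->]; exists (a + b); [exact: nonnegD | rewrite mulmxDl].
Qed.

Lemma coneZ m n (F : 'M_(m, n)) (c : rat) v : 0 <= c -> cone F v -> cone F (c *: v).
Proof.
by move=> hc [a ha ->]; exists (c *: a); [exact: nonnegZ | rewrite scalemxAl].
Qed.

Lemma cone_row m n (F : 'M_(m, n)) i : cone F (row i F).
Proof.
exists (delta_mx 0 i); last by rewrite rowE.
by move=> j k; rewrite mxE; case: eqP; case: eqP.
Qed.

Lemma cone_mul m n p (F : 'M_(m, n)) (L : 'M_(n, p)) v :
  cone F v -> cone (F *m L) (v *m L).
Proof. by move=> [u hu ->]; exists u; rewrite ?mulmxA. Qed.

Lemma cone_mulP m n p (F : 'M_(m, n)) (L : 'M_(n, p)) w :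
  cone (F *m L) w -> exists2 v, cone F v & w = v *m L.
Proof. by move=> [u hu ->]; exists (u *m F); rewrite ?mulmxA //; exists u. Qed.

Lemma cone_col_mx m1 m2 n (F : 'M_(m1, n)) (G : 'M_(m2, n)) v :
  cone (col_mx F G) v <-> exists x y, [/\ cone F x, cone G y & v = x + y].
Proof.
split=> [[u hu ->]|[x [y [[a ha ->] [b hb ->] ->]]]].
  have [hl hr] : nonneg (lsubmx u) /\ nonneg (rsubmx u).
    by apply/nonneg_row_mx; rewrite hsubmxK.
  exists (lsubmx u *m F), (rsubmx u *m G); split; try by eexists.
  by rewrite -{1}(hsubmxK u) mul_row_col.
exists (row_mx a b); first exact/nonneg_row_mx.
by rewrite mul_row_col.
Qed.

(* One solution is kept for each possible support: subtracting a multiple of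
   the one with the same support as [u] strictly shrinks the support of [u]. *)
Lemma nonneg_kernel_fg p q (A : 'M[rat]_(p, q)) :
  exists t (E : 'M[rat]_(t, p)),
    [/\ nonneg E, E *m A = 0 & forall u, nonneg u -> u *m A = 0 -> cone E u].
Proof.
pose sol (u : 'rV[rat]_p) := nonneg u /\ u *m A = 0.
pose supp (u : 'rV[rat]_p) := [set i | 0 < u 0 i].
have suppE u i : (i \in supp u) = (0 < u 0 i) by rewrite inE.
have /fin_all_exists[e he] : forall S : {set 'I_p}, exists e : 'rV[rat]_p,
    sol e /\ ((exists u, sol u /\ supp u = S) -> supp e = S).
  move=> S; have [[u [hu hS]]|h] := pselect (exists u, sol u /\ supp u = S).
    by exists u.
  exists 0; split=> //; split; [exact: nonneg0 | exact: mul0mx].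
pose E := \matrix_(i < #|{set 'I_p}|) e (enum_val i).
exists _, E; split.
- by move=> i j; rewrite mxE; case: (he (enum_val i)) => -[].
- by apply/row_matrixP=> i; rewrite row_mul rowK row0; case: (he (enum_val i)) => -[].
have eE S : cone E (e S).
  by have := cone_row E (enum_rank S); rewrite rowK enum_rankK.
move=> u; have [n] := ubnP #|supp u|; elim: n u => // n IH u hn hu huA.
have [h0|[i0 hi0]] := set_0Vmem (supp u).
  suff -> : u = 0 by exact: cone0.
  apply/rowP=> i; rewrite mxE; apply/eqP; rewrite eq_le hu andbT leNgt.
  by apply/negP=> hi; have := in_set0 i; rewrite -h0 suppE hi.
have [[he1 he2] hes] := he (supp u); move: (e (supp u)) (eE (supp u)) he1 he2 hes.
move=> d dE hd hdA /(_ (ex_intro _ u (conj (conj hu huA) erefl))) hds.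
have dpos i : i \in supp u -> 0 < d 0 i by rewrite -hds suppE.
case: (arg_minP (fun i => u 0 i / d 0 i) hi0) => k hk hmin.
pose c := u 0 k / d 0 k.
have dk := dpos _ hk; have uk : 0 < u 0 k by rewrite -suppE.
have hc : 0 <= c by rewrite divr_ge0 // ltW.
have hu' : nonneg (u - c *: d).
  move=> i j; rewrite !ord1 !mxE subr_ge0.
  have [hj|hj] := boolP (j \in supp u).
    by rewrite -ler_pdivlMr ?dpos // hmin.
  suff -> : d 0 j = 0 by rewrite mulr0.
  apply/eqP; rewrite eq_le hd andbT leNgt; apply: contra hj => hj.
  by rewrite -hds suppE.
have -> : u = (u - c *: d) + c *: d by rewrite subrK.
apply: coneD; last exact: coneZ.
apply: IH => //; last by rewrite mulmxBl -scalemxAl huA hdA scaler0 subr0.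
apply: leq_trans (ltnSE hn); apply: proper_card; apply/properP; split.
  apply/subsetP=> j; rewrite !suppE !mxE => hj.
  by apply: lt_le_trans hj _; rewrite gerDl oppr_le0 mulr_ge0.
by exists k => //; rewrite suppE !mxE /c divfK ?subrr ?ltxx // gt_eqF.
Qed.

(** * Cones sandwiched on every subspace *)

Definition convex_cone n (C : 'rV[rat]_n -> Prop) : Prop :=
  [/\ C 0, forall v w, C v -> C w -> C (v + w)
    & forall (c : rat) v, 0 <= c -> C v -> C (c *: v)].

(* Equivalently, the closure of the intersection of [C] with any subspace is
   finitely generated; this form avoids topology. *)
Definition tame n (C : 'rV[rat]_n -> Prop) : Prop :=
  forall p (K : 'M[rat]_(n, p)), exists q (F : 'M[rat]_(q, n)) s,
    (forall v, C v -> v *m K = 0 -> cone F v) /\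
    (forall v, cone F v -> C (s + v) /\ (s + v) *m K = 0).

Lemma convex_cone_sum n (C : 'rV_n -> Prop) m (A : 'M_(m, n)) u :
  convex_cone C -> (forall i, C (row i A)) -> nonneg u -> C (u *m A).
Proof.
move=> [C0 CD CZ] hA hu; rewrite mulmx_sum_row.
by elim/big_ind: _ => // i _; exact: CZ.
Qed.

Lemma tame_ext n (C D : 'rV_n -> Prop) :
  (forall v, C v <-> D v) -> tame C -> tame D.
Proof.
move=> h tC p K; have [q [F [s [h1 h2]]]] := tC p K.
exists q, F, s; split=> [v /h|v /h2[/h]]; [exact: h1 | by []].
Qed.

(** The coefficient vectors that [F *m K] annihilates form a finitely generated cone by
    [nonneg_kernel_fg]; its generators times [F] are the rows of [G]. *)
Lemma cone_ker m n p (F : 'M[rat]_(m, n)) (K : 'M[rat]_(n, p)) :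
  exists q (G : 'M_(q, n)), forall v, cone G v <-> cone F v /\ v *m K = 0.
Proof.
have [t [E [hE EA hEA]]] := nonneg_kernel_fg (F *m K).
exists t, (E *m F) => v; split.
  move=> [u hu ->]; split; last by rewrite -!mulmxA EA mulmx0.
  by exists (u *m E); rewrite ?mulmxA //; exact: nonnegM.
by move=> [[u hu ->]]; rewrite -mulmxA => /(hEA _ hu)[w hw ->]; exists w; rewrite ?mulmxA.
Qed.

Lemma tame_cone m n (F : 'M_(m, n)) : tame (cone F).
Proof.
move=> p K; have [q [G hG]] := cone_ker F K.
exists q, G, 0; split=> [v Fv Kv|v]; first exact/hG.
by rewrite add0r => /hG.
Qed.

Lemma cone1 n (v : 'rV_n) : cone 1%:M v <-> nonneg v.
Proof.
by split=> [[u hu ->]|hv]; [rewrite mulmx1 | exists v; rewrite ?mulmx1].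
Qed.

Lemma tame_ker n p (C : 'rV_n -> Prop) (L : 'M_(n, p)) :
  tame C -> tame (fun v => C v /\ v *m L = 0).
Proof.
move=> tC r K; have [q [F [s [h1 h2]]]] := tC _ (row_mx L K).
exists q, F, s; split.
  by move=> v [Cv Lv] Kv; apply: h1 => //; rewrite mul_mx_row Lv Kv row_mx0.
move=> v /h2[Cv]; rewrite mul_mx_row -row_mx0 => /eq_row_mx[-> ->].
by [].
Qed.

Lemma tame_img n p (C : 'rV_n -> Prop) (L : 'M_(n, p)) :
  tame C -> tame (fun w => exists2 v, C v & w = v *m L).
Proof.
move=> tC r K; have [q [F [s [h1 h2]]]] := tC _ (L *m K).
exists q, (F *m L), (s *m L); split.
  by move=> w [v Cv ->]; rewrite -mulmxA => h; apply: cone_mul; exact: h1.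
move=> w /cone_mulP[v /h2[Cv Kv] ->]; rewrite -mulmxDl; split; first by exists (s + v).
by rewrite -mulmxA.
Qed.

(** A family of maximal rank cannot be enlarged. That its rows belong to [X] itself matters: the
    negative part of a combination of them can be cancelled by adding elements of [X]. *)
Lemma span_of n (X : 'rV[rat]_n -> Prop) :
  exists t (A : 'M[rat]_(t, n)),
    (forall i, X (row i A)) /\ (forall v, X v -> (v <= A)%MS).
Proof.
pose P k := exists t (A : 'M[rat]_(t, n)), (forall i, X (row i A)) /\ \rank A = k.
have [k [[t [A [hA rA]]] hk]] : exists k, P k /\ forall j, P j -> (j <= k)%N.
  have exP : exists k, `[< P k >].
    by exists 0%N; apply/asboolP; exists 0%N, 0; split; [case|rewrite mxrank0].
  have ub k : `[< P k >] -> (k <= n)%N.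
    by move=> /asboolP[t [A [_ <-]]]; exact: rank_leq_col.
  exists (ex_maxn exP ub); case: ex_maxnP => k /asboolP hk hmax; split=> // j /asboolP.
  exact: hmax.
exists t, A; split=> // v Xv.
have hP : P (\rank (col_mx A v)).
  exists (t + 1)%N, (col_mx A v); split=> // i; case: (splitP i) => j hj.
    have -> : i = lshift 1 j by exact: val_inj.
    by rewrite -[row _ _]/(row (lshift 1 j) _) rowKu.
  have -> : i = rshift t j by exact: val_inj.
  by rewrite rowKd ord1 row_id.
have le : (A <= A + v)%MS by exact: addsmxSl.
have := hk _ hP; rewrite -rA => hr.
have : (A == A + v)%MS.
  by rewrite -(mxrank_leqif_eq le) eqn_leq mxrankS // addsmxE.
by move=> /eqmxP ->; exact: addsmxSr.
Qed.

Lemma pos_neg_parts m n (c : 'M[rat]_(m, n)) :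
  exists P N, [/\ nonneg P, nonneg N & c = P - N].
Proof.
exists (\matrix_(i, j) Num.max (c i j) 0), (\matrix_(i, j) Num.max (- c i j) 0).
split; [by move=> i j; rewrite mxE le_max lexx orbT.. |].
apply/matrixP=> i j; rewrite !mxE.
have [h|h] := leP 0 (c i j).
  by rewrite (max_idPr _) ?subr0 // oppr_le0.
by rewrite (max_idPl _) ?sub0r ?opprK // oppr_ge0 ltW.
Qed.

Lemma rat_ub n (v : 'rV[rat]_n) : exists N : nat, forall i, `|v 0 i| <= N%:R.
Proof.
exists (\sum_i (Num.truncn `|v 0%R i|).+1)%N => i.
apply: ltW; apply: lt_le_trans (truncnS_gt _) _.
by rewrite ler_nat (bigD1 i) //= leq_addr.
Qed.

(** The constraint [K] couples the factors, so each factor is sandwiched on the span of the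
    projection of [E], the part of the product inside [ker K]. The shift of one factor need not be
    the projection of an element of [E], but it lies in the span of such projections and becomes one
    after a correction inside the cone. *)
Lemma tame_prod n1 n2 (C1 : 'rV_n1 -> Prop) (C2 : 'rV_n2 -> Prop) :
  convex_cone C1 -> convex_cone C2 -> tame C1 -> tame C2 ->
  tame (fun v => C1 (lsubmx v) /\ C2 (rsubmx v)).
Proof.
move=> cC1 cC2 t1 t2 p K.
pose E (v : 'rV_(n1 + n2)) := [/\ C1 (lsubmx v), C2 (rsubmx v) & v *m K = 0].
have cE : convex_cone E.
  case: cC1 cC2 => [C10 C1D C1Z] [C20 C2D C2Z]; split.
  - by split; rewrite ?linear0 ?mul0mx.
  - move=> v w [a1 a2 a3] [b1 b2 b3]; split; rewrite ?linearD; [exact: C1D|exact: C2D|].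
    by rewrite mulmxDl a3 b3 addr0.
  - move=> c v hc [a1 a2 a3]; split; rewrite ?linearZ; [exact: C1Z|exact: C2Z|].
    by rewrite -scalemxAl a3 scaler0.
have [m1 [A1 [hA1 sA1]]] := span_of (fun x => exists2 v, E v & x = lsubmx v).
have [m2 [A2 [hA2 sA2]]] := span_of (fun x => exists2 v, E v & x = rsubmx v).
have [q1 [F1 [s1 [F1c F1s]]]] := t1 _ (cokermx A1).
have [q2 [F2 [s2 [F2c F2s]]]] := t2 _ (cokermx A2).
have [q [G hG]] := cone_ker (block_mx F1 0 0 F2) K.
have coneB v : cone (block_mx F1 0 0 F2) v <-> cone F1 (lsubmx v) /\ cone F2 (rsubmx v).
  rewrite -{1}(hsubmxK v); split.
    move=> [u hu]; rewrite -(hsubmxK u) mul_row_block !mulmx0 addr0 add0r.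
    move: hu; rewrite -{1}(hsubmxK u) => /nonneg_row_mx[hl hr] /eq_row_mx[-> ->].
    by split; eexists; try reflexivity.
  move=> [[u hu eu] [w hw ew]]; exists (row_mx u w); first exact/nonneg_row_mx.
  by rewrite mul_row_block !mulmx0 addr0 add0r -eu -ew.
(* With [s1 = P A1 - N A1], the vector [s1 + N A1 = P A1] is the left part of an element of [E], and
   the correction [N A1] lies in [C1]. *)
have [e1 Ee1 [N1 N1c]] : exists2 e, E e & exists2 N, C1 N & lsubmx e = s1 + N.
  have : (s1 <= A1)%MS.
    rewrite submxE -[s1]addr0; apply/eqP; case: (F1s 0); [exact: cone0 | by []].
  move=> /submxP[c ec]; have [P [N [hP hN cPN]]] := pos_neg_parts c.
  have /fin_all_exists[f hf] : forall i, exists v, E v /\ row i A1 = lsubmx v.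
    by move=> i; have [v] := hA1 i; exists v.
  exists (P *m \matrix_i f i).
    by apply: convex_cone_sum => // i; rewrite rowK; case: (hf i).
  exists (N *m A1).
    by apply: convex_cone_sum => // i; case: (hf i) => -[h _ _] ->.
  rewrite ec cPN mulmxBl subrK -mulmx_lsub; congr (_ *m _).
  apply/row_matrixP=> i; have [_ ->] := hf i.
  by apply/rowP=> j; rewrite !mxE.
have [e2 Ee2 [N2 N2c]] : exists2 e, E e & exists2 N, C2 N & rsubmx e = s2 + N.
  have : (s2 <= A2)%MS.
    rewrite submxE -[s2]addr0; apply/eqP; case: (F2s 0); [exact: cone0 | by []].
  move=> /submxP[c ec]; have [P [N [hP hN cPN]]] := pos_neg_parts c.
  have /fin_all_exists[f hf] : forall i, exists v, E v /\ row i A2 = rsubmx v.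
    by move=> i; have [v] := hA2 i; exists v.
  exists (P *m \matrix_i f i).
    by apply: convex_cone_sum => // i; rewrite rowK; case: (hf i).
  exists (N *m A2).
    by apply: convex_cone_sum => // i; case: (hf i) => -[_ h _] ->.
  rewrite ec cPN mulmxBl subrK -mulmx_rsub; congr (_ *m _).
  apply/row_matrixP=> i; have [_ ->] := hf i.
  by apply/rowP=> j; rewrite !mxE.
(* [e1] supplies the shift on the left and [e2] the one on the right; their other halves lie in the
   cones and are simply added. *)
move=> eN2 eN1; exists q, G, (e1 + e2); split.
  move=> v [C1v C2v] Kv; apply/hG; split=> //; apply/coneB; split.
    by apply: F1c => //; apply/eqP; rewrite -submxE; apply: sA1; exists v.
  by apply: F2c => //; apply/eqP; rewrite -submxE; apply: sA2; exists v.
move=> v /hG[/coneB[v1 v2] Kv].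
case: Ee1 => [e11 e12 e1K]; case: Ee2 => [e21 e22 e2K].
have [_ C1D _] := cC1; have [_ C2D _] := cC2.
split; last by rewrite !mulmxDl e1K e2K Kv !addr0.
have acac m (a b c d : 'rV[rat]_m) : a + b + c + d = (a + d) + (b + c).
  by rewrite -!addrA [d + _]addrCA [d + _]addrC !addrA.
have bacd m (a b c d : 'rV[rat]_m) : c + (a + b) + d = (a + d) + (b + c).
  by rewrite [c + _]addrC acac.
split.
  rewrite !linearD /= eN1 acac.
  by apply: (C1D); [have [] := F1s _ v1 | apply: (C1D)].
rewrite !linearD /= eN2 bacd.
by apply: (C2D); [have [] := F2s _ v2 | apply: (C2D)].
Qed.

(** Pairs with equal middle components are the kernel of [L] in the product, and [Q] forgets the
    middle. *)
Lemma tame_comp n1 n2 n3 (C1 : 'rV_(n1 + n2) -> Prop) (C2 : 'rV_(n2 + n3) -> Prop) :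
  convex_cone C1 -> convex_cone C2 -> tame C1 -> tame C2 ->
  tame (fun v : 'rV_(n1 + n3) =>
    exists y, C1 (row_mx (lsubmx v) y) /\ C2 (row_mx y (rsubmx v))).
Proof.
move=> cC1 cC2 t1 t2.
pose L : 'M[rat]_((n1 + n2) + (n2 + n3), n2) :=
  col_mx (col_mx 0 1%:M) (col_mx (- 1%:M) 0).
pose Q : 'M[rat]_((n1 + n2) + (n2 + n3), n1 + n3) :=
  col_mx (block_mx 1%:M 0 0 0) (block_mx 0 0 0 1%:M).
apply: tame_ext (tame_img Q (tame_ker L (tame_prod cC1 cC2 t1 t2))) => v; split.
  move=> [w [[h1 h2]]]; rewrite -[w]hsubmxK -[lsubmx w]hsubmxK -[rsubmx w]hsubmxK.
  rewrite !mul_row_col ?mul_row_block ?mul_mx_row !mulmx0 !mulmxN !mulmx1 !(add0r, addr0).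
  rewrite !add_row_mx !(add0r, addr0) => /subr0_eq e ->.
  rewrite row_mxKl row_mxKr; exists (rsubmx (lsubmx w)); rewrite hsubmxK; split=> //.
  by rewrite e hsubmxK.
move=> [y [h1 h2]].
exists (row_mx (row_mx (lsubmx v) y) (row_mx y (rsubmx v))).
  rewrite row_mxKl row_mxKr; split=> //.
  by rewrite !mul_row_col !mulmx0 !mulmxN !mulmx1 !(add0r, addr0) subrr.
rewrite !mul_row_col ?mul_row_block ?mul_mx_row !mulmx0 !mulmx1.
by rewrite !add_row_mx !(add0r, addr0) hsubmxK.
Qed.

(** * Well-quasi-orders *)

Definition wqo T (R : T -> T -> Prop) : Prop :=
  forall f : nat -> T, exists i j, (i < j)%N /\ R (f i) (f j).

Definition increasing (g : nat -> nat) : Prop := forall i j, (i < j)%N -> (g i < g j)%N.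

Lemma increasing_ge g : increasing g -> forall i, (i <= g i)%N.
Proof. by move=> hg; elim=> // i IH; apply: leq_ltn_trans IH (hg _ _ _). Qed.

Lemma dependent_choice T (P : seq T -> T -> Prop) :
  (forall s, exists x, P s x) ->
  exists f : nat -> T, forall n, P [seq f i | i <- iota 0 n] (f n).
Proof.
move=> /choice[ch hch].
pose g := fix g n := if n is m.+1 then rcons (g m) (ch (g m)) else [::].
exists (fun n => ch (g n)) => n.
suff -> : [seq ch (g i) | i <- iota 0 n] = g n by exact: hch.
elim: n => // n IH; rewrite -[in iota _ _]addn1 iotaD map_cat IH /=.
by rewrite add0n cats1.
Qed.

Lemma in_map_iota T (f : nat -> T) n i :
  (i < n)%N -> List.In (f i) [seq f i | i <- iota 0 n].
Proof.
move=> h; have : i \in iota 0 n by rewrite mem_iota.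
elim: (iota 0 n) => //= a s IH; rewrite inE => /orP[/eqP->|/IH]; [by left|by right].
Qed.

(** Infinitely many indices without a later partner would form a bad sequence, so beyond some [N]
    every index has one; partners are then followed from [N]. *)
Lemma wqo_chain T (R : T -> T -> Prop) :
  (forall x y z, R x y -> R y z -> R x z) -> wqo R ->
  forall f : nat -> T, exists2 g, increasing g &
    forall i j, (i < j)%N -> R (f (g i)) (f (g j)).
Proof.
move=> trR wR f.
pose good i := exists2 j, (i < j)%N & R (f i) (f j).
have [N hN] : exists N, forall i, (N <= i)%N -> good i.
  apply: contrapT => h.
  have hb n : exists i, (n < i)%N /\ ~ good i.
    apply: contrapT => h'; apply: h; exists n.+1 => i hi.
    by apply: contrapT => hg; apply: h'; exists i.
  have hs (s : seq nat) : exists i, ~ good i /\ forall j, List.In j s -> (j < i)%N.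
    have [i [h1 h2]] := hb (foldr maxn 0%N s); exists i; split=> // j hj.
    apply: leq_ltn_trans h1; elim: s hj => //= a s IH [->|/IH h']; first by rewrite leq_maxl.
    by rewrite leq_max h' orbT.
  have [g hg] := dependent_choice hs.
  have [i [j [hij hR]]] := wR (f \o g).
  have [hi _] := hg i; apply: hi; exists (g j) => //.
  by have [_] := hg j; apply; apply: in_map_iota.
have /choice[nx hnx] : forall i, exists j, (N <= i)%N -> (i < j)%N /\ R (f i) (f j).
  by move=> i; have [/hN[j]|_] := leqP N i; [exists j | exists 0%N].
pose g i := iter i nx N.
have gN i : (N <= g i)%N.
  by elim: i => //= i IH; apply: (leq_trans IH (ltnW _)); case: (hnx _ IH).
have gS i : (g i < g i.+1)%N /\ R (f (g i)) (f (g i.+1)) by exact: hnx.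
exists g => i j; elim: j => // j IH; rewrite ltnS leq_eqVlt => /orP[/eqP->|hij].
- by case: (gS j).
- by apply: ltn_trans (IH hij) _; case: (gS j).
- by case: (gS j).
- by apply: trR (IH hij) _; case: (gS j).
Qed.

Lemma wqo_map T T' (h : T -> T') (R : T' -> T' -> Prop) (S : T -> T -> Prop) :
  (forall x y, R (h x) (h y) -> S x y) -> wqo R -> wqo S.
Proof. by move=> hRS wR f; have [i [j [hij /hRS hS]]] := wR (h \o f); exists i, j. Qed.

Lemma wqo_prod T T' (R : T -> T -> Prop) (S : T' -> T' -> Prop) :
  (forall x y z, R x y -> R y z -> R x z) -> wqo R -> wqo S ->
  wqo (fun x y : T * T' => R x.1 y.1 /\ S x.2 y.2).
Proof.
move=> trR wR wS f; have [g hg hR] := wqo_chain trR wR (fst \o f).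
have [i [j [hij hS]]] := wS (snd \o f \o g).
by exists (g i), (g j); split; [exact: hg | split; [exact: hR |]].
Qed.

Lemma wqo_fin (T : finType) : wqo (@eq T).
Proof.
move=> f; pose h (i : 'I_#|T|.+1) := f i.
have /injectivePn[i [j hij e]] : ~~ injectiveb h.
  by apply/negP=> /injectiveP /leq_card; rewrite card_ord ltnn.
have /orP[hlt|hlt] : (i < j)%N || (j < i)%N by rewrite -neq_ltn.
  by exists i, j.
by exists j, i.
Qed.

Lemma wqo_sum T T' (R : T -> T -> Prop) (S : T' -> T' -> Prop) :
  wqo R -> wqo S ->
  wqo (fun x y : T + T' => match x, y with
       | inl a, inl b => R a b | inr a, inr b => S a b | _, _ => False end).
Proof.
move=> wR wS f.
have [[N hN]|h] := pselect (exists N, forall i, (N <= i)%N -> exists a, f i = inl a).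
  have /choice[g hg] : forall i, exists a, f (N + i)%N = inl a.
    by move=> i; apply: hN; rewrite leq_addr.
  have [i [j [hij hR]]] := wR g.
  by exists (N + i)%N, (N + j)%N; rewrite ltn_add2l !hg.
have hb n : exists i, (n < i)%N /\ exists b, f i = inr b.
  apply: contrapT => h'; apply: h; exists n.+1 => i hi.
  case e : (f i) => [a|b]; first by exists a.
  by case: h'; exists i; split=> //; exists b.
have [nx hnx] := choice hb.
pose g i := iter i nx (nx 0%N).
have gi : increasing g.
  move=> i j; elim: j => // j IH; rewrite ltnS leq_eqVlt => /orP[/eqP->|/IH hij].
    by case: (hnx (g j)).
  by apply: ltn_trans hij _; case: (hnx (g j)).
have /choice[k hk] : forall i, exists b, f (g i) = inr b.
  by case=> [|i] /=; [case: (hnx 0%N) | case: (hnx (g i))].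
have [i [j [hij hS]]] := wS k.
by exists (g i), (g j); rewrite !hk; split=> //; exact: gi.
Qed.

Lemma wqo_nat : wqo (fun x y => (x <= y)%N).
Proof.
move=> f; apply: contrapT => h.
have hd n : (f n.+1 < f n)%N.
  by rewrite ltnNge; apply/negP=> hl; apply: h; exists n, n.+1.
have hf n : (f n + n <= f 0%N)%N.
  by elim: n => [|n IH]; rewrite ?addn0 //; have := hd n; lia.
by have := hf (f 0%N).+1; lia.
Qed.

Definition vle n (x y : 'rV[nat]_n) : Prop := exists z, y = x + z.

Lemma vleP n (x y : 'rV[nat]_n) : (forall i, (x 0%R i <= y 0%R i)%N) <-> vle x y.
Proof.
split=> [h|[z ->] i]; last by rewrite mxE leq_addr.
exists (\row_i (y 0%R i - x 0%R i)%N); apply/rowP=> i; rewrite !mxE.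
by rewrite -[LHS](subnKC (h i)).
Qed.

Lemma vle_refl n (x : 'rV[nat]_n) : vle x x.
Proof. by exists 0; rewrite addr0. Qed.

Lemma vle_trans n (x y z : 'rV[nat]_n) : vle x y -> vle y z -> vle x z.
Proof. by move=> [a ->] [b ->]; exists (a + b); rewrite addrA. Qed.

Lemma wqo_vec n : wqo (@vle n).
Proof.
elim: n => [|n IH].
  by move=> f; exists 0%N, 1%N; split=> //; apply/vleP=> -[].
pose h (x : 'rV[nat]_n.+1) := (x 0 ord0, \row_i x 0 (lift ord0 i)).
apply: (wqo_map (h := h)) (wqo_prod _ wqo_nat IH); last by move=> x y z; exact: leq_trans.
move=> x y [h1 /vleP h2]; apply/vleP=> i.
case: (unliftP ord0 i) => [j ->|->] //.
by have := h2 j; rewrite !mxE.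
Qed.

(** Otherwise each finite list leaves an element of [P] above none of its members in [P], and
    choosing such elements repeatedly gives a bad sequence. *)
Lemma wqo_basis T (R : T -> T -> Prop) (P : T -> Prop) :
  wqo R -> exists k (m : 'I_k -> T),
    (forall i, P (m i)) /\ forall x, P x -> exists i, R (m i) x.
Proof.
move=> wR; apply: contrapT => h.
have hs (s : seq T) : exists x, P x /\ forall y, List.In y s -> P y -> ~ R y x.
  apply: contrapT => hx; apply: h; pose s' := [seq x <- s | `[< P x >]].
  have hs' i : P (tnth (in_tuple s') i).
    case: s' (filter_all (fun x => `[< P x >]) s : all (fun x => `[< P x >]) s') i => [_ []//|a s'].
    by move=> hs' i; rewrite (tnth_nth a); apply/asboolP; move/(all_nthP a): hs'; apply.
  exists _, (tnth (in_tuple s')); split=> // x Px.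
  apply: contrapT => hm; apply: hx; exists x; split=> // y ys Py Ryx; apply: hm.
  have : List.In y s'.
    rewrite /s'; elim: s {s' hs' } ys => //= a s IH [->|/IH hy].
      by rewrite asboolT //=; left.
    by case: asbool => //=; right.
  elim: (s') => // a u IH /= [->|/IH[i hi]].
    by exists ord0; rewrite /tnth.
  exists (lift ord0 i); rewrite (tnth_nth a) /=.
  by move: hi; rewrite (tnth_nth a).
have [f hf] := dependent_choice hs.
have [i [j [hij hR]]] := wR f.
by have [_ /(_ (f i) (in_map_iota _ hij))] := hf j; apply=> //; case: (hf i).
Qed.

Inductive emb T (R : T -> T -> Prop) : seq T -> seq T -> Prop :=
| emb_nil : emb R [::] [::]
| emb_skip s b t of emb R s t : emb R s (b :: t)
| emb_cons a s b t of R a b & emb R s t : emb R (a :: s) (b :: t).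

Lemma emb_nils T (R : T -> T -> Prop) s : emb R [::] s.
Proof. by elim: s => [|a s IH]; constructor. Qed.

Lemma emb_refl T (R : T -> T -> Prop) : (forall x, R x x) -> forall s, emb R s s.
Proof. by move=> rR; elim=> [|a s IH]; constructor. Qed.

Lemma emb_trans T (R : T -> T -> Prop) :
  (forall x y z, R x y -> R y z -> R x z) ->
  forall s t u, emb R s t -> emb R t u -> emb R s u.
Proof.
move=> trR s t u st tu; elim: tu s st => [//|t' c u' _ IH s st|b t' c u' bc _ IH s st].
  by constructor; exact: IH.
inversion st; subst; first by constructor; exact: IH.
by constructor; [exact: trR bc | exact: IH].
Qed.

Lemma emb_cat T (R : T -> T -> Prop) s t s' t' :
  emb R s t -> emb R s' t' -> emb R (s ++ s') (t ++ t').
Proof. by move=> h h'; elim: h => //= *; constructor. Qed.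

Lemma emb_uncons T (R : T -> T -> Prop) a s t : emb R (a :: s) t ->
  exists t1 b t2, [/\ t = t1 ++ b :: t2, R a b & emb R s t2].
Proof.
move=> h; remember (a :: s) as u eqn:e; elim: h a s e => // {t u}.
  move=> u b t _ IH a s /IH[t1 [b' [t2 [-> h1 h2]]]].
  by exists (b :: t1), b', t2.
by move=> a' u b t ab h _ a s [<- <-]; exists [::], b, t.
Qed.

(* Nash-Williams: take a bad sequence of words whose lengths are minimal at
   each step; removing the first letters of a chain contradicts minimality. *)
Lemma higman T (R : T -> T -> Prop) :
  (forall x y z, R x y -> R y z -> R x z) -> wqo R -> wqo (emb R).
Proof.
move=> trR wR; apply: contrapT => hw.
pose bad (f : nat -> seq T) := forall i j, (i < j)%N -> ~ emb R (f i) (f j).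
have [f0 hf0] : exists f, bad f.
  apply: contrapT => h; apply: hw => f; apply: contrapT => h'; apply: h; exists f.
  by move=> i j hij hR; apply: h'; exists i, j.
pose agree n (f f' : nat -> seq T) := forall i, (i < n)%N -> f i = f' i.
have [step hstep] : exists step : nat -> (nat -> seq T) -> (nat -> seq T),
    forall n f, bad f -> [/\ bad (step n f), agree n f (step n f) &
      forall f', bad f' -> agree n f f' -> (size (step n f n) <= size (f' n))%N].
  suff /choice[st hst] : forall nf : nat * (nat -> seq T), exists g, bad nf.2 ->
      [/\ bad g, agree nf.1 nf.2 g &
      forall f', bad f' -> agree nf.1 nf.2 f' -> (size (g nf.1) <= size (f' nf.1))%N].
    by exists (fun n f => st (n, f)) => n f; exact: (hst (n, f)).
  move=> [n f] /=; have [bf|nbf] := pselect (bad f); last by exists f.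
  have exP : exists k, `[< exists g, [/\ bad g, agree n f g & size (g n) = k] >].
    by exists (size (f n)); apply/asboolP; exists f; split.
  case: (ex_minnP exP) => k /asboolP[g [bg ag sg]] hmin.
  exists g => _; split=> // f' bf' af'; rewrite sg; apply: hmin.
  by apply/asboolP; exists f'.
pose F := fix F n := if n is m.+1 then step m (F m) else f0.
have bF n : bad (F n) by elim: n => //= n IH; case: (hstep n _ IH).
have aF n k : agree n (F n) (F (n + k)%N).
  elim: k => [|k IH] i hi; first by rewrite addn0.
  rewrite addnS /= IH //; have [_ h _] := hstep (n + k)%N _ (bF (n + k)%N).
  by apply: h; exact: leq_trans hi (leq_addr _ _).
pose m n := F n.+1 n.
have mF n i : (i < n)%N -> m i = F n i.
  by move=> hi; rewrite /m (aF i.+1 (n - i.+1)%N) ?subnKC.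
have bm : bad m.
  by move=> i j hij; rewrite (mF j.+1 i) 1?ltnW // (mF j.+1 j) //; exact: bF.
have minm n f' : bad f' -> agree n m f' -> (size (m n) <= size (f' n))%N.
  move=> bf' af'; case: (hstep n _ (bF n)) => _ _ hm; apply: hm => // i hi.
  by rewrite -mF // af'.
have mcons n : exists at' : T * seq T, m n = at'.1 :: at'.2.
  case e : (m n) => [|a t]; last by exists (a, t).
  by case: (bm n n.+1) => //; rewrite e; exact: emb_nils.
have [at' hat] := choice mcons.
have [g hg hR] := wqo_chain trR wR (fst \o at').
pose f' n := if (n < g 0%N)%N then m n else (at' (g (n - g 0%N)%N)).2.
have bf' : bad f'.
  move=> i j hij; rewrite /f'.
  have [hj|hj] := ltnP j (g 0%N).
    by rewrite (ltn_trans hij hj); exact: bm.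
  have [hi|hi] := ltnP i (g 0%N).
    move=> h; apply: (bm i (g (j - g 0%N)%N)).
      by apply: leq_trans hi _; have [->//|/hg/ltnW] := posnP (j - g 0%N)%N.
    by rewrite [X in emb R _ X]hat; constructor.
  move=> h; have hk : (i - g 0%N < j - g 0%N)%N by lia.
  apply: (bm _ _ (hg _ _ hk)); rewrite !hat.
  by constructor=> //; exact: hR.
have af' : agree (g 0%N) m f' by move=> i hi; rewrite /f' hi.
have := minm _ _ bf' af'.
by rewrite /f' ltnn subnn hat /= ltnn.
Qed.

(** * Vectors of natural numbers *)

Lemma nat_addE (x y : nat) : (x + y)%R = (x + y)%N.
Proof. by []. Qed.

Lemma nat_zeroE : @GRing.zero (nat : nmodType) = 0%N.
Proof. by []. Qed.

Lemma nat_mulrnE (x k : nat) : (x *+ k)%R = (x * k)%N.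
Proof. by elim: k => [|k IH]; rewrite ?muln0 // mulrS IH mulnS. Qed.

Definition vecE := (mxE, mulmxnE, nat_mulrnE, nat_addE, nat_zeroE).

Ltac vnat :=
  let i := fresh "i" in
  apply/rowP => i;
  repeat match goal with H : _ = _ |- _ =>
    move/rowP/(_ i): H; rewrite ?vecE /=; let H' := fresh "H" in intro H' end;
  rewrite ?vecE /=; lia.

Definition toQ n (x : 'rV[nat]_n) : 'rV[rat]_n := \row_i (x 0 i)%:R.

Lemma toQ0 n : toQ (0 : 'rV_n) = 0.
Proof. by apply/rowP=> i; rewrite !mxE. Qed.

Lemma toQD n (x y : 'rV_n) : toQ (x + y) = toQ x + toQ y.
Proof. by apply/rowP=> i; rewrite !mxE nat_addE natrD. Qed.

Lemma toQMn n (x : 'rV_n) k : toQ (x *+ k) = k%:R *: toQ x.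
Proof. by apply/rowP=> i; rewrite !vecE natrM mulrC. Qed.

Lemma toQ_inj n : injective (@toQ n).
Proof.
move=> x y /rowP h; apply/rowP=> i; have := h i; rewrite !mxE => /eqP.
by rewrite eqr_nat => /eqP.
Qed.

Lemma toQ_ge0 n (x : 'rV_n) : nonneg (toQ x).
Proof. by move=> i j; rewrite mxE. Qed.

Lemma toQ_row_mx n m (x : 'rV_n) (y : 'rV_m) : toQ (row_mx x y) = row_mx (toQ x) (toQ y).
Proof. by apply/rowP=> i; rewrite !mxE; case: split => j; rewrite mxE. Qed.

Lemma toQ_sum n (I : finType) (F : I -> 'rV_n) :
  toQ (\sum_i F i) = \sum_i toQ (F i).
Proof. by elim/big_rec2: _ => [|i y x _ <-]; rewrite ?toQ0 ?toQD. Qed.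

Lemma clear_denoms m n (A : 'M[rat]_(m, n)) :
  exists2 M : nat, (0 < M)%N & forall i j, exists z : int, M%:R * A i j = z%:~R.
Proof.
pose M := (\prod_(p : 'I_m * 'I_n) `|denq (A p.1 p.2)|)%N.
exists M; first by apply: prodn_gt0 => p; rewrite absz_gt0 denq_neq0.
move=> i j; rewrite /M (bigD1 (i, j)) //= natrM mulrAC.
set P := (\prod_(_ | _) _)%N.
exists (numq (A i j) * P%:Z); rewrite intrM; congr (_ * _).
have -> : (`|denq (A i j)|%N%:R : rat) = (denq (A i j))%:~R.
  by rewrite -{2}(absz_denq (A i j)).
by rewrite mulrC -numqE.
Qed.

Lemma nonneg_clear_denoms n (v : 'rV[rat]_n) :
  nonneg v -> exists (M : nat) x, (0 < M)%N /\ M%:R *: v = toQ x.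
Proof.
move=> hv; have [M M0 hM] := clear_denoms v.
have /fin_all_exists[x hx] : forall i, exists k : nat, M%:R * v 0 i = k%:R.
  move=> i; have [z hz] := hM 0 i; have : 0 <= z%:~R :> rat by rewrite -hz mulr_ge0.
  by rewrite ler0z hz; case: z {hz} => // k _; exists k.
by exists M, (\row_i x i); split=> //; apply/rowP=> i; rewrite !mxE hx.
Qed.

(** * Rational cones of monoids of vectors *)

Definition monoid n (D : 'rV[nat]_n -> Prop) : Prop :=
  D 0 /\ forall x y, D x -> D y -> D (x + y).

Lemma monoidMn n (D : 'rV_n -> Prop) x k : monoid D -> D x -> D (x *+ k).
Proof. by move=> [D0 DD] Dx; elim: k => // k IH; rewrite mulrS; exact: DD. Qed.

(** For a monoid this is the rational cone generated by [D], all denominators being gathered in one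
    factor. *)
Definition qcone n (D : 'rV[nat]_n -> Prop) (v : 'rV[rat]_n) : Prop :=
  exists (M : nat) x, [/\ (0 < M)%N, D x & M%:R *: v = toQ x].

Lemma qcone_toQ n (D : 'rV_n -> Prop) x : D x -> qcone D (toQ x).
Proof. by move=> Dx; exists 1%N, x; rewrite scale1r. Qed.

Lemma convex_qcone n (D : 'rV_n -> Prop) : monoid D -> convex_cone (qcone D).
Proof.
move=> mD; have [D0 DD] := mD; split.
- by exists 1%N, 0; rewrite scaler0 toQ0.
- move=> v w [M [x [M0 Dx ex]]] [N [y [N0 Dy ey]]].
  exists (M * N)%N, (x *+ N + y *+ M); rewrite muln_gt0 M0 N0; split=> //.
    by apply: DD; exact: monoidMn.
  by rewrite toQD !toQMn -ex -ey natrM scalerDr !scalerA [N%:R * M%:R]mulrC.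
- move=> c v hc [M [x [M0 Dx ex]]].
  have [N N0 hN] := clear_denoms (c%:M : 'M_1).
  have [z hz] := hN 0 0; move: hz; rewrite !mxE eqxx mulr1n => hz.
  have : 0 <= z%:~R :> rat by rewrite -hz mulr_ge0.
  rewrite ler0z; case: z hz => // k hk _.
  exists (N * M)%N, (x *+ k); rewrite muln_gt0 N0 M0; split=> //; first exact: monoidMn.
  have {}hk : N%:R * c = k%:R by exact: hk.
  by rewrite toQMn -ex !scalerA -hk natrM; congr (_ *: _); ring.
Qed.

Definition qcone2 m n (R : 'rV[nat]_m -> 'rV[nat]_n -> Prop) : 'rV[rat]_(m + n) -> Prop :=
  qcone (fun z => R (lsubmx z) (rsubmx z)).

Definition monoid2 m n (R : 'rV[nat]_m -> 'rV[nat]_n -> Prop) : Prop :=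
  R 0 0 /\ forall x y x' y', R x y -> R x' y' -> R (x + x') (y + y').

Lemma monoid2P m n (R : 'rV_m -> 'rV_n -> Prop) :
  monoid2 R -> monoid (fun z => R (lsubmx z) (rsubmx z)).
Proof. by move=> [R0 RD]; split=> [|x y]; rewrite ?linear0 // !linearD; exact: RD. Qed.

Lemma monoid2Mn m n (R : 'rV_m -> 'rV_n -> Prop) x y k :
  monoid2 R -> R x y -> R (x *+ k) (y *+ k).
Proof. by move=> [R0 RD] h; elim: k => // k IH; rewrite !mulrS; exact: RD. Qed.

Lemma monoid2_sum m n (R : 'rV_m -> 'rV_n -> Prop) k (F : 'I_k -> 'rV_m) (G : 'I_k -> 'rV_n) :
  monoid2 R -> (forall i, R (F i) (G i)) -> R (\sum_i F i) (\sum_i G i).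
Proof. by move=> [R0 RD] h; apply: (big_ind2 R) => // *; exact: RD. Qed.

Lemma qcone2P m n (R : 'rV_m -> 'rV_n -> Prop) v :
  qcone2 R v <-> exists M x y,
    [/\ (0 < M)%N, R x y & M%:R *: v = row_mx (toQ x) (toQ y)].
Proof.
split=> [[M [z [M0 Rz e]]]|[M [x [y [M0 Rz e]]]]].
  by exists M, (lsubmx z), (rsubmx z); rewrite -toQ_row_mx hsubmxK.
by exists M, (row_mx x y); rewrite row_mxKl row_mxKr toQ_row_mx.
Qed.

Lemma qcone2_ext m n (R S : 'rV_m -> 'rV_n -> Prop) v :
  (forall x y, R x y <-> S x y) -> qcone2 R v <-> qcone2 S v.
Proof.
by move=> h; split=> [] [M [z [M0 /h ? ?]]]; exists M, z.
Qed.

(** Taking cones commutes with composition: middle vectors that agree rationally become equal after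
    each side is multiplied by the denominator of the other. *)
Lemma tame_relcomp m n p (R : 'rV_m -> 'rV_n -> Prop) (S : 'rV_n -> 'rV_p -> Prop) :
  monoid2 R -> monoid2 S -> tame (qcone2 R) -> tame (qcone2 S) ->
  tame (qcone2 (fun x z => exists y, R x y /\ S y z)).
Proof.
move=> mR mS tR tS.
have cR := convex_qcone (monoid2P mR); have cS := convex_qcone (monoid2P mS).
apply: tame_ext (tame_comp cR cS tR tS) => v; split.
  move=> [y [/qcone2P[M [a [b [M0 Rab e1]]]] /qcone2P[N [b' [c [N0 Sbc e2]]]]]].
  move: e1 e2; rewrite !scale_row_mx => /eq_row_mx[e1 e2] /eq_row_mx[e3 e4].
  apply/qcone2P; exists (M * N)%N, (a *+ N), (c *+ M); rewrite muln_gt0 M0 N0; split=> //.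
    exists (b *+ N); split.
      have := monoidMn (x := row_mx a b) N (monoid2P mR).
      by rewrite !linearMn /= row_mxKl row_mxKr; apply.
    have -> : b *+ N = b' *+ M.
      apply: toQ_inj; rewrite !toQMn -e2 -e3 !scalerA.
      by rewrite -!natrM mulnC.
    have := monoidMn (x := row_mx b' c) M (monoid2P mS).
    by rewrite !linearMn /= row_mxKl row_mxKr; apply.
  rewrite !toQMn -e1 -e4 -{1}[v]hsubmxK scale_row_mx !scalerA.
  by rewrite !natrM [_ * N%:R]mulrC.
move=> /qcone2P[M [a [c [M0 [b [Rab Sbc]]]]]].
rewrite -{1}[v]hsubmxK scale_row_mx => /eq_row_mx[e1 e2].
have hM : M%:R != 0 :> rat by rewrite pnatr_eq0 -lt0n.
exists (M%:R^-1 *: toQ b); split; apply/qcone2P.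
  by exists M, a, b; rewrite scale_row_mx scalerA divff // scale1r e1.
by exists M, b, c; rewrite scale_row_mx scalerA divff // scale1r e2.
Qed.

Lemma tame_nonneg n : tame (qcone (fun _ : 'rV[nat]_n => True)).
Proof.
apply: tame_ext (tame_cone 1%:M) => v; rewrite cone1; split.
  by move=> /nonneg_clear_denoms[M [x [M0 e]]]; exists M, x.
move=> [M [x [M0 _ e]]] i j; have := toQ_ge0 x i j.
by rewrite -e mxE pmulr_rge0 // ltr0n.
Qed.

(** Vanishing on the coordinates in [P], written as a kernel as [tame] requires. *)
Definition coord_ker n (P : pred 'I_n) : 'M[rat]_n := diag_mx (\row_j (P j)%:R).

Lemma coord_kerP n (P : pred 'I_n) (v : 'rV[rat]_n) :
  v *m coord_ker P = 0 <-> forall j, P j -> v 0 j = 0.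
Proof.
have E j : (v *m coord_ker P) 0 j = v 0 j * (P j)%:R by rewrite mul_mx_diag !mxE.
split=> [/rowP h j Pj|h]; first by have := h j; rewrite E Pj mulr1 mxE.
by apply/rowP=> j; rewrite E mxE; case Pj: (P j); rewrite ?mulr0 // h ?mul0r.
Qed.

(** * Systems of runs *)

Lemma rel_comps_cat T (r s : seq (relation T)) x z :
  rel_comps (r ++ s) x z <-> exists y, rel_comps r x y /\ rel_comps s y z.
Proof.
elim: r x => [|R r IH] x /=.
  by split=> [h|[y [->]]] //; exists x.
split.
  by move=> [u [h /IH[y [h1 h2]]]]; exists y; split=> //; exists u.
by move=> [y [[u [h1 h2]] h3]]; exists u; split=> //; apply/IH; exists y.
Qed.

Section Systems.

Variables (d : nat) (E : finType) (eff : E -> 'rV[int]_d) (pri : E -> 'I_d.+1).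

Local Notation vec := 'rV[nat]_d.

Definition in_zone (g : nat) (x : vec) : Prop := forall j : 'I_d, (j < g)%N -> x 0 j = 0%N.

Definition edge_rel (e : E) (x y : vec) : Prop :=
  in_zone (pri e) x /\ map_mx Posz y = map_mx Posz x + eff e.

Definition word_rel (w : seq E) : relation vec := rel_comps [seq edge_rel e | e <- w].

Definition word_star (w : seq E) : relation vec := clos_refl_trans vec (word_rel w).

Definition flat_rel (ws : seq (seq E)) : relation vec :=
  rel_comps [seq word_star w | w <- ws].

Lemma in_zone0 g : in_zone g 0.
Proof. by move=> j _; rewrite mxE. Qed.

Lemma in_zoneD g x y : in_zone g (x + y) <-> in_zone g x /\ in_zone g y.
Proof.
split=> [h|[hx hy] j hj]; last by rewrite mxE hx // hy.
by split=> j /h; rewrite mxE => /eqP; rewrite nat_addE addn_eq0 => /andP[/eqP ? /eqP].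
Qed.

Lemma in_zoneMn g x k : in_zone g x -> in_zone g (x *+ k).
Proof. by move=> h j hj; rewrite !vecE h. Qed.

Lemma in_zone_sum g (I : finType) (F : I -> vec) :
  (forall i, in_zone g (F i)) -> in_zone g (\sum_i F i).
Proof.
by move=> h; elim/big_ind: _ => [|x y hx hy|//]; [exact: in_zone0|apply/in_zoneD].
Qed.

Lemma in_zone_le g g' x : (g' <= g)%N -> in_zone g x -> in_zone g' x.
Proof. by move=> hg h j hj; apply: h; exact: leq_trans hj hg. Qed.

Lemma word_rel_cat w w' x z :
  word_rel (w ++ w') x z <-> exists y, word_rel w x y /\ word_rel w' y z.
Proof. by rewrite /word_rel map_cat; exact: rel_comps_cat. Qed.

Lemma flat_rel_cat ws ws' x z :
  flat_rel (ws ++ ws') x z <-> exists y, flat_rel ws x y /\ flat_rel ws' y z.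
Proof. by rewrite /flat_rel map_cat; exact: rel_comps_cat. Qed.

Lemma flat_rel1 w x y : flat_rel [:: w] x y <-> word_star w x y.
Proof. by split=> [[z [h <-]]|h] //; exists y. Qed.

Lemma word_star_iter w (f : nat -> vec) n :
  (forall i, (i < n)%N -> word_rel w (f i) (f i.+1)) -> word_star w (f 0%N) (f n).
Proof.
elim: n => [|n IH] h; first exact: rt_refl.
apply: rt_trans (IH _) (rt_step _ _ _ _ (h n _)) => // i hi; apply: h; exact: ltnW.
Qed.

(* The objects stand for runs from [src] to [tgt].  Amalgamation makes the
   increments [inc a] of a run [a] a monoid. *)
Record sys := Sys {
  obj : Type;
  src : obj -> vec;
  tgt : obj -> vec;
  le : obj -> obj -> Prop
}.

Definition inc (S : sys) (a : obj S) (x y : vec) : Prop :=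
  exists b, [/\ le a b, src b = src a + x & tgt b = tgt a + y].

Record good (g : nat) (S : sys) : Prop := Good {
  sys_refl : forall a : obj S, le a a;
  sys_trans : forall a b c : obj S, le a b -> le b c -> le a c;
  le_inc : forall a b : obj S, le a b -> exists x y, src b = src a + x /\ tgt b = tgt a + y;
  wqo_le : wqo (@le S);
  shift : forall (a : obj S) z, in_zone g z -> inc a z z;
  amalg : forall a b c : obj S, le a b -> le a c -> exists e,
    [/\ le b e, le c e, src e + src a = src b + src c & tgt e + tgt a = tgt b + tgt c];
  has_word : forall a : obj S, exists w, forall z, in_zone g z ->
    word_rel w (src a + z) (tgt a + z);
  flat : forall (a : obj S) k (p q : 'I_k -> vec), (forall i, inc a (p i) (q i)) ->
    exists ws, forall n : 'I_k -> nat,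
      flat_rel ws (src a + \sum_i p i *+ n i) (tgt a + \sum_i q i *+ n i);
  tame_inc : forall a : obj S, tame (qcone2 (inc a))
}.

Lemma good_le g g' S : (g <= g')%N -> good g S -> good g' S.
Proof.
move=> hg [h1 h2 h3 h4 h5 h6 h7 h8 h9]; split=> //.
  by move=> a z /(in_zone_le hg); exact: h5.
by move=> a; have [w hw] := h7 a; exists w => z /(in_zone_le hg); exact: hw.
Qed.

Lemma inc_monoid g S (a : obj S) : good g S -> monoid2 (inc a).
Proof.
move=> gS; split; first by exists a; rewrite !addr0; split=> //; exact: sys_refl gS a.
move=> x y x' y' [b [ab sb tb]] [c [ac sc tc]].
have [e [be ce se te]] := amalg gS ab ac.
exists e; split; [exact (sys_trans gS ab be) | | ]; vnat.
Qed.

Definition id_sys : sys := @Sys vec id id (@vle d).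

Lemma inc_idP (a : obj id_sys) x y : inc a x y <-> x = y.
Proof.
split=> [[b [_ /= -> h]]|->]; first vnat.
by exists (a + y); split=> //; exists y.
Qed.

Lemma good_id : good 0 id_sys.
Proof.
split=> //=.
- exact: vle_refl.
- exact: vle_trans.
- by move=> a b [z ->]; exists z, z.
- exact: wqo_vec.
- by move=> a z _; apply/inc_idP.
- move=> a b c [x ->] [y ->]; exists (a + x + y); split; try vnat.
  + by exists y.
  + by exists x; vnat.
- by move=> a; exists [::].
- move=> a k p q h; exists [::] => n; rewrite /flat_rel /=; congr (_ + _).
  by apply: eq_bigr => i _; have /inc_idP -> := h i.
- move=> a; apply: tame_ext (tame_cone (row_mx 1%:M 1%:M)) => v; split.
    move=> [u /nonneg_clear_denoms[M [x [M0 ex]]] ->]; apply/qcone2P.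
    by exists M, x, x; rewrite mul_mx_row !mulmx1 scale_row_mx ex; split=> //; apply/inc_idP.
  move=> /qcone2P[M [x [y [M0 /inc_idP -> e]]]].
  exists (M%:R^-1 *: toQ y); first by apply: nonnegZ (toQ_ge0 _); rewrite invr_ge0.
  rewrite mul_mx_row !mulmx1 -scale_row_mx -e scalerA mulVf ?scale1r //.
  by rewrite pnatr_eq0 -lt0n.
Qed.

Definition sum_sys (S1 S2 : sys) : sys := @Sys (obj S1 + obj S2)
  (fun a => match a with inl a => src a | inr a => src a end)
  (fun a => match a with inl a => tgt a | inr a => tgt a end)
  (fun a b => match a, b with
     | inl a, inl b => le a b | inr a, inr b => le a b | _, _ => False end).

Lemma inc_suml (S1 S2 : sys) (a : obj S1) x y :
  inc (S := sum_sys S1 S2) (inl a) x y <-> inc a x y.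
Proof. by split=> [[[b|b] [] //= *]|[b [*]]]; [exists b | exists (inl b)]. Qed.

Lemma inc_sumr (S1 S2 : sys) (a : obj S2) x y :
  inc (S := sum_sys S1 S2) (inr a) x y <-> inc a x y.
Proof. by split=> [[[b|b] [] //= *]|[b [*]]]; [exists b | exists (inr b)]. Qed.

Lemma good_sum g S1 S2 : good g S1 -> good g S2 -> good g (sum_sys S1 S2).
Proof.
move=> g1 g2; split.
- by case=> a /=; [exact: sys_refl g1 a | exact: sys_refl g2 a].
- by move=> [a|a] [b|b] [c|c] //=; [exact: (sys_trans g1) | exact: (sys_trans g2)].
- by move=> [a|a] [b|b] //=; [exact: (le_inc g1) | exact: (le_inc g2)].
- exact: wqo_sum (wqo_le g1) (wqo_le g2).
- move=> [a|a] z hz; [apply/inc_suml; exact: (shift g1)|apply/inc_sumr; exact: (shift g2)].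
- move=> [a|a] [b|b] [c|c] //= ab ac.
    by have [e he] := amalg g1 ab ac; exists (inl e).
  by have [e he] := amalg g2 ab ac; exists (inr e).
- by move=> [a|a]; [exact: (has_word g1) | exact: (has_word g2)].
- move=> [a|a] k p q h.
    by apply: (flat g1) => i; apply/(@inc_suml S1 S2).
  by apply: (flat g2) => i; apply/(@inc_sumr S1 S2).
- move=> [a|a].
    apply: tame_ext (tame_inc g1 a) => v; apply: qcone2_ext => x y.
    by rewrite inc_suml.
  apply: tame_ext (tame_inc g2 a) => v; apply: qcone2_ext => x y.
  by rewrite inc_sumr.
Qed.

Record comp_obj (S1 S2 : sys) := CompObj {
  fst_obj : obj S1;
  snd_obj : obj S2;
  comp_eq : tgt fst_obj = src snd_obj
}.

Definition comp_sys (S1 S2 : sys) : sys := @Sys (comp_obj S1 S2)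
  (fun a => src (fst_obj a)) (fun a => tgt (snd_obj a))
  (fun a b => le (fst_obj a) (fst_obj b) /\ le (snd_obj a) (snd_obj b)).

Lemma inc_compP g (S1 S2 : sys) (a : obj (comp_sys S1 S2)) x z : good g S1 ->
  inc a x z <-> exists y, inc (fst_obj a) x y /\ inc (snd_obj a) y z.
Proof.
move=> g1; split.
  move=> [b [[/= ab1 ab2] sb tb]].
  have [x' [y [sb' tb']]] := le_inc g1 ab1.
  exists y; split; [by exists (fst_obj b) | exists (snd_obj b)].
  by split=> //; rewrite -!comp_eq.
move=> [y [[b [ab sb tb]] [c [ac sc tc]]]].
have e : tgt b = src c by rewrite tb sc comp_eq.
by exists (CompObj e).
Qed.

Lemma good_comp g S1 S2 : good g S1 -> good g S2 -> good g (comp_sys S1 S2).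
Proof.
move=> g1 g2; split.
- by move=> a; split; [exact (sys_refl g1 _) | exact (sys_refl g2 _)].
- move=> a b c [ab1 ab2] [bc1 bc2].
  by split; [exact (sys_trans g1 ab1 bc1) | exact (sys_trans g2 ab2 bc2)].
- move=> a b [/(le_inc g1)[x [y [sb _]]] /(le_inc g2)[x' [y' [_ tb]]]].
  by exists x, y'.
- apply: (wqo_map (h := fun a => (fst_obj a, snd_obj a)))
    (wqo_prod _ (wqo_le g1) (wqo_le g2)) => //.
  exact (@sys_trans _ _ g1).
- move=> a z hz; apply/(inc_compP _ _ _ g1); exists z.
  by split; [exact (shift g1 _ hz) | exact (shift g2 _ hz)].
- move=> a b c [ab1 ab2] [ac1 ac2].
  have [e1 [be1 ce1 se1 te1]] := amalg g1 ab1 ac1.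
  have [e2 [be2 ce2 se2 te2]] := amalg g2 ab2 ac2.
  have e : tgt e1 = src e2.
    have ea := comp_eq a; have eb := comp_eq b; have ec := comp_eq c.
    by vnat.
  by exists (CompObj e).
- move=> a; have [w1 hw1] := has_word g1 (fst_obj a).
  have [w2 hw2] := has_word g2 (snd_obj a).
  exists (w1 ++ w2) => z hz; apply/word_rel_cat.
  exists (tgt (fst_obj a) + z); split; first exact: hw1.
  by rewrite comp_eq; exact: hw2.
- move=> a k p q h.
  have /fin_all_exists[y hy] : forall i, exists y,
      inc (fst_obj a) (p i) y /\ inc (snd_obj a) y (q i).
    by move=> i; apply/(inc_compP _ _ _ g1).
  have [ws1 h1] := flat g1 (fun i => (hy i).1).
  have [ws2 h2] := flat g2 (fun i => (hy i).2).
  exists (ws1 ++ ws2) => n; apply/flat_rel_cat.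
  by eexists; split; [exact: h1 | rewrite comp_eq; exact: h2].
- move=> a.
  apply: tame_ext (tame_relcomp (inc_monoid _ g1) (inc_monoid _ g2)
    (tame_inc g1 (fst_obj a)) (tame_inc g2 (snd_obj a))) => v.
  by apply: qcone2_ext => x y; rewrite (inc_compP _ _ _ g1).
Qed.

Record pre_obj (g : nat) (S : sys) := PreObj {
  pre_edge : E;
  pre_src : vec;
  pre_rest : obj S;
  pre_pri : pri pre_edge = g :> nat;
  pre_rel : edge_rel pre_edge pre_src (src pre_rest)
}.

Definition pre_sys (g : nat) (S : sys) : sys := @Sys (pre_obj g S)
  (fun a => pre_src a) (fun a => tgt (pre_rest a))
  (fun a b => pre_edge a = pre_edge b /\ le (pre_rest a) (pre_rest b)).

Lemma pre_zone g S (a : pre_obj g S) : in_zone g (pre_src a).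
Proof. by have [h _] := pre_rel a; move: h; rewrite pre_pri. Qed.

(** The edge adds the same vector to both sources and so transports an increment unchanged; its test
    adds the requirement that the increment at the source lie in the zone. *)
Lemma inc_preP g g' S (a : obj (pre_sys g S)) x y : good g' S ->
  inc a x y <-> inc (pre_rest a) x y /\ in_zone g x.
Proof.
move=> gS; have [za ea] := pre_rel a; split.
  move=> [b [/= [eab ab] sb tb]]; split; last first.
    by have := pre_zone b; rewrite sb => /in_zoneD[].
  exists (pre_rest b); split=> //.
  have [_] := pre_rel b; rewrite -eab => eb.
  by vnat.
move=> [[b [ab sb tb]] zx].
have eb : edge_rel (pre_edge a) (pre_src a + x) (src b).
  split; last by rewrite sb; vnat.
  by apply/in_zoneD; rewrite pre_pri -{1}(pre_pri a).
by exists (PreObj (pre_pri a) eb).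
Qed.

Lemma good_pre g S : good g S -> good g (pre_sys g S).
Proof.
move=> gS; split.
- by move=> a; split=> //; exact (sys_refl gS _).
- move=> a b c [e1 ab] [e2 bc]; split; first exact (etrans e1 e2).
  exact (sys_trans gS ab bc).
- move=> a b [eab /(le_inc gS)[x [y [sb tb]]]]; exists x, y; split=> //=.
  have [_ ha] := pre_rel a; have [_] := pre_rel b; rewrite -eab => hb.
  by vnat.
- apply: (wqo_map (h := fun a => (pre_edge a, pre_rest a)))
    (wqo_prod _ (@wqo_fin E) (wqo_le gS)) => //.
  by move=> ? ? ? -> ->.
- by move=> a z hz; apply/(inc_preP _ _ _ gS); split=> //; exact (shift gS _ hz).
- move=> a b c [eab ab] [eac ac].
  have [e [be ce se te]] := amalg gS ab ac.
  have [_ ha] := pre_rel a; have [zb] := pre_rel b; rewrite -eab => hb.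
  have [_] := pre_rel c; rewrite -eac => hc.
  have [x [y [sb _]]] := le_inc gS ab.
  have sb' : pre_src b = pre_src a + x by vnat.
  have he : edge_rel (pre_edge a) (pre_src c + x) (src e).
    split; last by vnat.
    rewrite eac; apply/in_zoneD; split; first by have [] := pre_rel c.
    by move: zb; rewrite -eab eac sb' => /in_zoneD[].
  exists (PreObj (pre_pri a) he); split=> //=; vnat.
- move=> a; have [w hw] := has_word gS (pre_rest a).
  exists (pre_edge a :: w) => z hz; exists (src (pre_rest a) + z); split; last exact: hw.
  have [za ha] := pre_rel a; split; last by vnat.
  by apply/in_zoneD; split=> //; rewrite pre_pri.
- move=> a k p q h.
  have hp i : inc (pre_rest a) (p i) (q i) by have /(inc_preP _ _ _ gS)[] := h i.
  have [ws hws] := flat gS hp.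
  (* Words of a flat relation are starred; one iteration of the one-edge word performs the test. *)
  exists ([:: pre_edge a] :: ws) => n.
  exists (src (pre_rest a) + \sum_i p i *+ n i); split; last exact: hws.
  apply: rt_step; eexists; split; last reflexivity.
  have [za ha] := pre_rel a; split; last by vnat.
  apply/in_zoneD; split=> //; apply: in_zone_sum => i.
  by rewrite pre_pri; apply: in_zoneMn; have /(inc_preP _ _ _ gS)[] := h i.
- move=> a.
  have tS := tame_ker (col_mx (coord_ker (fun j : 'I_d => (j < g)%N)) (0 : 'M_d)) (tame_inc gS (pre_rest a)).
  have Z v : v *m (col_mx (coord_ker (fun j : 'I_d => (j < g)%N)) (0 : 'M_d)) =
      lsubmx v *m coord_ker (fun j : 'I_d => (j < g)%N).
    by rewrite -{1}[v]hsubmxK mul_row_col mulmx0 addr0.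
  apply: tame_ext tS => v; rewrite Z; split.
    move=> [/qcone2P[M [x [y [M0 Rxy e]]]] /coord_kerP hv].
    apply/qcone2P; exists M, x, y; split=> //; apply/(inc_preP _ _ _ gS); split=> // j hj.
    move: e; rewrite -{1}[v]hsubmxK scale_row_mx => /eq_row_mx[/rowP/(_ j) e _].
    move: e; rewrite mxE hv // mulr0 mxE => /esym/eqP.
    by rewrite pnatr_eq0 => /eqP.
  move=> /qcone2P[M [x [y [M0 /(inc_preP _ _ _ gS)[Rxy hx] e]]]].
  split; first by apply/qcone2P; exists M, x, y.
  apply/coord_kerP => j hj; move: e; rewrite -{1}[v]hsubmxK scale_row_mx.
  move=> /eq_row_mx[/rowP/(_ j) e _]; move: e; rewrite !mxE hx // => /eqP.
  by rewrite mulf_eq0 pnatr_eq0 -leqn0 leqNgt M0 /= => /eqP.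
Qed.

End Systems.

(** * Chains of letters *)

Section Chains.

Variables (d : nat) (E : finType) (eff : E -> 'rV[int]_d) (pri : E -> 'I_d.+1).
Variables (g : nat) (L : sys d).
Hypothesis gL : good eff pri g L.

Local Notation vec := 'rV[nat]_d.
Local Notation zone := (@in_zone d g).

(** Only the configurations between letters, both ends included, must lie in the zone; inside a
    letter the tested coordinates may be nonzero. *)
Fixpoint chain (p : vec) (l : seq (obj L)) (p' : vec) : Prop :=
  match l with
  | [::] => zone p /\ p = p'
  | a :: l' => [/\ zone p, src a = p & chain (tgt a) l' p']
  end.

Definition arrow (p p' : vec) : Prop := exists l, chain p l p'.

Lemma chain_src p l p' : chain p l p' -> zone p.
Proof. by case: l => [|a l] []. Qed.

Lemma chain_tgt p l p' : chain p l p' -> zone p'.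
Proof. by elim: l p => [|a l IH] p /=; [move=> [h <-] | move=> [_ _ /IH]]. Qed.

Lemma chain_cat p l q l' r : chain p l q -> chain q l' r -> chain p (l ++ l') r.
Proof.
elim: l p => [|a l IH] p /=; first by move=> [_ ->].
by move=> [hp ea h] h'; split=> //; exact: IH.
Qed.

Lemma chain_split p l l' r : chain p (l ++ l') r -> exists q, chain p l q /\ chain q l' r.
Proof.
elim: l p => [|a l IH] p /=; first by move=> h; exists p; split=> //; split=> //; exact: chain_src h.
by move=> [hp ea /IH[q [h1 h2]]]; exists q.
Qed.

Lemma chain_shift p l p' z : chain p l p' -> zone z ->
  exists l', chain (p + z) l' (p' + z) /\ emb (@le d L) l l'.
Proof.
move=> + hz; elim: l p => [|a l IH] p /=.
  by move=> [hp <-]; exists [::]; split; [split=> //; apply/in_zoneD | constructor].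
move=> [hp ea /IH[l' [h1 h2]]].
have [b [ab sb tb]] := shift gL a hz.
exists (b :: l'); split; last by constructor.
by split; [apply/in_zoneD | rewrite sb ea | rewrite tb].
Qed.

Lemma arrow_refl p : zone p -> arrow p p.
Proof. by move=> hp; exists [::]. Qed.

Lemma arrow_trans p q r : arrow p q -> arrow q r -> arrow p r.
Proof. by move=> [l h] [l' h']; exists (l ++ l'); exact: chain_cat h h'. Qed.

Lemma arrow_shift p p' z : arrow p p' -> zone z -> arrow (p + z) (p' + z).
Proof. by move=> [l h] hz; have [l' [h' _]] := chain_shift h hz; exists l'. Qed.

Lemma arrow_letter (a : obj L) : zone (src a) -> zone (tgt a) -> arrow (src a) (tgt a).
Proof. by move=> hs ht; exists [:: a]. Qed.

Lemma arrow_zone p p' : arrow p p' -> zone p /\ zone p'.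
Proof. by move=> [l h]; split; [exact: chain_src h | exact: chain_tgt h]. Qed.

(** The increments of the empty chain at [c]: what can be inserted between two letters of a
    chain. *)
Definition gap (c x y : vec) : Prop := arrow (c + x) (c + y).

Lemma gap_zone c x y : gap c x y -> [/\ zone c, zone x & zone y].
Proof. by move=> /arrow_zone[/in_zoneD[? ?] /in_zoneD[]]. Qed.

Lemma gap_shift c x y z : gap c x y -> zone z -> gap c (x + z) (y + z).
Proof. by move=> h hz; rewrite /gap !addrA; exact: arrow_shift. Qed.

Lemma gap_monoid c : zone c -> monoid2 (gap c).
Proof.
move=> hc; split; first by apply: arrow_refl; rewrite addr0.
move=> x y x' y' h h'.
have [_ _ hy] := gap_zone h; have [_ hx' _] := gap_zone h'.
apply: arrow_trans (gap_shift h hx') _.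
by have := gap_shift h' hy; rewrite [x' + _]addrC [y' + _]addrC.
Qed.

Lemma chain_word p l p' : chain p l p' ->
  exists w, forall z, zone z -> word_rel eff pri w (p + z) (p' + z).
Proof.
elim: l p => [|a l IH] p /=; first by move=> [_ <-]; exists [::].
move=> [hp ea /IH[w hw]]; have [w' hw'] := has_word gL a.
exists (w' ++ w) => z hz; apply/word_rel_cat; exists (tgt a + z).
by split; [rewrite -ea; exact: hw' | exact: hw].
Qed.

(** One word per pump suffices: the copies of [p i] are turned into copies of [q i] one index after
    the other, everything else being carried along as a translation inside the zone. *)
Lemma gap_flat c k (p q : 'I_k -> vec) : (forall i, gap c (p i) (q i)) ->
  exists ws, forall (n : 'I_k -> nat) z, zone z ->
    flat_rel eff pri ws (c + \sum_i p i *+ n i + z) (c + \sum_i q i *+ n i + z).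
Proof.
elim: k p q => [|k IH] p q h.
  by exists [::] => n z _; rewrite !big_ord0.
have [ws hws] := IH _ _ (fun i => h (widen_ord (leqnSn k) i)).
have [l hl] := h ord_max; have [w hw] := chain_word hl.
have [_ hp hq] := gap_zone (h ord_max).
exists (ws ++ [:: w]) => n z hz; apply/flat_rel_cat.
have := hws (fun i => n (widen_ord (leqnSn k) i)) (p ord_max *+ n ord_max + z).
rewrite in_zoneD => /(_ (conj (in_zoneMn _ hp) hz)) h1.
eexists; split.
  rewrite big_ord_recr /=; set S := \sum_(i < k) _ in h1 *.
  by have -> : c + (S + p ord_max *+ n ord_max) + z = c + S + (p ord_max *+ n ord_max + z);
    [rewrite !addrA | exact: h1].
apply/flat_rel1; rewrite !big_ord_recr /=.
set S := \sum_(i < k) _; set m := n ord_max.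
(* After [j] iterations of [w], [j] of the [m] copies of the last [p] have become copies of the last
   [q]. *)
pose f j := c + S + z + p ord_max *+ (m - j) + q ord_max *+ j.
have -> : c + S + (p ord_max *+ m + z) = f 0%N by rewrite /f subn0; vnat.
have -> : c + (S + q ord_max *+ m) + z = f m by rewrite /f subnn; vnat.
apply: word_star_iter => j hj.
have hz' : zone (S + z + p ord_max *+ (m - j.+1) + q ord_max *+ j).
  rewrite !in_zoneD; split; last exact: in_zoneMn.
  split; last exact: in_zoneMn.
  split=> //; apply: in_zone_sum => i; apply: in_zoneMn.
  by have [] := gap_zone (h (widen_ord (leqnSn k) i)).
have := hw _ hz'; rewrite /f subnS.
have -> : p ord_max *+ (m - j) = p ord_max *+ (m - j).-1 + p ord_max.
  by rewrite -mulrSr prednK // subn_gt0.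
rewrite mulrSr; congr (word_rel _ _ _ _ _); vnat.
Qed.

End Chains.

(** * The cone of a gap *)

Definition fg n (C : 'rV[rat]_n -> Prop) : Prop :=
  exists q (F : 'M[rat]_(q, n)), forall v, C v <-> cone F v.

Lemma fg_cone m n (F : 'M_(m, n)) : fg (cone F).
Proof. by exists m, F. Qed.

Lemma fg_convex n (C : 'rV_n -> Prop) : fg C -> convex_cone C.
Proof.
move=> [q [F h]]; split=> [|v w /h hv /h hw|c v hc /h hv]; apply/h.
- exact: cone0.
- exact: coneD.
- exact: coneZ.
Qed.

Lemma fg_add n (C D : 'rV_n -> Prop) : fg C -> fg D ->
  fg (fun v => exists x y, [/\ C x, D y & v = x + y]).
Proof.
move=> [q [F h]] [q' [F' h']]; exists _, (col_mx F F') => v; rewrite cone_col_mx.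
by split=> [] [x [y [hx hy ->]]]; exists x, y; split=> //; apply/h || apply/h'.
Qed.

Lemma fg_sum n k (C : 'I_k -> 'rV_n -> Prop) : (forall i, fg (C i)) ->
  fg (fun v => exists2 u, (forall i, C i (u i)) & v = \sum_i u i).
Proof.
elim: k C => [|k IH] C h.
  exists 0%N, 0 => v; split.
    by move=> [u _ ->]; rewrite big_ord0; exact: cone0.
  move=> [u _ ->]; exists (fun _ => 0) => [[]//|]; by rewrite mulmx0 big_ord0.
have [q [F hF]] := fg_add (h ord0) (IH _ (fun i => h (lift ord0 i))).
exists q, F => v; rewrite -hF; split.
  move=> [u hu ->]; exists (u ord0), (\sum_i u (lift ord0 i)).
  by rewrite big_ord_recl; split=> //; exists (fun i => u (lift ord0 i)).
move=> [x [y [hx [u hu ->] ->]]].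
exists (fun i => if unlift ord0 i is Some j then u j else x).
  by move=> i; case: unliftP => [j ->|->].
rewrite big_ord_recl unlift_none; congr (_ + _).
by apply: eq_bigr => i _; rewrite liftK.
Qed.

Lemma fg_sum_in n k (C : 'I_k -> 'rV[rat]_n -> Prop) i v : (forall i, fg (C i)) ->
  C i v -> exists2 u, (forall i, C i (u i)) & v = \sum_i u i.
Proof.
move=> h Cv; exists (fun j => if j == i then v else 0).
  by move=> j; case: eqP => [->//|_]; case: (fg_convex (h j)).
by rewrite -big_mkcond big_pred1_eq.
Qed.

Lemma fg_ker n p (C : 'rV_n -> Prop) (K : 'M_(n, p)) : fg C -> fg (fun v => C v /\ v *m K = 0).
Proof.
move=> [q [F h]]; have [q' [G hG]] := cone_ker F K.
by exists q', G => v; rewrite hG h.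
Qed.

Lemma fg_img n p (C : 'rV_n -> Prop) (L : 'M_(n, p)) :
  fg C -> fg (fun w => exists2 v, C v & w = v *m L).
Proof.
move=> [q [F h]]; exists q, (F *m L) => w; split.
  by move=> [v /h Cv ->]; exact: cone_mul.
by move=> /cone_mulP[v /h Cv ->]; exists v.
Qed.

Lemma fg_prod n1 n2 (C : 'rV_n1 -> Prop) (D : 'rV_n2 -> Prop) :
  fg C -> fg D -> fg (fun v => C (lsubmx v) /\ D (rsubmx v)).
Proof.
move=> fC fD.
have [q [F h]] := fg_add (fg_img (row_mx 1%:M 0) fC) (fg_img (row_mx 0 1%:M) fD).
exists q, F => v; rewrite -h; split.
  move=> [Cv Dv]; exists (row_mx (lsubmx v) 0), (row_mx 0 (rsubmx v)).
  rewrite add_row_mx addr0 add0r hsubmxK; split=> //.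
    by exists (lsubmx v); rewrite // mul_mx_row mulmx1 mulmx0.
  by exists (rsubmx v); rewrite // mul_mx_row mulmx1 mulmx0.
move=> [x [y [[a Ca ->] [b Db ->] ->]]].
by rewrite !mul_mx_row !mulmx1 !mulmx0 add_row_mx addr0 add0r row_mxKl row_mxKr.
Qed.

Lemma fg_nonneg n : fg (@nonneg 1 n).
Proof. by exists n, 1%:M => v; rewrite cone1. Qed.

Definition qhull n (G : 'rV[rat]_n -> Prop) (v : 'rV[rat]_n) : Prop :=
  exists2 M : nat, (0 < M)%N & G (M%:R *: v).

Lemma qhull_mul n (G : 'rV[rat]_n -> Prop) (M : nat) v :
  G 0 -> (forall v w, G v -> G w -> G (v + w)) -> G v -> G (M%:R *: v).
Proof.
move=> G0 GD Gv; elim: M => [|M IH]; first by rewrite scale0r.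
by rewrite -natr1 scalerDl scale1r; exact: GD.
Qed.

Lemma convex_qhull n (G : 'rV[rat]_n -> Prop) :
  G 0 -> (forall v w, G v -> G w -> G (v + w)) -> convex_cone (qhull G).
Proof.
move=> G0 GD; split.
- by exists 1%N; rewrite ?scaler0.
- move=> v w [M M0 Gv] [N N0 Gw]; exists (M * N)%N; first by rewrite muln_gt0 M0.
  rewrite scalerDr {1}mulnC !natrM -!scalerA.
  by apply: (GD); exact: qhull_mul.
- move=> c v hc [M M0 Gv].
  have /nonneg_clear_denoms[N [x [N0 /rowP/(_ 0)]]] : nonneg (c%:M : 'rV_1).
    by move=> i j; rewrite !ord1 mxE eqxx mulr1n.
  rewrite !mxE eqxx mulr1n => e; exists (N * M)%N; first by rewrite muln_gt0 N0.
  have -> : (N * M)%:R *: (c *: v) = (x 0 0)%:R *: (M%:R *: v).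
    by rewrite !scalerA -e natrM; congr (_ *: _); ring.
  exact: qhull_mul.
Qed.

Lemma not_uniq_split (T : eqType) (s : seq T) :
  ~~ uniq s -> exists i s1 s2 s3, s = s1 ++ i :: s2 ++ i :: s3.
Proof.
elim: s => //= a s IH; rewrite negb_and negbK => /orP[|/IH].
  by case/splitPr => s2 s3; exists a, [::], s2, s3.
by move=> [i [s1 [s2 [s3 ->]]]]; exists i, (a :: s1), s2, s3.
Qed.

(** * Bounded coordinates and cyclic moves *)

Section Occurrences.

Variables (d : nat) (E : finType) (eff : E -> 'rV[int]_d) (pri : E -> 'I_d.+1).
Variables (g : nat) (L : sys d).
Hypothesis gL : good eff pri g L.

Local Notation vec := 'rV[nat]_d.
Local Notation zone := (@in_zone d g).
Local Notation arrow := (@arrow d g L).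
Local Notation gap := (@gap d g L).

Variables (c : vec) (p : nat) (K : 'M[rat]_(d + d, p)).
Hypothesis zc : zone c.

Definition kgap (x y : vec) : Prop := gap c x y /\ row_mx (toQ x) (toQ y) *m K = 0.

Lemma kgap_monoid : monoid2 kgap.
Proof.
have [G0 GD] := gap_monoid gL zc; split.
  by split=> //; rewrite toQ0 row_mx0 mul0mx.
move=> x y x' y' [h1 k1] [h2 k2]; split; first exact: GD.
by rewrite !toQD -add_row_mx mulmxDl k1 k2 addr0.
Qed.

(* The configurations on a run of [c] whose increment lies in [ker K]: only a
   coordinate that they leave unbounded can be pumped inside [ker K]. *)
Definition occ (q : vec) : Prop :=
  exists x y, [/\ kgap x y, arrow (c + x) q & arrow q (c + y)].

Definition bounded (i : 'I_d) : Prop := exists B, forall q, occ q -> (q 0%R i <= B)%N.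

Lemma occ_zone q : occ q -> zone q.
Proof. by move=> [x [y [_ /arrow_zone[]]]]. Qed.

Lemma zone_bounded (i : 'I_d) : (i < g)%N -> bounded i.
Proof. by move=> hi; exists 0%N => q /occ_zone ->. Qed.

(** Monoid multiples of the run make [c + T *+ B.+1] an occurrence, which exceeds the bound [B]
    unless [T] vanishes at [i]. *)
Lemma mid_bounded U T R i : gap c U T -> gap c T R -> kgap U R -> bounded i -> T 0 i = 0%N.
Proof.
move=> gUT gTR kUR [B hB]; apply/eqP; rewrite -leqn0 leqNgt; apply/negP=> hT.
have := hB (c + T *+ B.+1); rewrite !vecE => h.
have : (c 0%R i + T 0%R i * B.+1 <= B)%N.
  apply: h; exists (U *+ B.+1), (R *+ B.+1); split.
  - exact: monoid2Mn kgap_monoid kUR.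
  - exact: monoid2Mn (gap_monoid gL zc) gUT.
  - exact: monoid2Mn (gap_monoid gL zc) gTR.
by nia.
Qed.

Lemma kgap_bounded x y i : kgap x y -> bounded i -> x 0 i = 0%N /\ y 0 i = 0%N.
Proof.
move=> k bi; have [gxy _] := k; have [_ zx zy] := gap_zone gxy.
have refl z : zone z -> gap c z z.
  by move=> hz; apply: arrow_refl; apply/in_zoneD.
by split; [exact: mid_bounded (refl _ zx) gxy k bi | exact: mid_bounded gxy (refl _ zy) k bi].
Qed.

(** The two runs are crossed. The first half of the run through [q + e], followed by the second half
    of the run through [q], leads from [c + x + x'] to [c + x + y + e]; the first half of the latter
    run and the second half of the former then lead to [c + y + y']. *)
Lemma occ_le q e : occ q -> occ (q + e) ->
  exists U T R, [/\ gap c U T, gap c T R, kgap U R & exists x, T = e + x].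
Proof.
move=> [x [y [kxy a1 a2]]] [x' [y' [kxy' b1 b2]]].
have [/gap_zone[_ zx zy] _] := kxy; have [/gap_zone[_ zx' zy'] _] := kxy'.
have [_ /in_zoneD[zq ze]] := arrow_zone b1.
exists (x + x'), (x + y + e), (y + y'); split.
- rewrite /gap (_ : c + (x + x') = c + x' + x); last by vnat.
  apply: arrow_trans (arrow_shift gL b1 zx) _.
  have zex : zone (e + x) by apply/in_zoneD.
  by have := arrow_shift gL a2 zex; congr (arrow _ _); vnat.
- have zye : zone (y + e) by apply/in_zoneD.
  rewrite /gap (_ : c + (x + y + e) = c + x + (y + e)); last by vnat.
  apply: arrow_trans (arrow_shift gL a1 zye) _.
  rewrite (_ : q + (y + e) = q + e + y); last by vnat.
  by have := arrow_shift gL b2 zy; congr (arrow _ _); vnat.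
- by have [_ kD] := kgap_monoid; exact: kD.
- by exists (x + y); vnat.
Qed.

Lemma occ_le_bounded q e i : occ q -> occ (q + e) -> bounded i -> e 0 i = 0%N.
Proof.
move=> oq oqe bi; have [U [T [R [h1 h2 h3 [x eT]]]]] := occ_le oq oqe.
have := mid_bounded h1 h2 h3 bi; rewrite eT !vecE /=; lia.
Qed.

(** On an unbounded coordinate two comparable occurrences differ strictly, and [occ_le] turns the
    difference into a middle increment; these are summed over the coordinates. *)
Lemma high_mid : exists U T R,
  [/\ gap c U T, gap c T R, kgap U R & forall i, ~ bounded i -> (0 < T 0%R i)%N].
Proof.
have /fin_all_exists[f hf] : forall i, exists t : vec * vec * vec,
    [/\ gap c t.1.1 t.1.2, gap c t.1.2 t.2, kgap t.1.1 t.2 & ~ bounded i -> (0 < t.1.2 0%R i)%N].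
  move=> i; have [bi|nbi] := pselect (bounded i).
    exists (0, 0, 0); have [? _] := gap_monoid gL zc; have [? _] := kgap_monoid.
    by split.
  have /choice[f hf] : forall B, exists q, occ q /\ (B < q 0%R i)%N.
    move=> B; apply: contrapT => h; apply: nbi; exists B => q oq.
    by rewrite leqNgt; apply/negP=> hq; apply: h; exists q.
  have [h hinc hle] := wqo_chain (@vle_trans d) (@wqo_vec d) f.
  (* The occurrence [f (h m)] has more than [h m >= m] at [i], hence more than [f (h 0)] has
     there. *)
  pose m := (f (h 0%N) 0%R i).+1.
  have [e he] := hle 0%N m isT.
  have [o1 _] := hf (h 0%N); have [o2 hm] := hf (h m).
  rewrite he in o2; have [U [T [R [h1 h2 h3 [x eT]]]]] := occ_le o1 o2.
  exists (U, T, R); split=> // _ /=; rewrite eT !vecE /=.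
  move: hm; rewrite he !vecE /=; have := increasing_ge hinc m; rewrite /m; lia.
exists (\sum_i (f i).1.1), (\sum_i (f i).1.2), (\sum_i (f i).2); split.
- by apply: monoid2_sum (gap_monoid gL zc) _ => i; case: (hf i).
- by apply: monoid2_sum (gap_monoid gL zc) _ => i; case: (hf i).
- by apply: monoid2_sum kgap_monoid _ => i; case: (hf i).
- move=> i nbi; case: (hf i) => _ _ _ /(_ nbi) h.
  rewrite summxE (bigD1 i) //= nat_addE; lia.
Qed.

Definition agree (q r : vec) : Prop := forall i, bounded i -> q 0 i = r 0 i.

Lemma agree_refl q : agree q q. Proof. by []. Qed.

Lemma agree_sym q r : agree q r -> agree r q.
Proof. by move=> h i bi; rewrite h. Qed.

Lemma agree_trans q r s : agree q r -> agree r s -> agree q s.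
Proof. by move=> h h' i bi; rewrite h // h'. Qed.

Lemma agreeD (q x : vec) : (forall i, bounded i -> x 0 i = 0%N) -> agree (q + x) q.
Proof. by move=> h i bi; rewrite !vecE h // addn0. Qed.

(* The displacement [v] is realized from [q] to [q'] once the unbounded
   coordinates are large enough, whatever their values. *)
Definition move (q q' : vec) (v : 'rV[rat]_d) : Prop :=
  exists H : nat, forall r, zone r -> agree r q ->
    (forall i, ~ bounded i -> (H <= r 0%R i)%N) ->
    exists r', [/\ arrow r r', toQ r' = toQ r + v & agree r' q'].

Lemma move_agree q q' r r' v : agree q r -> agree q' r' -> move q q' v -> move r r' v.
Proof.
move=> h h' [H hH]; exists H => s zs as_ hs.
have [s' [h1 h2 h3]] := hH s zs (agree_trans as_ (agree_sym h)) hs.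
by exists s'; split=> //; exact: agree_trans h3 h'.
Qed.

Lemma move0 q : move q q 0.
Proof. by exists 0%N => r zr ar _; exists r; rewrite addr0; split=> //; exact: arrow_refl. Qed.

Lemma move_comp q r s v w : move q r v -> move r s w -> move q s (v + w).
Proof.
move=> [H hH] [H' hH']; have [N hN] := rat_ub v.
exists (H + H' + N)%N => x zx ax hx.
have [y [xy ey ay]] : exists y, [/\ arrow x y, toQ y = toQ x + v & agree y r].
  by apply: hH => // i /hx; lia.
have [_ zy] := arrow_zone xy.
have [z [yz ez az]] : exists z, [/\ arrow y z, toQ z = toQ y + w & agree z s].
  apply: hH' => // i /hx hxi; move/rowP/(_ i): ey; rewrite !mxE => e.
  have := hN i; rewrite -(ler_nat rat) ler_norml => /andP[hv _].
  have : (H + H' + N)%:R <= (x 0 i)%:R :> rat by rewrite ler_nat.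
  by rewrite !natrD e; have : 0 <= H%:R :> rat by []; lra.
by exists z; split=> //; [exact: arrow_trans xy yz | rewrite ez ey addrA].
Qed.

Lemma move_arrow q q' : arrow q q' -> move q q' (toQ q' - toQ q).
Proof.
move=> h; have [zq _] := arrow_zone h.
exists (\sum_i q 0%R i)%N => r zr ar hr.
have [w ew] : vle q r.
  apply/vleP=> i; have [bi|/hr] := pselect (bounded i); first by rewrite ar.
  by apply: leq_trans; rewrite (bigD1 i) //= leq_addr.
have zw : zone w by move: zr; rewrite ew => /in_zoneD[].
exists (q' + w); rewrite ew; split; first exact (arrow_shift gL h zw).
  by rewrite !toQD; apply/rowP=> i; rewrite !mxE; ring.
apply: agreeD => i bi; have := ar i bi; rewrite ew !vecE /=; lia.
Qed.

Definition cycmove (v : 'rV[rat]_d) : Prop := move c c v.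

Lemma cycmoveD v w : cycmove v -> cycmove w -> cycmove (v + w).
Proof. exact: move_comp. Qed.

Lemma convex_cycmove : convex_cone (qhull cycmove).
Proof. exact: convex_qhull (move0 c) cycmoveD. Qed.

End Occurrences.

Section IteratedMoves.

Variables (d : nat) (E : finType) (eff : E -> 'rV[int]_d) (pri : E -> 'I_d.+1).
Variables (g : nat) (L : sys d).
Hypothesis gL : good eff pri g L.

Local Notation vec := 'rV[nat]_d.
Local Notation zone := (@in_zone d g).
Local Notation arrow := (@arrow d g L).
Local Notation gap := (@gap d g L).

Variables (c : vec) (p : nat) (K : 'M[rat]_(d + d, p)).
Hypothesis zc : zone c.

Local Notation kgap := (@kgap d g L c p K).
Local Notation bounded := (@bounded d g L c p K).
Local Notation agree := (@agree d g L c p K).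
Local Notation move := (@move d g L c p K).
Local Notation cycmove := (@cycmove d g L c p K).

Let mK : monoid2 kgap := kgap_monoid gL K zc.
Let mG : monoid2 (gap c) := gap_monoid gL zc.

(* Pump the unbounded coordinates with [high_mid], then perform the cyclic move
   as many times as this height allows. *)
Lemma kgap_of_cycmove : exists s, s *m K = 0 /\ forall x y : 'rV[rat]_d,
  nonneg x -> nonneg y -> (forall i, bounded i -> x 0 i = 0 /\ y 0 i = 0) ->
  row_mx x y *m K = 0 -> qhull cycmove (y - x) -> qcone2 kgap (s + row_mx x y).
Proof.
have [U [T [R [gUT gTR kUR hT]]]] := high_mid gL K zc.
exists (row_mx (toQ U) (toQ R)); split; first by case: kUR.
move=> x y hx hy hb hK [M1 M10 m1].
have [M2 [z [M20 ez]]] : exists (M : nat) z, (0 < M)%N /\ M%:R *: row_mx x y = toQ z.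
  by apply: nonneg_clear_denoms; apply/nonneg_row_mx.
(* [M1] makes the multiple of [y - x] a cyclic move, [M2] clears the denominators. *)
pose M := (M1 * M2)%N; pose a : vec := lsubmx z *+ M1; pose b : vec := rsubmx z *+ M1.
have [ea eb] : toQ a = M%:R *: x /\ toQ b = M%:R *: y.
  move: ez; rewrite scale_row_mx -[z]hsubmxK toQ_row_mx => /eq_row_mx[e1 e2].
  by rewrite !toQMn -e1 -e2 !scalerA -natrM.
clearbody a b.
have M0 : (0 < M)%N by rewrite muln_gt0 M10.
have [ba bb] : (forall i, bounded i -> a 0 i = 0%N) /\ (forall i, bounded i -> b 0 i = 0%N).
  split=> i /hb[xi yi].
    by move/rowP/(_ i): ea; rewrite [in RHS]mxE xi mulr0 mxE => /eqP; rewrite pnatr_eq0 => /eqP.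
  by move/rowP/(_ i): eb; rewrite [in RHS]mxE yi mulr0 mxE => /eqP; rewrite pnatr_eq0 => /eqP.
have zz (u : vec) : (forall i, bounded i -> u 0 i = 0%N) -> zone u.
  by move=> h j hj; apply: h; exact: zone_bounded.
have za := zz _ ba; have zb := zz _ bb.
have [H hH] : cycmove (toQ b - toQ a).
  rewrite ea eb -scalerBr /M natrM mulrC -scalerA.
  apply: qhull_mul => //; [exact: move0 | exact: cycmoveD].
(* With [n] copies of [T] every unbounded coordinate stays at least [H], however many copies of [a]
   have been turned into [b]; the successor keeps [n] positive. *)
pose n := H.+1.
have gTn := monoid2Mn n mG gUT; have gRn := monoid2Mn n mG gTR.
have bT i : bounded i -> T 0 i = 0%N by exact: (mid_bounded gL zc gUT gTR kUR).
have zT := zz _ bT.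
have zan := in_zoneMn n za; have zbn := in_zoneMn n zb; have zTn := in_zoneMn n zT.
have steps j : (j <= n)%N ->
    arrow (c + T *+ n + a *+ n) (c + T *+ n + a *+ (n - j) + b *+ j).
  elim: j => [|j IH] hj.
    rewrite subn0 mulr0n addr0; apply: arrow_refl.
    by apply/in_zoneD; split=> //; apply/in_zoneD.
  apply: arrow_trans (IH (ltnW hj)) _.
  set r := _ + b *+ j.
  have zr : zone r.
    rewrite /r !in_zoneD; do !split=> //; exact: in_zoneMn.
  have ar : agree r c.
    by move=> i bi; rewrite /r !vecE ba // bb // bT // !mul0n !addn0.
  have hr i : ~ bounded i -> (H <= r 0%R i)%N.
    by move=> /hT; rewrite /r !vecE /= /n; nia.
  have [r' [rr' er' _]] := hH r zr ar hr.
  suff <- : r' = c + T *+ n + a *+ (n - j.+1) + b *+ j.+1 by [].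
  apply: toQ_inj; rewrite er' /r.
  have -> : a *+ (n - j) = a *+ (n - j.+1) + a by rewrite -mulrSr -subSn.
  by rewrite [b *+ j.+1]mulrSr !toQD; apply/rowP=> i; rewrite !mxE; ring.
have kn : kgap (U *+ n + a *+ n) (R *+ n + b *+ n).
  split.
    apply: arrow_trans (gap_shift gL gTn zan) _.
    apply: arrow_trans _ (gap_shift gL gRn zbn).
    by have := steps n (leqnn n); rewrite subnn mulr0n addr0 !addrA.
  have [_ kUn] := monoid2Mn n mK kUR.
  rewrite !toQD -add_row_mx mulmxDl kUn add0r !toQMn ea eb -!scale_row_mx.
  by rewrite -!scalemxAl hK !scaler0.
(* The extra copies of [U] and [R] bring their number to [n * M], so that division by [n * M] leaves
   exactly [s] in front of [row_mx x y]. *)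
apply/qcone2P; exists (n * M)%N, (U *+ n + a *+ n + U *+ (n * M - n)), (R *+ n + b *+ n + R *+ (n * M - n)).
split; first by rewrite muln_gt0.
  by apply: (proj2 mK) => //; exact: (monoid2Mn _ mK kUR).
have nM : (n * M - n + n = n * M)%N by rewrite subnK // leq_pmulr.
have eV (V : vec) (w : vec) x' : toQ w = M%:R *: x' ->
    (n * M)%:R *: toQ V + (n * M)%:R *: x' = toQ (V *+ n + w *+ n + V *+ (n * M - n)).
  move=> ew; rewrite -{1}nM natrD !toQD !toQMn ew scalerA -natrM.
  by apply/rowP=> i; rewrite !mxE; ring.
by rewrite scalerDr !scale_row_mx add_row_mx (eV _ _ _ ea) (eV _ _ _ eb).
Qed.

End IteratedMoves.

(** * Displacements of the letters above a given one *)

Section Letters.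

Variables (d : nat) (E : finType) (eff : E -> 'rV[int]_d) (pri : E -> 'I_d.+1).
Variables (g : nat) (L : sys d).
Hypothesis gL : good eff pri g L.

Local Notation vec := 'rV[nat]_d.
Local Notation zone := (@in_zone d g).
Local Notation arrow := (@arrow d g L).

Variables (c : vec) (p : nat) (K : 'M[rat]_(d + d, p)).
Hypothesis zc : zone c.

Local Notation kgap := (@kgap d g L c p K).
Local Notation occ := (@occ d g L c p K).
Local Notation bounded := (@bounded d g L c p K).
Local Notation agree := (@agree d g L c p K).
Local Notation move := (@move d g L c p K).
Local Notation cycmove := (@cycmove d g L c p K).

Let mK : monoid2 kgap := kgap_monoid gL K zc.
Let cK : convex_cone (qcone2 kgap) := convex_qcone (monoid2P mK).
Let cM : convex_cone (qhull cycmove) := @convex_cycmove d g L c p K.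

Definition disp (a : obj L) : 'rV[rat]_d := toQ (tgt a) - toQ (src a).

Definition diff_mx : 'M[rat]_(d + d, d) := col_mx (- 1%:M) 1%:M.

Lemma diff_mxE (v : 'rV[rat]_(d + d)) : v *m diff_mx = rsubmx v - lsubmx v.
Proof. by rewrite -{1}[v]hsubmxK mul_row_col mulmxN !mulmx1 addrC. Qed.

Definition letter_occ (a : obj L) : Prop :=
  exists x y, [/\ kgap x y, arrow (c + x) (src a) & arrow (tgt a) (c + y)].

Lemma letter_occ_zone a : letter_occ a -> zone (src a) /\ zone (tgt a).
Proof. by move=> [x [y [_ /arrow_zone[_ ?] /arrow_zone[? _]]]]. Qed.

Lemma letter_occ_arrow a : letter_occ a -> arrow (src a) (tgt a).
Proof. by move=> /letter_occ_zone[? ?]; exact: arrow_letter. Qed.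

Lemma letter_occ_occ a : letter_occ a -> occ (src a) /\ occ (tgt a).
Proof.
move=> la; have h := letter_occ_arrow la; move: la => [x [y [k h1 h2]]].
split; exists x, y; split=> //; [exact: arrow_trans h h2 | exact: arrow_trans h1 h].
Qed.

Lemma letter_le a b : letter_occ a -> letter_occ b -> le a b ->
  exists x y, [/\ src b = src a + x, tgt b = tgt a + y &
    forall i, bounded i -> x 0 i = 0%N /\ y 0 i = 0%N].
Proof.
move=> la lb /(le_inc gL)[x [y [ex ey]]]; exists x, y; split=> // i bi.
have [a1 a2] := letter_occ_occ la; have [b1 b2] := letter_occ_occ lb.
rewrite ex in b1; rewrite ey in b2.
by split; [exact (occ_le_bounded gL zc a1 b1 bi) | exact (occ_le_bounded gL zc a2 b2 bi)].
Qed.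

Lemma agree_kgap x y : kgap x y -> agree (c + x) c /\ agree (c + y) c.
Proof.
by move=> k; split; apply: agreeD => i /(kgap_bounded gL zc k)[].
Qed.

Lemma zone_agree q r : agree q r -> zone r -> zone q.
Proof. by move=> h zr j hj; rewrite h ?zr //; exact: zone_bounded. Qed.

Lemma cycmove_kgap x y : kgap x y -> cycmove (toQ y - toQ x).
Proof.
move=> k; have [hx hy] := agree_kgap k; have [gxy _] := k.
apply: move_agree hx hy _.
have := move_arrow gL c K gxy.
by congr (move _ _ _); rewrite !toQD opprD addrACA subrr add0r.
Qed.

(* A run passing through the letter [a], with [a] replaced by another move [v]
   between configurations that agree with its ends. *)
Lemma cycmove_subst a q q' v x y :
  kgap x y -> arrow (c + x) (src a) -> arrow (tgt a) (c + y) ->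
  agree (src a) q -> agree (tgt a) q' -> move q q' v ->
  cycmove (toQ y - toQ x + (v - disp a)).
Proof.
move=> k h1 h2 aq aq' hv; have [hx hy] := agree_kgap k.
have m1 := move_agree hx aq (move_arrow gL c K h1).
have m2 := move_agree aq' hy (move_arrow gL c K h2).
have := move_comp m1 (move_comp hv m2).
by congr (move _ _ _); rewrite /disp !toQD; apply/rowP=> i; rewrite !mxE; ring.
Qed.

(** [M] times [v + w] is [M - 1] copies of [v] followed by [v + M w]. *)
Lemma qhull_smaller (v w : 'rV[rat]_d) (M : nat) :
  (0 < M)%N -> cycmove v -> cycmove (v + M%:R *: w) -> qhull cycmove (v + w).
Proof.
move=> M0 hv hw; exists M => //; rewrite scalerDr -{1}(prednK M0) -natr1 scalerDl scale1r -addrA.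
by apply: cycmoveD => //; apply: qhull_mul => //; [exact: move0 | exact: cycmoveD].
Qed.

(* [inc a] is tame on the span of the increments that do occur; the interior
   shift of its sandwich is undone by such increments. *)
Lemma letter_cone a : letter_occ a -> exists C e,
  [/\ fg C, qcone2 kgap e,
    forall b, letter_occ b -> le a b -> C (disp b - disp a)
  & forall v, C v -> qhull cycmove (e *m diff_mx + v)].
Proof.
move=> la.
pose X (v : 'rV[rat]_(d + d)) := exists b x y, [/\ letter_occ b, le a b,
  src b = src a + x, tgt b = tgt a + y & v = row_mx (toQ x) (toQ y)].
have [t [A [hA sA]]] := span_of X.
have [q [F [s [Fi Fii]]]] := tame_inc gL a (cokermx A).
have [cc ecc] : exists cc, s = cc *m A.
  by apply/submxP; rewrite submxE -[s]addr0; apply/eqP; case: (Fii 0); [exact: cone0|].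
have [P [N [hP hN ePN]]] := pos_neg_parts cc.
have [u [w [kuw hu hw]]] := la.
have /fin_all_exists[f hf] : forall i, exists t : (obj L * (vec * vec) * (vec * vec)),
    let: (b, (x, y), (u, w)) := t in
    [/\ letter_occ b, le a b, src b = src a + x & tgt b = tgt a + y] /\
    [/\ row i A = row_mx (toQ x) (toQ y), kgap u w, arrow (c + u) (src b)
      & arrow (tgt b) (c + w)].
  move=> i; have [b [x [y [lb ab sb tb e]]]] := hA i.
  by have [u' [w' [? ? ?]]] := lb; exists (b, (x, y), (u', w')).
(* Row [i] is the increment of a run of [c] through the letter whose increment over [a] is row [i]
   of [A]. *)
pose G := \matrix_(i < t) row_mx (toQ (f i).2.1) (toQ (f i).2.2).
have hG i : qcone2 kgap (row i G).
  rewrite rowK; case: (f i) (hf i) => -[b [x y]] [u' w'] [_ [_ k _ _]] /=.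
  by apply/qcone2P; exists 1%N, u', w'; rewrite scale1r.
exists (fun v => exists2 z, cone F z & v = z *m diff_mx), (row_mx (toQ u) (toQ w) + P *m G).
split.
- exact: fg_img (fg_cone F).
- apply: (let: And3 _ h _ := cK in h); last exact: convex_cone_sum cK hG hP.
  by apply/qcone2P; exists 1%N, u, w; rewrite scale1r.
- move=> b lb ab; have [x [y [ex ey _]]] := letter_le la lb ab.
  exists (row_mx (toQ x) (toQ y)).
    apply: Fi; first by apply/qcone2P; exists 1%N, x, y; rewrite scale1r; split=> //; exists b.
    by apply/eqP; rewrite -submxE; apply: sA; exists b, x, y.
  rewrite diff_mxE row_mxKl row_mxKr /disp ex ey !toQD.
  by apply/rowP=> i; rewrite !mxE; ring.
move=> _ [z hz ->].
have [hsz ksz] := Fii z hz; have [_ ks] := Fii _ (cone0 F); rewrite addr0 in ks.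
have zA : (z <= A)%MS.
  by rewrite submxE; move: ksz; rewrite mulmxDl ks add0r => ->.
have cI : convex_cone (qcone2 (inc a)) := convex_qcone (monoid2P (inc_monoid a gL)).
(* Adding [N *m A] removes the subtraction hidden in [s]; what remains is a rational increment of
   [a], and a multiple of it is realized by one letter [b]. *)
have [M [xY [yY [M0 [b [ab sb tb]] eY]]]] : exists M x y,
    [/\ (0 < M)%N, inc a x y & M%:R *: (z + P *m A) = row_mx (toQ x) (toQ y)].
  apply/qcone2P; have -> : z + P *m A = (s + z) + N *m A.
    by rewrite ecc ePN mulmxBl addrC -addrA [z + _]addrC addrA subrK.
  apply: (let: And3 _ h _ := cI in h) => //; apply: convex_cone_sum cI _ hN => i.
  case: (f i) (hf i) => -[b [x y]] [u' w'] [[lb ab sb tb] [-> _ _ _]].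
  by apply/qcone2P; exists 1%N, x, y; rewrite scale1r; split=> //; exists b.
(* [b] is not known to occur, so [letter_le] does not apply to it; it applies to the letters behind
   the rows of [A], whose span contains the increment. *)
have Y0 i : bounded i -> xY 0 i = 0%N /\ yY 0 i = 0%N.
  move=> bi.
  have [D eD] : exists D, z + P *m A = D *m A.
    by apply/submxP; rewrite addmx_sub // submxMl.
  have A0 j : A j (lshift d i) = 0 /\ A j (rshift d i) = 0.
    case: (f j) (hf j) => -[b' [x y]] [u' w'] [[lb ab' sb' tb'] [/rowP e _ _ _]].
    have [x' [y' [ex ey /(_ i bi)[x0 y0]]]] := letter_le la lb ab'.
    have -> : A j (lshift d i) = (x 0 i)%:R.
      by have := e (lshift d i); rewrite row_mxEl !mxE.
    have -> : A j (rshift d i) = (y 0 i)%:R.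
      by have := e (rshift d i); rewrite row_mxEr !mxE.
    have -> : x = x' by vnat.
    have -> : y = y' by vnat.
    by rewrite x0 y0.
  split.
    move/rowP/(_ (lshift d i)): eY; rewrite eD row_mxEl !mxE big1 ?mulr0 => [/esym/eqP|j _].
      by rewrite pnatr_eq0 => /eqP.
    by case: (A0 j) => -> _; rewrite mulr0.
  move/rowP/(_ (rshift d i)): eY; rewrite eD row_mxEr !mxE big1 ?mulr0 => [/esym/eqP|j _].
    by rewrite pnatr_eq0 => /eqP.
  by case: (A0 j) => _ ->; rewrite mulr0.
have [abx aby] : agree (src b) (src a) /\ agree (tgt b) (tgt a).
  by rewrite sb tb; split; apply: agreeD => i /Y0[].
have [za za'] := letter_occ_zone la.
have hb : arrow (src b) (tgt b).
  by apply: arrow_letter; [exact: zone_agree abx za | exact: zone_agree aby za'].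
have mb := move_agree abx aby (move_arrow gL c K hb).
have m1 := cycmove_subst kuw hu hw (agree_refl (src a)) (agree_refl (tgt a)) mb.
have m2 : qhull cycmove (toQ w - toQ u + (z + P *m A) *m diff_mx).
  apply: (qhull_smaller M0) (cycmove_kgap kuw) _.
  rewrite scalemxAl eY diff_mxE row_mxKl row_mxKr; move: m1; congr (move _ _ _).
  by rewrite /disp sb tb !toQD; apply/rowP=> i; rewrite !mxE; ring.
(* The surplus [P *m A] is undone by runs through the chosen letters in which the letter is replaced
   by [a]: row [i] of [(G - A) *m diff_mx] is the displacement of such a run. *)
have -> : (row_mx (toQ u) (toQ w) + P *m G) *m diff_mx + z *m diff_mx =
    (toQ w - toQ u + (z + P *m A) *m diff_mx) + P *m ((G - A) *m diff_mx).
  rewrite !mulmxDl mulNmx diff_mxE row_mxKl row_mxKr mulmxDr mulmxN !mulmxA.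
  by apply/rowP=> i; rewrite !mxE; ring.
apply: (let: And3 _ h _ := cM in h) => //; apply: convex_cone_sum cM _ hP => i.
rewrite row_mul linearB /= rowK.
case: (f i) (hf i) => -[b' [x y]] [u' w'] [[lb ab' sb' tb'] [-> k h1 h2]] /=.
have [x' [y' [ex ey xy0]]] := letter_le la lb ab'.
have ax : agree (src b') (src a) by rewrite ex; apply: agreeD => j /xy0[].
have ay : agree (tgt b') (tgt a) by rewrite ey; apply: agreeD => j /xy0[].
exists 1%N => //; rewrite scale1r.
have := cycmove_subst k h1 h2 ax ay (move_arrow gL c K (letter_occ_arrow la)).
congr (move _ _ _); rewrite mulmxBl !diff_mxE !row_mxKl !row_mxKr /disp sb' tb' !toQD.
by apply/rowP=> j; rewrite !mxE; ring.
Qed.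

End Letters.

(** * Displacements of whole runs and the sandwich for a gap *)

Section GapCone.

Variables (d : nat) (E : finType) (eff : E -> 'rV[int]_d) (pri : E -> 'I_d.+1).
Variables (g : nat) (L : sys d).
Hypothesis gL : good eff pri g L.

Local Notation vec := 'rV[nat]_d.
Local Notation zone := (@in_zone d g).
Local Notation arrow := (@arrow d g L).
Local Notation gap := (@gap d g L).

Variables (c : vec) (p : nat) (K : 'M[rat]_(d + d, p)).
Hypothesis zc : zone c.

Local Notation kgap := (@kgap d g L c p K).
Local Notation bounded := (@bounded d g L c p K).
Local Notation agree := (@agree d g L c p K).
Local Notation move := (@move d g L c p K).
Local Notation cycmove := (@cycmove d g L c p K).

Local Notation disp := (@disp d L).
Local Notation letter_occ := (@letter_occ d g L c p K).

Let mK : monoid2 kgap := kgap_monoid gL K zc.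
Let cK : convex_cone (qcone2 kgap) := convex_qcone (monoid2P mK).
Let cM : convex_cone (qhull cycmove) := @convex_cycmove d g L c p K.

Section Cycles.

Variables (k : nat) (m : 'I_k -> obj L).
Hypothesis lm : forall i, letter_occ (m i).

(** Consecutive letters need only agree on the bounded coordinates, which is all that [move] retains
    of the configurations. *)
Fixpoint walk (q : vec) (w : seq 'I_k) (r : vec) : Prop :=
  match w with
  | [::] => agree q r
  | i :: w' => agree q (src (m i)) /\ walk (tgt (m i)) w' r
  end.

Lemma walk_agree q w r q' r' : agree q' q -> agree r r' -> walk q w r -> walk q' w r'.
Proof.
move=> hq; elim: w q q' hq => [|i w IH] q q' hq hr /=.
  by move=> h; apply: agree_trans hq (agree_trans h hr).
by move=> [h1 h2]; split; [exact: agree_trans hq h1 | exact: IH (agree_refl _) hr h2].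
Qed.

Lemma walk_cat q w w' r : walk q (w ++ w') r <-> exists s, walk q w s /\ walk s w' r.
Proof.
elim: w q => [|i w IH] q /=.
  split=> [h|[s [h1 h2]]]; first by exists q; split=> //; exact: agree_refl.
  exact: walk_agree h1 (agree_refl _) h2.
split=> [[h1 /IH[s [h2 h3]]]|[s [[h1 h2] h3]]]; first by exists s.
by split=> //; apply/IH; exists s.
Qed.

Lemma walk_move q w r : walk q w r -> move q r (\sum_(i <- w) disp (m i)).
Proof.
elim: w q => [|i w IH] q /=.
  by move=> h; rewrite big_nil; exact: (move_agree (agree_refl q) h (@move0 d g L c p K q)).
move=> [h1 /IH h2]; rewrite big_cons; apply: move_comp _ h2.
apply: move_agree (agree_sym h1) (agree_refl _) _.
exact: (move_arrow gL c K (letter_occ_arrow (lm i))).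
Qed.

Definition closed_walk (w : seq 'I_k) : Prop := exists q, walk q w q.

(* Distinct simple cycles on the same set of letters have the same total
   displacement, hence the indexing by sets. *)
Lemma cycle_cone (S : {set 'I_k}) : exists C e,
  [/\ fg C, qcone2 kgap e,
    forall w, uniq w -> closed_walk w -> [set i in w] = S -> C (\sum_(i <- w) disp (m i))
  & forall v, C v -> qhull cycmove (e *m diff_mx d + v)].
Proof.
have [[i0 [w0 [uw [q hw] eS]]]|h] :=
    pselect (exists i w, [/\ uniq (i :: w), closed_walk (i :: w) & [set j in i :: w] = S]); last first.
  exists (cone (0 : 'M_(0, d))), 0; split.
  - exact: fg_cone.
  - by case: cK.
  - case=> [|i w] uw cw ew; first by rewrite big_nil; exact: cone0.
    by case: h; exists i, w.
  - by move=> _ [u _ ->]; rewrite mulmx0 mul0mx addr0; case: cM.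
have [x [y [kxy h1 h2]]] := lm i0; have h3 := letter_occ_arrow (lm i0).
pose del := \sum_(i in S) disp (m i).
have edel w : uniq w -> [set j in w] = S -> \sum_(i <- w) disp (m i) = del.
  by move=> uw' ew; rewrite big_uniq //; apply: eq_bigl => i; rewrite -ew inE.
have mdel n : move (src (m i0)) (src (m i0)) (n%:R *: del).
  apply: qhull_mul; [exact: move0 | by move=> ? ?; exact: move_comp |].
  rewrite -(edel _ uw eS); apply: walk_move; apply: (walk_agree _ _ hw).
    by apply: agree_sym; case: hw.
  by case: hw.
(* Any multiple of the cycle is inserted at the source of [m i0] on a run through that letter; the
   shift is the increment of this run. *)
exists (cone del), (row_mx (toQ x) (toQ y)); split.
- exact: fg_cone.
- by apply/qcone2P; exists 1%N, x, y; rewrite scale1r.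
- by move=> w uw' _ /(edel _ uw') ->; have := cone_row del 0; rewrite row_id.
move=> _ [u hu ->].
have [M [n [M0 en]]] := nonneg_clear_denoms hu.
apply: (qhull_smaller M0); first by rewrite diff_mxE row_mxKl row_mxKr; exact: (cycmove_kgap gL zc kxy).
have -> : M%:R *: (u *m del) = (n 0 0)%:R *: del.
  by rewrite scalemxAl en [toQ n]mx11_scalar mul_scalar_mx mxE.
have a0 : agree (src (m i0)) (src (m i0)) by [].
have h4 : arrow (src (m i0)) (c + y) := arrow_trans h3 h2.
have [hx hy] := agree_kgap gL zc kxy.
have m1 := move_agree hx a0 (move_arrow gL c K h1).
have m2 := move_agree a0 hy (move_arrow gL c K h4).
have := move_comp m1 (move_comp (mdel (n 0 0)) m2).
congr (move _ _ _); rewrite diff_mxE row_mxKl row_mxKr !toQD.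
by apply/rowP=> j; rewrite !mxE; ring.
Qed.

(** A repeated letter cuts a closed walk into two shorter ones: the loop from that letter to its
    second occurrence, and the rest. *)
Lemma closed_walk_decomp (C : 'rV[rat]_d -> Prop) : convex_cone C ->
  (forall w, uniq w -> closed_walk w -> C (\sum_(i <- w) disp (m i))) ->
  forall w, closed_walk w -> C (\sum_(i <- w) disp (m i)).
Proof.
move=> [C0 CD CZ] hC w; have [n] := ubnP (size w); elim: n w => // n IH w hn cw.
have [/hC|/not_uniq_split[i [w1 [w2 [w3 ew]]]]] := boolP (uniq w); first exact.
case: cw => q; rewrite ew => /walk_cat[s [h1 [h2 /walk_cat[s' [h3 [h4 h5]]]]]].
have -> : \sum_(j <- w1 ++ i :: w2 ++ i :: w3) disp (m j) =
    \sum_(j <- i :: w2) disp (m j) + \sum_(j <- w1 ++ i :: w3) disp (m j).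
  by rewrite !(big_cat, big_cons) /=; apply/rowP=> j; rewrite !mxE; ring.
move: hn; rewrite ew !size_cat /= size_cat /= => hn.
apply: CD; apply: IH; rewrite /= ?size_cat /=; try lia.
  by exists (src (m i)); split; [exact: agree_refl | exact: walk_agree (agree_refl _) h4 h3].
by exists q; apply/walk_cat; exists s; split.
Qed.

End Cycles.

(** Each letter of a run is replaced by a minimal letter below it, the surplus going to a cone of
    [letter_cone]. The minimal letters form a closed walk, since both ends of the run agree with
    [c], and its displacement goes to the cones of [cycle_cone]. *)
Lemma kgap_disp_cone : exists C e,
  [/\ fg C, qcone2 kgap e,
    forall x y, kgap x y -> C (toQ y - toQ x)
  & forall v, C v -> qhull cycmove (e *m diff_mx d + v)].
Proof.
have [k [m [lm hm]]] := wqo_basis letter_occ (wqo_le gL).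
have /fin_all_exists2[A _ hA'] : forall i, exists2 C, True & exists e,
    [/\ fg C, qcone2 kgap e,
      forall b, letter_occ b -> le (m i) b -> C (disp b - disp (m i))
    & forall v, C v -> qhull cycmove (e *m diff_mx d + v)].
  by move=> i; have [C h] := letter_cone gL zc (lm i); exists C.
have /fin_all_exists[eA hA] := hA'.
have /fin_all_exists2[B _ hB'] : forall i : 'I_#|{set 'I_k}|, exists2 C, True & exists e,
    [/\ fg C, qcone2 kgap e,
      forall w, uniq w -> closed_walk m w -> [set i in w] = enum_val i -> C (\sum_(i <- w) disp (m i))
    & forall v, C v -> qhull cycmove (e *m diff_mx d + v)].
  by move=> i; have [C h] := cycle_cone lm (enum_val i); exists C.
have /fin_all_exists[eB hB] := hB'.
have fA i : fg (A i) by case: (hA i).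
have fB i : fg (B i) by case: (hB i).
pose CA v := exists2 u, (forall i, A i (u i)) & v = \sum_i u i.
pose CB v := exists2 u, (forall i, B i (u i)) & v = \sum_i u i.
have fCA : fg CA := fg_sum fA; have fCB : fg CB := fg_sum fB.
pose C v := exists x y, [/\ CA x, CB y & v = x + y].
have fC : fg C := fg_add fCA fCB.
have [A0 AD _] := fg_convex fCA; have [B0 BD _] := fg_convex fCB.
have [Q0 QD _] := cK; have [M0 MD _] := cM.
exists C, (\sum_i eA i + \sum_i eB i); split=> //.
- apply: (QD); elim/big_ind: _ => // i _; [by case: (hA i) | by case: (hB i)].
- move=> x y kxy; have [[l hl] _] := kxy.
  have split_letters q : arrow (c + x) q -> forall l : seq (obj L), chain g q l (c + y) ->
      exists w, walk m q w (c + y) /\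
        CA (toQ (c + y) - toQ q - \sum_(i <- w) disp (m i)).
    move=> aq l'; elim: l' q aq => [|a l' IH] q aq /=.
      move=> [_ ->]; exists [::]; split; first exact: agree_refl.
      by rewrite big_nil !subrr.
    move=> [zq eq ha].
    have aa : arrow q (tgt a).
      by exists [:: a]; split=> //; split=> //; exact: (chain_src ha).
    have [w [hw Cw]] := IH _ (arrow_trans aq aa) ha.
    have la : letter_occ a by exists x, y; split=> //; [rewrite eq | exists l'].
    have [i hi] := hm a la.
    have [u [v [eu ev uv0]]] := letter_le gL zc (lm i) la hi.
    exists (i :: w); split.
      split; first by rewrite -eq eu; apply: agreeD => j /uv0[].
      apply: walk_agree _ (agree_refl _) hw.
      by apply: agree_sym; rewrite ev; apply: agreeD => j /uv0[].
    have -> : toQ (c + y) - toQ q - \sum_(j <- i :: w) disp (m j) =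
        (toQ (c + y) - toQ (tgt a) - \sum_(j <- w) disp (m j)) + (disp a - disp (m i)).
      rewrite big_cons -eq /(disp a); set S := \sum_(_ <- _) _.
      by apply/rowP=> j; rewrite !mxE; ring.
    apply: (AD) => //; apply: fg_sum_in => //.
    by case: (hA i) => _ _ h _; apply: h.
  have [zx _] := arrow_zone (ex_intro _ l hl).
  have [w [hw Cw]] := split_letters _ (arrow_refl L zx) l hl.
  have [hx hy] := agree_kgap gL zc kxy.
  exists (toQ (c + y) - toQ (c + x) - \sum_(i <- w) disp (m i)), (\sum_(i <- w) disp (m i)).
  split=> //; last by rewrite subrK !toQD opprD addrACA subrr add0r.
  apply: (@closed_walk_decomp _ m); first exact: fg_convex.
    move=> w' uw' cw'; apply: (fg_sum_in (i := enum_rank [set i in w'])) => //.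
    by case: (hB (enum_rank [set i in w'])) => _ _ h _; apply: h => //; rewrite enum_rankK.
  by exists c; apply: walk_agree _ hy hw; exact: agree_sym.
- move=> v [_ [_ [[a ha ->] [b hb ->] ->]]].
  (* Each component consumes its own summand of the shift. *)
  rewrite mulmxDl addrACA !mulmx_suml -!big_split /=.
  apply: (MD); elim/big_ind: _ => // i _.
    by case: (hA i) => _ _ _; apply.
  by case: (hB i) => _ _ _; apply.
Qed.

Lemma qcone2_kgap e : qcone2 kgap e ->
  [/\ nonneg e, e *m K = 0 & forall i, bounded i -> e 0 (lshift d i) = 0 /\ e 0 (rshift d i) = 0].
Proof.
move=> /qcone2P[M [x [y [M0 k ee]]]].
have hM : M%:R != 0 :> rat by rewrite pnatr_eq0 -lt0n.
have {ee} -> : e = M%:R^-1 *: row_mx (toQ x) (toQ y) by rewrite -ee scalerA mulVf // scale1r.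
split.
- apply: nonnegZ; first by rewrite invr_ge0.
  by apply/nonneg_row_mx; split; exact: toQ_ge0.
- by have [_ kK] := k; rewrite -scalemxAl kK scaler0.
- move=> i bi; have [x0 y0] := kgap_bounded gL zc k bi.
  by rewrite mxE row_mxEl mxE [in X in _ /\ X]mxE row_mxEr !mxE x0 y0 mulr0.
Qed.

(** The outer cone collects necessary conditions: nonnegativity, displacement in [C], membership in
    [ker K], zeros on the bounded coordinates. They become sufficient after a shift: [e] makes the
    displacement cyclic up to a multiple, and [s] provides the height to perform it. *)
Lemma gap_sandwich : exists q (F : 'M[rat]_(q, d + d)) s,
  (forall v, qcone2 (gap c) v -> v *m K = 0 -> cone F v) /\
  (forall v, cone F v -> qcone2 (gap c) (s + v) /\ (s + v) *m K = 0).
Proof.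
have [s [sK hs]] := kgap_of_cycmove gL K zc.
have [C [e [fC ke hC1 hC2]]] := kgap_disp_cone.
pose B : pred 'I_(d + d) := fun j => match split j with inl i => `[< bounded i >] | inr i => `[< bounded i >] end.
have [q [F hF]] : fg (fun v => [/\ nonneg v, C (v *m diff_mx d), v *m K = 0 & v *m coord_ker B = 0]).
  have f1 := fg_prod (fg_nonneg (d + d)) fC.
  have f2 := fg_ker (col_mx (diff_mx d) (- 1%:M)) f1.
  have f3 := fg_ker (coord_ker B) (fg_ker K (fg_img (col_mx 1%:M 0) f2)).
  have [q [F hF]] := f3; exists q, F => v; rewrite -hF; split.
    move=> [h1 h2 h3 h4]; split=> //; split=> //.
    exists (row_mx v (v *m diff_mx d)); last by rewrite mul_row_col mulmx1 mulmx0 addr0.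
    by rewrite row_mxKl row_mxKr mul_row_col mulmxN mulmx1 subrr.
  move=> [[[z [[z1 z2]] z3 ->] h3 h4]]; split=> //; move: z3 z1 z2;
    rewrite -[z]hsubmxK !mul_row_col mulmxN !mulmx1 !mulmx0 addr0 row_mxKl row_mxKr //.
  by move=> /subr0_eq ->.
exists q, F, (s + e); split.
  move=> v /qcone2P[M [x [y [M0 gxy ev]]]] vK; apply/hF.
  have kxy : kgap x y by split=> //; rewrite -ev -scalemxAl vK scaler0.
  have hv : v = M%:R^-1 *: row_mx (toQ x) (toQ y).
    by rewrite -ev scalerA mulVf ?scale1r // pnatr_eq0 -lt0n.
  have kv : qcone2 kgap v by apply/qcone2P; exists M, x, y.
  have [h1 h2 h3] := qcone2_kgap kv; split=> //.
    rewrite hv -scalemxAl diff_mxE row_mxKl row_mxKr.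
    have [_ _ CZ] := fg_convex fC; apply: CZ; first by rewrite invr_ge0.
    exact: hC1.
  apply/coord_kerP => j; rewrite /B; case: splitP => i ej /asboolP/h3[e1 e2].
    by rewrite -e1; congr (v 0 _); exact: val_inj.
  by rewrite -e2; congr (v 0 _); exact: val_inj.
move=> v /hF[h1 h2 h3 /coord_kerP h4].
have [e1 e2 e3] := qcone2_kgap ke.
have key : qcone2 kgap (s + (e + v)).
  rewrite -[e + v]hsubmxK; apply: hs; rewrite ?hsubmxK.
  - by move=> i j; rewrite ord1 !mxE addr_ge0.
  - by move=> i j; rewrite ord1 !mxE addr_ge0.
  - move=> i bi; have [a b] := e3 i bi.
    by rewrite !mxE a b !h4 ?addr0 // /B ?(unsplitK (inl i)) ?(unsplitK (inr i)) asboolT.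
  - by rewrite mulmxDl e2 h3 addr0.
  - by rewrite -diff_mxE mulmxDl; exact: hC2.
rewrite -addrA; split; last by rewrite !mulmxDl sK e2 h3 !addr0.
by have [M [z [M0 [gz _] ez]]] := key; exists M, z.
Qed.

End GapCone.

Lemma tame_gap d (E : finType) (eff : E -> 'rV[int]_d) (pri : E -> 'I_d.+1) g (L : sys d) c :
  good eff pri g L -> in_zone g c -> tame (qcone2 (@gap d g L c)).
Proof. by move=> gL zc p K; exact: gap_sandwich gL _ _ _ zc. Qed.

(** * Iteration and levels *)

Section Star.

Variables (d : nat) (E : finType) (eff : E -> 'rV[int]_d) (pri : E -> 'I_d.+1).
Variables (g : nat) (L : sys d).
Hypothesis gL : good eff pri g L.

Local Notation vec := 'rV[nat]_d.
Local Notation zone := (@in_zone d g).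
Local Notation chain := (@chain d g L).
Local Notation arrow := (@arrow d g L).
Local Notation gap := (@gap d g L).

Record star_obj := StarObj {
  star_src : vec;
  star_word : seq (obj L);
  star_tgt : vec;
  star_chain : chain star_src star_word star_tgt
}.

(** The ends are compared explicitly because embedding of words does not compare them: letters may
    be skipped before the first match and after the last. *)
Definition star_sys : sys d := @Sys d star_obj star_src star_tgt
  (fun a b => [/\ vle (star_src a) (star_src b), vle (star_tgt a) (star_tgt b)
    & emb (@le d L) (star_word a) (star_word b)]).

(** Increments of a chain as an alternating composition of gaps and letter increments, the shape to
    which [tame_relcomp] applies. *)
Fixpoint incs (c : vec) (l : seq (obj L)) (x y : vec) : Prop :=
  match l with
  | [::] => gap c x y
  | a :: l' => exists u, gap c x u /\ exists v, inc a u v /\ incs (tgt a) l' v y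
  end.

(** Letters skipped by the embedding are collected in the gap before the next matched letter;
    [arrow (c + x) q] holds those read so far. *)
Lemma emb_incs c l p l' x y q : chain c l p -> emb (@le d L) l l' ->
  arrow (c + x) q -> chain q l' (p + y) -> incs c l x y.
Proof.
move=> + h; elim: h c x q => {l l'} [|l b l' _ IH|a l b l' ab _ IH] c x q /=.
- by move=> [_ ->] h [_ eq]; rewrite -[gap p x y]/(arrow (p + x) (p + y)) -eq.
- move=> cl h [zq eb cl']; apply: (IH _ _ _ cl _ cl'); apply: arrow_trans h _.
  by rewrite -eb; apply: arrow_letter; [rewrite eb | exact: (chain_src cl')].
- move=> [zc ea cl] h [zq eb cl'].
  have [u [v [eu ev]]] := le_inc gL ab.
  exists u; split; first by rewrite -[gap c x u]/(arrow (c + x) (c + u)) -ea -eu eb ea.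
  exists v; split; first by exists b.
  apply: (IH _ _ _ cl _ cl'); rewrite -ev; apply: arrow_refl; exact: (chain_src cl').
Qed.

Lemma incs_emb c l p x y : chain c l p -> incs c l x y ->
  exists l', chain (c + x) l' (p + y) /\ emb (@le d L) l l'.
Proof.
elim: l c x => [|a l IH] c x /=.
  by move=> [_ <-] [l' h]; exists l'; split=> //; exact: emb_nils.
move=> [zc ea cl] [u [[l1 h1] [v [[b [ab sb tb]] hv]]]].
have [l2 [h2 e2]] := IH _ _ cl hv.
exists (l1 ++ b :: l2); split.
  apply: (chain_cat h1); split; first exact: (chain_tgt h1).
    by rewrite sb ea.
  by rewrite tb.
by apply: (emb_cat (emb_nils _ l1)); constructor.
Qed.

Lemma inc_starP (a : obj star_sys) x y : inc a x y <-> incs (star_src a) (star_word a) x y.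
Proof.
case: a => c l p cl /=; split.
  move=> [[c' l' p' cl'] [[_ _ /= hl] ec ep]]; move: cl'; rewrite ec ep => cl'.
  by apply: (emb_incs cl hl _ cl'); apply: arrow_refl; exact: (chain_src cl').
move=> h; have [l' [cl' hl]] := incs_emb cl h.
by exists (StarObj cl'); split=> //=; split=> //=; [exists x | exists y].
Qed.

Lemma incs_monoid c l p : chain c l p -> monoid2 (incs c l).
Proof.
elim: l c => [|a l IH] c /=; first by move=> [zc _]; exact (gap_monoid gL zc).
move=> [zc ea /IH[I0 ID]].
have [G0 GD] := gap_monoid gL zc; have [A0 AD] := inc_monoid a gL.
split; first by exists 0; split=> //; exists 0.
move=> x y x' y' [u [h1 [v [h2 h3]]]] [u' [h1' [v' [h2' h3']]]].
by exists (u + u'); split; [exact: GD | exists (v + v'); split; [exact: AD | exact: ID]].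
Qed.

Lemma incs_shift c l p z : chain c l p -> zone z -> incs c l z z.
Proof.
move=> + hz; elim: l c => [|a l IH] c /=.
  by move=> [zc _]; apply: arrow_refl; apply/in_zoneD.
move=> [zc ea /IH hl]; exists z; split; first by apply: arrow_refl; apply/in_zoneD.
by exists z; split=> //; exact (shift gL a hz).
Qed.

Lemma tame_incs c l p : chain c l p -> tame (qcone2 (incs c l)).
Proof.
elim: l c => [|a l IH] c /=; first by move=> [zc _]; exact (tame_gap gL zc).
move=> [zc ea cl].
have mG := gap_monoid gL zc; have mA := inc_monoid a gL; have mI := incs_monoid cl.
have mAI : monoid2 (fun u y => exists v, inc a u v /\ incs (tgt a) l v y).
  case: mA mI => [A0 AD] [I0 ID]; split; first by exists 0.
  by move=> x y x' y' [u [h1 h2]] [u' [h1' h2']]; exists (u + u'); split; [exact: AD | exact: ID].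
apply: (tame_relcomp mG mAI (tame_gap gL zc)).
exact: (tame_relcomp mA mI (tame_inc gL a) (IH _ cl)).
Qed.

Lemma incs_flat c l p0 k (p q : 'I_k -> vec) : chain c l p0 -> (forall i, incs c l (p i) (q i)) ->
  exists ws, forall n : 'I_k -> nat,
    flat_rel eff pri ws (c + \sum_i p i *+ n i) (p0 + \sum_i q i *+ n i).
Proof.
elim: l c p => [|a l IH] c p /=.
  move=> [zc <-] h; have [ws hws] := gap_flat gL h; exists ws => n.
  by have := hws n 0 (@in_zone0 d g); rewrite !addr0.
move=> [zc ea cl] h.
have /fin_all_exists[u hu] := h.
have /fin_all_exists[v hv] : forall i, exists v, inc a (u i) v /\ incs (tgt a) l v (q i).
  by move=> i; case: (hu i).
have [ws1 h1] := gap_flat gL (fun i => (hu i).1).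
have [ws2 h2] := flat gL (fun i => (hv i).1).
have [ws3 h3] := IH _ _ cl (fun i => (hv i).2).
exists (ws1 ++ (ws2 ++ ws3)) => n; apply/flat_rel_cat.
exists (c + \sum_i u i *+ n i); split.
  by have := h1 n 0 (@in_zone0 d g); rewrite !addr0.
by apply/flat_rel_cat; exists (tgt a + \sum_i v i *+ n i); split; [rewrite -ea; exact: h2 | exact: h3].
Qed.

(** The two chains run one after the other, the first translated by [x2] and the second by [y1]. *)
Lemma gap_amalg c l1 l2 x1 y1 x2 y2 : chain (c + x1) l1 (c + y1) -> chain (c + x2) l2 (c + y2) ->
  exists l3, [/\ chain (c + x1 + x2) l3 (c + y1 + y2),
    emb (@le d L) l1 l3 & emb (@le d L) l2 l3].
Proof.
move=> h1 h2.
have /in_zoneD[_ zx2] := chain_src h2; have /in_zoneD[_ zy1] := chain_tgt h1.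
have [s1 [c1 e1]] := chain_shift gL h1 zx2; have [s2 [c2 e2]] := chain_shift gL h2 zy1.
rewrite [X in chain X]addrAC [X in chain _ _ X]addrAC in c2.
exists (s1 ++ s2); split; first exact (chain_cat c1 c2).
  by rewrite -[l1]cats0; exact: (emb_cat e1 (emb_nils _ _)).
by rewrite -[l2]cat0s; exact: (emb_cat (emb_nils _ _) e2).
Qed.

Lemma chain_amalg c l p l1 l2 x1 x2 y1 y2 : chain c l p ->
  emb (@le d L) l l1 -> emb (@le d L) l l2 ->
  chain (c + x1) l1 (p + y1) -> chain (c + x2) l2 (p + y2) ->
  exists l3, [/\ chain (c + x1 + x2) l3 (p + y1 + y2),
    emb (@le d L) l1 l3 & emb (@le d L) l2 l3].
Proof.
elim: l c l1 l2 x1 x2 => [|a l IH] c l1 l2 x1 x2 /=.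
  by move=> [zc <-] _ _; exact: gap_amalg.
move=> [zc ea cl] em1 em2.
have [g1 [b1 [t1 [-> ab1 e1]]]] := emb_uncons em1.
have [g2 [b2 [t2 [-> ab2 e2]]]] := emb_uncons em2.
move=> /chain_split[q1 [cg1 [_ eq1 ct1]]] /chain_split[q2 [cg2 [_ eq2 ct2]]].
have [u1 [v1 [eu1 ev1]]] := le_inc gL ab1; have [u2 [v2 [eu2 ev2]]] := le_inc gL ab2.
rewrite -eq1 eu1 ea in cg1; rewrite -eq2 eu2 ea in cg2.
rewrite ev1 in ct1; rewrite ev2 in ct2.
have [g3 [cg3 f1 f2]] := gap_amalg cg1 cg2.
have [b3 [b13 b23 sb3 tb3]] := amalg gL ab1 ab2.
have [t3 [ct3 h1 h2]] := IH _ _ _ _ _ cl e1 e2 ct1 ct2.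
exists (g3 ++ b3 :: t3); split.
- apply: (chain_cat cg3); split; first exact: (chain_tgt cg3).
    by vnat.
  by have -> : tgt b3 = tgt a + v1 + v2 by vnat.
- by apply: (emb_cat f1); constructor.
- by apply: (emb_cat f2); constructor.
Qed.

Lemma good_star : good eff pri g star_sys.
Proof.
have trL : forall a b e : obj L, le a b -> le b e -> le a e by move=> a b e; exact: (sys_trans gL).
split.
- move=> a; split; [exact: vle_refl | exact: vle_refl |].
  exact (emb_refl (sys_refl gL) _).
- move=> a b c [h1 h2 h3] [k1 k2 k3]; split; [exact (vle_trans h1 k1)|exact (vle_trans h2 k2)|].
  exact (emb_trans trL h3 k3).
- by move=> a b [[x ex] [y ey] _]; exists x, y.
- apply: (wqo_map (h := fun a => (star_src a, (star_tgt a, star_word a))))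
    (wqo_prod (@vle_trans d) (@wqo_vec d) (wqo_prod (@vle_trans d) (@wqo_vec d)
      (higman trL (wqo_le gL)))).
  by move=> a b [h1 [h2 h3]].
- by move=> a z hz; apply/inc_starP; exact: (incs_shift (star_chain a)).
- move=> [c l p cl] [c1 l1 p1 cl1] [c2 l2 p2 cl2].
  move=> [/= [x1 ex1] [y1 ey1] e1] [/= [x2 ex2] [y2 ey2] e2].
  move: (cl1) (cl2); rewrite ex1 ex2 ey1 ey2 => h1 h2.
  have [l3 [cl3 f1 f2]] := chain_amalg cl e1 e2 h1 h2.
  exists (StarObj cl3); split=> //=; try by vnat.
    by split=> //=; [exists x2; vnat | exists y2; vnat].
  by split=> //=; [exists x1; vnat | exists y1; vnat].
- by move=> a; have [w hw] := chain_word gL (star_chain a); exists w.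
- by move=> a k p q h; apply: (incs_flat (star_chain a)) => i; apply/inc_starP.
- move=> a; apply: tame_ext (tame_incs (star_chain a)) => v.
  by apply: qcone2_ext => x y; rewrite inc_starP.
Qed.

End Star.

(** * Decomposition of runs by priority *)

Section Levels.

Variables (d : nat) (E : finType) (eff : E -> 'rV[int]_d) (pri : E -> 'I_d.+1).

Local Notation vec := 'rV[nat]_d.

(* Runs with priorities below [g], decomposed along the tests of the highest
   priority: between the first and the last of them the run is a chain of
   letters between configurations that are zero on the tested coordinates. *)
Fixpoint level (g : nat) : sys d :=
  if g is g'.+1 then
    let P := pre_sys eff pri g' (level g') in
    sum_sys (level g') (comp_sys (level g') (comp_sys (star_sys g' P) P))
  else id_sys d.

(** Priorities below [g] test at most the first [g.-1] coordinates; level 0 consists of empty runs,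
    so truncation at 0 is harmless. *)
Lemma good_level g : good eff pri g.-1 (level g).
Proof.
elim: g => [|g IH] /=; first exact: good_id.
have {}IH : good eff pri g (level g) by apply: good_le IH; case: g.
have gP := good_pre IH.
apply: good_sum => //; apply: good_comp => //; apply: good_comp => //.
exact: good_star.
Qed.

Definition low_step (g : nat) (x y : vec) : Prop :=
  exists2 e, (pri e < g)%N & edge_rel eff pri e x y.

Definition level_rel g x y := exists a : obj (level g), src a = x /\ tgt a = y.

(** Only this direction is proved: that objects yield actual runs is already part of [good]. Reading
    from the front, an edge of priority [g] together with the low run up to the next test becomes a
    new first letter, or the final piece if no test follows. *)
Lemma level_complete g x y : clos_refl_trans_1n vec (low_step g) x y -> level_rel g x y.
Proof.
elim: g x y => [|g IH] x y.
  by case=> [|? ? [e]] //; exists x.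
set P := pre_sys eff pri g (level g) => h.
have [h1|[c [q [l [b [h1 cl eb ey]]]]]] : clos_refl_trans_1n vec (low_step g) x y \/
    exists c q (l : seq (obj P)) (b : obj P),
      [/\ clos_refl_trans_1n vec (low_step g) x c, chain g c l q, src b = q & tgt b = y].
- elim: h => {x y} [x|x x' y [e le_e he] _ IHy]; first by left; constructor.
  have [lt_e|ge_e] := ltnP (pri e) g.
    have step z : clos_refl_trans_1n vec (low_step g) x' z ->
        clos_refl_trans_1n vec (low_step g) x z.
      by apply: Relation_Operators.rt1n_trans; exists e.
    case: IHy => [/step h1|[c [q [l [b [/step h1 cl eb ey]]]]]]; first by left.
    by right; exists c, q, l, b.
  have ee : pri e = g :> nat by lia.
  have zx : in_zone g x by case: he; rewrite ee.
  right; exists x; case: IHy => [/IH[r [sr tr]]|[c [q [l [b [/IH[r [sr tr]] cl eb ey]]]]]].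
    have hr : edge_rel eff pri e x (src r) by rewrite sr.
    by exists x, [::], (PreObj ee hr); split=> //; constructor.
  have hr : edge_rel eff pri e x (src r) by rewrite sr.
  exists q, (PreObj ee hr :: l), b; split=> //; first by constructor.
  by split=> //=; rewrite tr.
- by have [a [sa ta]] := IH _ _ h1; exists (inl a).
have [a [sa ta]] := IH _ _ h1.
have e1 : tgt (StarObj cl : obj (star_sys g P)) = src b by rewrite eb.
have e2 : tgt a = src (CompObj e1 : obj (comp_sys (star_sys g P) P)) by rewrite ta.
by exists (inr (CompObj e2)).
Qed.

End Levels.

(** * Growth along an ultrafilter *)

Record ultrafilter I (U : (I -> Prop) -> Prop) : Prop := Ultrafilter {
  ultraS : forall P Q : I -> Prop, (forall n, P n -> Q n) -> U P -> U Q;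
  ultraI : forall P Q, U P -> U Q -> U (fun n => P n /\ Q n);
  ultra0 : ~ U (fun _ => False);
  ultra_em : forall P, U P \/ U (fun n => ~ P n)
}.

(** The complements of the [T j] have the finite intersection property. *)
Lemma ultrafilter_avoiding I J (T : J -> I -> Prop) :
  (forall s : seq J, exists n, forall j, List.In j s -> ~ T j n) ->
  exists U, ultrafilter U /\ forall j, U (fun n => ~ T j n).
Proof.
move=> hT.
pose F (A : I -> Prop) := exists s, forall n, (forall j, List.In j s -> ~ T j n) -> A n.
have pF : filter.ProperFilter F.
  apply: filter.Build_ProperFilter_ex.
    by move=> P [s hs]; have [n hn] := hT s; exists n; exact: hs.
  split.
  - by exists [::].
  - move=> P Q [s hs] [t ht]; exists (s ++ t) => n hn.
    by split; [apply: hs | apply: ht] => j hj; apply: hn; apply/List.in_app_iff; [left|right].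
  - by move=> P Q PQ [s hs]; exists s => n /hs /PQ.
have [G [uG FG]] := filter.ultraFilterLemma pF.
exists G; split; last first.
  by move=> j; apply: FG; exists [:: j] => n; apply; left.
have fG : filter.ProperFilter G by exact: filter.ultra_proper.
split.
- by move=> P Q PQ; apply: filter.filterS.
- by move=> P Q; exact: filter.filterI.
- exact: filter.filter_not_empty.
- by move=> P; exact: filter.in_ultra_setVsetC.
Qed.

Section Ultra.

Variables (I : Type) (U : (I -> Prop) -> Prop).
Hypothesis uU : ultrafilter U.

Lemma ultra_ex P : U P -> exists n, P n.
Proof.
move=> h; apply: contrapT => hn; apply: (ultra0 uU).
by apply: ultraS h => // n Pn; apply: hn; exists n.
Qed.

Lemma ultraT (P : I -> Prop) : (forall n, P n) -> U P.
Proof.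
move=> h; have [//|hn] := ultra_em uU P.
by apply: ultraS hn => // n; case.
Qed.

Lemma ultraN P : ~ U P -> U (fun n => ~ P n).
Proof. by move=> h; case: (ultra_em uU P). Qed.

Lemma ultra_all k (P : 'I_k -> I -> Prop) : (forall i, U (P i)) -> U (fun n => forall i, P i n).
Proof.
elim: k P => [|k IH] P h; first by apply: ultraT => n [].
have := ultraI uU (h ord0) (IH _ (fun i => h (lift ord0 i))).
by apply: ultraS => // n [h1 h2] i; case: (unliftP ord0 i) => [j ->|->].
Qed.

Lemma ultra_pigeonhole (T : finType) (P : T -> I -> Prop) :
  U (fun n => exists i, P i n) -> exists i, U (P i).
Proof.
move=> h; apply: contrapT => hn.
have : U (fun n => forall i : 'I_#|T|, ~ P (enum_val i) n).
  by apply: ultra_all => i; apply: ultraN => hi; apply: hn; exists (enum_val i).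
move=> /(ultraI uU h) hh; apply: (ultra0 uU); apply: (ultraS uU _ hh) => n [[i Pi] h'].
by apply: (h' (enum_rank i)); rewrite enum_rankK.
Qed.

Lemma ultra_const (T : finType) (f : I -> T) : exists v, U (fun n => f n = v).
Proof. by apply: ultra_pigeonhole; apply: ultraT => n; exists (f n). Qed.

Lemma ultra_const_bounded (f : I -> nat) B :
  U (fun n => (f n <= B)%N) -> exists v, U (fun n => f n = v).
Proof.
move=> h; have [v hv] := ultra_const (fun n => inord (f n) : 'I_B.+1).
exists v; apply: ultraS (ultraI uU h hv) => // n [h1 <-].
by rewrite inordK.
Qed.

Lemma ultra_const_rat (f : I -> rat) (M : nat) (B : rat) : (0 < M)%N ->
  (forall n, exists z : int, M%:R * f n = z%:~R) -> U (fun n => `|f n| <= B) ->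
  exists v, U (fun n => f n = v).
Proof.
move=> M0 /choice[z hz] hB.
have hM : 0 < M%:R :> rat by rewrite ltr0n.
pose N := (Num.truncn (M%:R * B)).+1.
have hzN : U (fun n => `|z n| <= N%:Z).
  apply: ultraS hB => // n hn; rewrite -(ler_int rat) intr_norm -hz normrM.
  rewrite (ger0_norm (ltW hM)); apply: le_trans (ltW (truncnS_gt _)).
  by rewrite ler_pM2l.
have [v hv] : exists v, U (fun n => `|(z n + N%:Z)%R|%N = v).
  apply: (@ultra_const_bounded _ (N + N)%N); apply: ultraS hzN => // n; lia.
exists ((v%:Z - N%:Z)%:~R / M%:R); apply: ultraS (ultraI uU hzN hv) => // n [h1 h2].
have -> : (v%:Z - N%:Z)%R = z n by lia.
by rewrite -hz mulrC mulKf // gt_eqF.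
Qed.

Lemma ultra_In T (Q : T -> I -> Prop) (s : seq T) :
  (forall y, List.In y s -> U (Q y)) -> U (fun x => forall y, List.In y s -> Q y x).
Proof.
elim: s => [|a s IH] h; first by apply: ultraT.
have h1 := h a (or_introl erefl); have h2 := IH (fun y hy => h y (or_intror hy)).
by apply: ultraS (ultraI uU h1 h2) => // n [h3 h4] y [<-|/h4].
Qed.

(** Otherwise [U]-most [k] lie below only [U]-few [k']; finitely many such [k] exclude only a
    [U]-small set, so a bad sequence can be continued forever. *)
Lemma ultra_wqo T (R : T -> T -> Prop) (f : I -> T) :
  wqo R -> U (fun k => U (fun k' => R (f k) (f k'))).
Proof.
move=> wR; apply: contrapT => /ultraN hN.
pose B k := U (fun k' => ~ R (f k) (f k')).
have hB : U B by apply: ultraS hN => // k /ultraN.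
have hs (s : seq I) : exists x, B x /\ forall y, List.In y s -> B y -> ~ R (f y) (f x).
  apply: (ultra_ex (P := fun x => B x /\ _)); apply: (ultraI uU) => //; apply: ultra_In => y _.
  have [By|nBy] := pselect (B y); last by apply: ultraT.
  by apply: (ultraS uU _ By).
have [x hx] := dependent_choice hs.
have [i [j [hij hR]]] := wR (f \o x).
by have [Bi _] := hx i; have [_ /(_ (x i) (in_map_iota _ hij) Bi)] := hx j; exact.
Qed.

End Ultra.

(** * Linear forms along an ultrafilter *)

Definition dot r (v : 'rV[rat]_r) (l : 'cV[rat]_r) : rat := (v *m l) 0 0.

Lemma dotDl r (v w : 'rV_r) l : dot (v + w) l = dot v l + dot w l.
Proof. by rewrite /dot mulmxDl mxE. Qed.

Lemma dotBl r (v w : 'rV_r) l : dot (v - w) l = dot v l - dot w l.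
Proof. by rewrite /dot mulmxBl !mxE. Qed.

Lemma dotDr r (v : 'rV_r) l m : dot v (l + m) = dot v l + dot v m.
Proof. by rewrite /dot mulmxDr mxE. Qed.

Lemma dotBr r (v : 'rV_r) l m : dot v (l - m) = dot v l - dot v m.
Proof. by rewrite /dot mulmxBr !mxE. Qed.

Lemma dotZr r (v : 'rV_r) c l : dot v (c *: l) = c * dot v l.
Proof. by rewrite /dot -scalemxAr mxE. Qed.

Lemma dot0r r (v : 'rV_r) : dot v 0 = 0.
Proof. by rewrite /dot mulmx0 mxE. Qed.

Lemma dot_mulmx r p (v : 'rV_r) (P : 'M_(r, p)) l : dot (v *m P) l = dot v (P *m l).
Proof. by rewrite /dot mulmxA. Qed.

Lemma dot_col r p (v : 'rV_r) (P : 'M_(r, p)) j : dot v (col j P) = (v *m P) 0 j.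
Proof. by rewrite /dot !mxE; apply: eq_bigr => i _; rewrite mxE. Qed.

Lemma dot_toQ_clear r (l : 'cV[rat]_r) : exists2 M : nat, (0 < M)%N &
  forall x : 'rV[nat]_r, exists z : int, M%:R * dot (toQ x) l = z%:~R.
Proof.
have [M M0 hM] := clear_denoms l.
have /fin_all_exists[z hz] := fun i => hM i 0.
exists M => // x; exists (\sum_i (x 0 i)%:Z * z i).
rewrite /dot mxE mulr_sumr rmorph_sum; apply: eq_bigr => i _.
by rewrite !mxE rmorphM /= -hz; ring.
Qed.

(** Linear forms are columns, and [K] stands for the space of forms spanned by its columns. *)
Definition colsub r p (l : 'cV[rat]_r) (K : 'M[rat]_(r, p)) : Prop := (l^T <= K^T)%MS.

Lemma colsub_mul r p (K : 'M_(r, p)) z : colsub (K *m z) K.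
Proof. by rewrite /colsub trmx_mul submxMl. Qed.

Lemma colsubP r p (K : 'M_(r, p)) l : colsub l K -> exists z, l = K *m z.
Proof. by move=> /submxP[z e]; exists z^T; rewrite -[l]trmxK e trmx_mul trmxK. Qed.

Lemma colsub_ker r p (K : 'M_(r, p)) l (v : 'rV_r) : colsub l K -> v *m K = 0 -> dot v l = 0.
Proof. by move=> /colsubP[z ->] h; rewrite /dot mulmxA h mul0mx mxE. Qed.

Lemma colsubD r p (K : 'M_(r, p)) l m : colsub l K -> colsub m K -> colsub (l + m) K.
Proof. by move=> h h'; rewrite /colsub linearD addmx_sub. Qed.

Lemma colspace_of r (X : 'cV[rat]_r -> Prop) : X 0 ->
  (forall l m, X l -> X m -> X (l + m)) -> (forall c l, X l -> X (c *: l)) ->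
  exists K : 'M[rat]_r, forall l, colsub l K <-> X l.
Proof.
move=> X0 XD XZ.
have [t [A [hA sA]]] := span_of (fun v : 'rV_r => X v^T).
exists <<A>>%MS^T => l; rewrite /colsub trmxK genmxE; split.
  move=> /submxP[c ec]; rewrite -[l]trmxK ec mulmx_sum_row linear_sum.
  by elim/big_ind: _ => // i _; rewrite linearZ /=; apply: (XZ); exact: hA.
by move=> Xl; apply: sA; rewrite trmxK.
Qed.

Section Growth.

Variables (I : Type) (U : (I -> Prop) -> Prop).
Hypothesis uU : ultrafilter U.
Variables (r : nat) (a : I -> 'rV[nat]_r) (p : nat) (K : 'M[rat]_(r, p)).

Local Notation A := (fun n => toQ (a n)).

(** Together with [constK] this says that the columns of [K] span exactly the forms that are
    constant along [U]. *)
Definition nondegenerate : Prop :=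
  forall l b, U (fun n => dot (toQ (a n)) l = b) -> colsub l K.

Definition dominated (l m : 'cV[rat]_r) : Prop :=
  exists C : rat, U (fun n => `|dot (toQ (a n)) l| <= C * `|dot (toQ (a n)) m|).

Hypothesis ndK : nondegenerate.
Variable c : 'rV[rat]_r.
Hypothesis constK : U (fun n => (toQ (a n) - c) *m K = 0).

(** The values of a form on integer vectors have a common denominator, so a bounded form is constant
    along [U]. *)
Lemma nondegenerate_unbounded l B : ~ colsub l K -> U (fun n => B < `|dot (toQ (a n)) l|).
Proof.
move=> nl; have [M M0 hM] := dot_toQ_clear l.
case: (ultra_em uU (fun n => B < `|dot (toQ (a n)) l|)) => // h; case: nl.
have [v hv] : exists v, U (fun n => dot (toQ (a n)) l = v).
  apply: (ultra_const_rat uU (B := B) M0) => [n|]; first exact: hM.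
  by apply: (ultraS uU _ h) => n /negP; rewrite -leNgt.
exact: ndK hv.
Qed.

Lemma dominated_refl l : dominated l l.
Proof. by exists 1; apply: (ultraT uU) => n; rewrite mul1r. Qed.

Lemma dominatedP l m : dominated l m ->
  exists2 C, 0 <= C & U (fun n => `|dot (toQ (a n)) l| <= C * `|dot (toQ (a n)) m|).
Proof.
move=> [C h]; exists `|C|; first exact: normr_ge0.
apply: (ultraS uU _ h) => n hn; apply: le_trans hn _.
by rewrite ler_wpM2r // ler_norm.
Qed.

Lemma dominated_trans l m k : dominated l m -> dominated m k -> dominated l k.
Proof.
move=> /dominatedP[C C0 h] [C' h']; exists (C * C').
apply: (ultraS uU _ (ultraI uU h h')) => n [h1 h2].
by apply: le_trans h1 _; rewrite -mulrA ler_wpM2l.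
Qed.

Lemma dominated0 m : dominated 0 m.
Proof. by exists 0; apply: (ultraT uU) => n; rewrite dot0r normr0 mul0r. Qed.

Lemma dominatedD l l' m : dominated l m -> dominated l' m -> dominated (l + l') m.
Proof.
move=> [C h] [C' h']; exists (C + C').
apply: (ultraS uU _ (ultraI uU h h')) => n [h1 h2].
by rewrite dotDr mulrDl; apply: le_trans (ler_normD _ _) (lerD h1 h2).
Qed.

Lemma dominatedZ k l m : dominated l m -> dominated (k *: l) m.
Proof.
move=> [C h]; exists (`|k| * C); apply: (ultraS uU _ h) => n h1.
by rewrite dotZr normrM -mulrA ler_wpM2l.
Qed.

Lemma not_dominated l m C : ~ dominated l m ->
  U (fun n => C * `|dot (toQ (a n)) m| < `|dot (toQ (a n)) l|).
Proof.
move=> h; case: (ultra_em uU (fun n => C * `|dot (toQ (a n)) m| < `|dot (toQ (a n)) l|)) => // h'.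
by case: h; exists C; apply: (ultraS uU _ h') => n /negP; rewrite -leNgt.
Qed.

Lemma const_dominated l m : colsub l K -> ~ colsub m K -> dominated l m.
Proof.
move=> lK mK; exists `|dot c l|.
apply: (ultraS uU _ (ultraI uU constK (nondegenerate_unbounded 1 mK))) => n [h1 h2].
have -> : dot (toQ (a n)) l = dot c l.
  by apply/eqP; rewrite -subr_eq0 -dotBl (colsub_ker lK h1).
by rewrite ler_peMr // ltW.
Qed.

(** The forms dominated by [m] are a subspace; [m] outside [K] is chosen to make its rank least. A
    form [l] in it and outside [K] dominates a subspace of no smaller rank, hence the same one,
    which contains [m]. *)
Lemma minimal_growth : (exists m, ~ colsub m K) -> exists m (K' : 'M[rat]_r),
  [/\ ~ colsub m K, forall l, colsub l K' <-> dominated l m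
    & forall l, colsub l K' -> ~ colsub l K -> dominated m l].
Proof.
move=> [m0 hm0].
have cls m : exists K' : 'M_r, forall l, colsub l K' <-> dominated l m.
  apply: colspace_of; [exact: dominated0 | by move=> ? ?; exact: dominatedD | by move=> ? ?; exact: dominatedZ].
pose P k := exists m (K' : 'M_r),
  [/\ ~ colsub m K, forall l, colsub l K' <-> dominated l m & \rank K' = k].
have exP : exists k, `[< P k >].
  by have [K' hK'] := cls m0; exists (\rank K'); apply/asboolP; exists m0, K'.
case: (ex_minnP exP) => k /asboolP[m [K' [hm hK' rK']]] hmin.
exists m, K'; split=> // l /hK' lm lK.
have [K2 hK2] := cls l.
have s21 : (K2^T <= K'^T)%MS.
  apply/rV_subP => v vK2; rewrite -[v]trmxK; apply/hK'.
  by apply: dominated_trans lm; apply/hK2; rewrite /colsub trmxK.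
have s12 : (K'^T <= K2^T)%MS.
  rewrite -(mxrank_leqif_sup s21) eqn_leq mxrankS //= !mxrank_tr rK'.
  by apply: hmin; apply/asboolP; exists l, K2.
by apply/hK2; apply: submx_trans s12; apply/hK'; exact: dominated_refl.
Qed.

End Growth.

(** * Finite flat covers *)

Definition rows_toQ r q (f : 'I_q -> 'rV[nat]_r) : 'M[rat]_(q, r) := \matrix_i toQ (f i).

Lemma toQ_comb r q (f : 'I_q -> 'rV[nat]_r) (n : 'I_q -> nat) :
  toQ (\sum_i f i *+ n i) = (\row_i (n i)%:R) *m rows_toQ f.
Proof.
rewrite toQ_sum mulmx_sum_row; apply: eq_bigr => i _.
by rewrite toQMn mxE rowK.
Qed.

Definition congr_mod r (m : nat) (x y : 'rV[nat]_r) : Prop := forall i, x 0 i = y 0 i %[mod m].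

Lemma congr_mod_int r m (x y : 'rV[nat]_r) : congr_mod m x y ->
  exists z : 'I_r -> int, forall i, (toQ x - toQ y) 0 i = m%:R * (z i)%:~R.
Proof.
move=> h; suff /fin_all_exists : forall i, exists z : int, (toQ x - toQ y) 0 i = m%:R * z%:~R by [].
move=> i; rewrite !mxE; have e1 := divn_eq (x 0 i) m; have e2 := divn_eq (y 0 i) m; rewrite (h i) in e1.
move: (x 0%R i %/ m)%N (y 0%R i %/ m)%N (y 0%R i %% m)%N e1 e2 => q1 q2 s -> ->.
by exists (q1%:Z - q2%:Z); rewrite !natrD !natrM rmorphB /= -!pmulrn; ring.
Qed.

(** The new vectors have to be pumps, so [FS] is perturbed by the shift [s] of a sandwich. In the
    coordinates [K' *m P], dual to [FS], row [j] of [G] is [M j] times [e] plus [N] times a unit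
    vector: a rescaled rank-one perturbation of [N] times the identity. The formula for the
    coordinates is its Sherman-Morrison inverse. *)
Lemma extend_basis r q0 p p1 p2 (K : 'M[rat]_(r, p1)) (K' : 'M[rat]_(r, p2))
    (F0 : 'M[rat]_(q0, r)) (FS : 'M[rat]_(p, r)) (P : 'M[rat]_(p2, p)) (s : 'rV[rat]_r)
    (M : 'I_p -> rat) (N : rat) :
  (forall v : 'rV_r, v *m K' = 0 -> v *m K = 0) ->
  row_free F0 -> F0 *m K' = 0 -> (forall v : 'rV_r, v *m K' = 0 -> (v <= F0)%MS) ->
  FS *m K = 0 -> s *m K = 0 -> FS *m (K' *m P) = 1%:M ->
  (forall v : 'rV_r, v *m K = 0 -> (v *m K' <= FS *m K')%MS) ->
  let e := s *m (K' *m P) in let E := \sum_j e 0 j in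
  N != 0 -> N + E != 0 -> (forall j, M j != 0) ->
  let G := \matrix_j (M j *: (s + N *: row j FS)) in
  let F := col_mx F0 G in
  [/\ row_free F, F *m K = 0, forall v : 'rV_r, v *m K = 0 -> (v <= F)%MS
    & forall x : 'rV_(q0 + p), let t := x *m F *m (K' *m P) in
      forall j, x 0 (rshift q0 j) = (t 0 j - e 0 j * ((\sum_l t 0 l) / (N + E))) / N / M j].
Proof.
move=> KK' free0 F0K' span0 FSK sK FSP span1 e E N0 NE M0 G F.
have F0P : F0 *m (K' *m P) = 0 by rewrite mulmxA F0K' mul0mx.
have GP (x : 'rV_p) l : (x *m G *m (K' *m P)) 0 l =
    e 0 l * (\sum_j x 0 j * M j) + N * (x 0 l * M l).
  have -> : x *m G *m (K' *m P) = (\sum_j x 0 j * M j) *: e + N *: (\row_j (x 0 j * M j)).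
    rewrite [x *m G]mulmx_sum_row mulmx_suml scaler_suml.
    have -> : \row_j (x 0 j * M j) = \sum_j (x 0 j * M j) *: (row j FS *m (K' *m P)).
      have -> : \sum_j (x 0 j * M j) *: (row j FS *m (K' *m P)) =
          (\row_j (x 0 j * M j)) *m (FS *m (K' *m P)).
        by rewrite mulmx_sum_row; apply: eq_bigr => j _; rewrite mxE row_mul.
      by rewrite FSP mulmx1.
    rewrite scaler_sumr -big_split /=; apply: eq_bigr => j _.
    rewrite rowK -!scalemxAl mulmxDl -!scalemxAl !scalerDr !scalerA; congr (_ + _ *: _).
    by ring.
  by rewrite !mxE mulrC.
have coords (x : 'rV_(q0 + p)) : let t := x *m F *m (K' *m P) in
      forall j, x 0 (rshift q0 j) = (t 0 j - e 0 j * ((\sum_l t 0 l) / (N + E))) / N / M j.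
  move=> t j; have tE l : t 0 l = e 0 l * (\sum_j rsubmx x 0 j * M j) + N * (rsubmx x 0 l * M l).
    rewrite -GP; congr (_ 0 l).
    by rewrite /t -{1}[x]hsubmxK mul_row_col mulmxDl -[_ *m F0 *m _]mulmxA F0P mulmx0 add0r.
  set Y := \sum_j rsubmx x 0 j * M j in tE.
  have -> : \sum_l t 0 l = Y * (N + E).
    under eq_bigr => l _ do rewrite tE.
    by rewrite big_split /= -mulr_suml -mulr_sumr -/Y -/E; ring.
  rewrite mulfK // tE; have -> : x 0 (rshift q0 j) = rsubmx x 0 j by rewrite mxE.
  by field; rewrite M0 N0.
have FK : F *m K = 0.
  rewrite mul_col_mx; have -> : F0 *m K = 0.
    apply/row_matrixP=> i; rewrite row_mul row0; apply: KK'.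
    by rewrite -row_mul F0K' row0.
  have -> : G *m K = 0; last by rewrite col_mx0.
  apply/row_matrixP=> i; rewrite row_mul row0 rowK -scalemxAl mulmxDl sK -scalemxAl.
  by rewrite -row_mul FSK row0 scaler0 addr0 scaler0.
split=> //.
- apply: inj_row_free => x xF.
  have x2 : rsubmx x = 0.
    apply/rowP=> j; have := coords x j; rewrite xF mul0mx.
    rewrite [X in _ * (X / _)]big1 => [|l _]; last by rewrite mxE.
    by rewrite !mxE !(mul0r, mulr0, subr0).
  move: xF; rewrite -[x]hsubmxK x2 mul_row_col mul0mx addr0 => x1.
  by rewrite (row_free_inj free0 (_ : lsubmx x *m F0 = 0 *m F0)) ?mul0mx ?row_mx0.
- move=> v vK; pose t := v *m (K' *m P); pose T := \sum_l t 0 l.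
  pose y := \row_j ((t 0 j - e 0 j * (T / (N + E))) / N / M j).
  have yM j : y 0 j * M j = (t 0 j - e 0 j * (T / (N + E))) / N by rewrite mxE divfK.
  have Yt : \sum_j y 0 j * M j = T / (N + E).
    under eq_bigr => j _ do rewrite yM.
    rewrite -mulr_suml big_split /= sumrN -mulr_suml -/T -/E.
    by field; rewrite NE N0.
  pose w := v - y *m G.
  have wP : w *m (K' *m P) = 0.
    apply/rowP=> l; rewrite mulmxBl [LHS]mxE [X in _ + X]mxE GP Yt yM [RHS]mxE -/t.
    by field; rewrite NE N0.
  have wK : w *m K = 0.
    have := FK; rewrite mul_col_mx => /eqP; rewrite col_mx_eq0 => /andP[_ /eqP GK].
    by rewrite mulmxBl vK -mulmxA GK mulmx0 subr0.
  have wK' : w *m K' = 0.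
    have /submxP[z ez] := span1 _ wK.
    suff z0 : z = 0 by rewrite ez z0 mul0mx.
    by rewrite -[z]mulmx1 -FSP [FS *m (K' *m P)]mulmxA mulmxA -ez -mulmxA.
  have -> : v = w + y *m G by rewrite subrK.
  apply: addmx_sub.
    apply: submx_trans (span0 _ wK') _.
    by rewrite /F -addsmxE addsmxSl.
  by apply: submx_trans (submxMl _ _) _; rewrite /F -addsmxE addsmxSr.
Qed.

(** The reduction of Carathéodory, made for [U]-many [n] at once: with the number of generators
    minimal, a linear dependency would remove one generator for each [n], and by pigeonhole the same
    one for [U]-many. *)
Lemma caratheodory_ultra I (U : (I -> Prop) -> Prop) (uU : ultrafilter U)
    q r p (F : 'M[rat]_(q, r)) (L : 'M[rat]_(r, p)) (b : I -> 'rV[rat]_p) :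
  U (fun n => exists2 u, nonneg u & b n = u *m F *m L) ->
  exists k (G : 'M[rat]_(k, r)), [/\ forall i, cone F (row i G), row_free (G *m L)
    & U (fun n => exists2 u, nonneg u & b n = u *m (G *m L))].
Proof.
move=> h0.
pose P k := exists G : 'M[rat]_(k, r), (forall i, cone F (row i G)) /\
  U (fun n => exists2 u, nonneg u & b n = u *m (G *m L)).
have exP : exists k, `[< P k >].
  exists q; apply/asboolP; exists F; split; first exact: cone_row.
  by apply: (ultraS uU _ h0) => n [u hu ->]; exists u; rewrite ?mulmxA.
case: (ex_minnP exP) => k /asboolP[G [hG hU]] hmin.
exists k, G; split=> //; apply: inj_row_free => x xG; apply: contrapT => x0.
have {x x0 xG} [y [yG [i0 yi0]]] : exists y : 'rV_k, y *m (G *m L) = 0 /\ exists i, 0 < y 0 i.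
  have [i /eqP xi] : exists i, x 0 i <> 0.
    by apply: contrapT => h; apply: x0; apply/rowP=> i; rewrite mxE; apply: contrapT => hi; apply: h; exists i.
  have [hi|hi] := ltP 0 (x 0 i); first by exists x; split=> //; exists i.
  exists (- x); rewrite mulNmx xG oppr0; split=> //; exists i.
  by rewrite mxE oppr_gt0 lt_neqAle xi.
case: k G hG hU hmin y yG i0 yi0 => [|k] G hG hU hmin y yG i0 yi0; first by case: i0 yi0.
have : U (fun n => exists i : 'I_k.+1, exists2 u, nonneg u & u 0 i = 0 /\ b n = u *m (G *m L)).
  apply: (ultraS uU _ hU) => n [u hu eb].
  case: (@arg_minP _ _ _ i0 (fun i => 0 < y 0 i) (fun i => u 0 i / y 0 i) yi0) => i yi hi.
  exists i; exists (u - (u 0 i / y 0 i) *: y).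
    move=> j l; rewrite !ord1 !mxE subr_ge0.
    have [yl|yl] := ltP 0 (y 0 l); first by rewrite -ler_pdivlMr // hi.
    apply: le_trans (hu 0 l); rewrite mulr_ge0_le0 //.
    by rewrite divr_ge0 // ltW.
  by rewrite !mxE divfK ?gt_eqF // subrr mulmxBl -scalemxAl yG scaler0 subr0.
move=> /(ultra_pigeonhole uU)[i hi].
have : (k.+1 <= k)%N; last by rewrite ltnn.
apply: hmin; apply/asboolP; exists (row' i G); split.
  by move=> j; have -> : row j (row' i G) = row (lift i j) G by apply/rowP=> l; rewrite !mxE.
apply: (ultraS uU _ hi) => n [u hu [ui ->]].
exists (col' i u); first by move=> j l; rewrite mxE.
rewrite !mulmxA; congr (_ *m L).
rewrite !mulmx_sum_row (bigD1_ord i) //= ui scale0r add0r.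
apply: eq_bigr => j _; rewrite mxE; congr (_ *: _).
by apply/rowP=> l; rewrite !mxE.
Qed.

(** Controls the correction term in the coordinates of [extend_basis]: it stays below the main term
    once the [t i] are comparable and [N] is large. *)
Lemma share_le p (t e : 'I_p -> rat) (C N : rat) j :
  (forall i, 0 <= t i) -> (forall i, t i <= C * t j) -> 0 < N ->
  `|e j| * (p%:R * C) <= N -> e j * ((\sum_i t i) / N) <= t j.
Proof.
move=> t0 tC N0 eN.
rewrite mulrA ler_pdivrMr //.
have S0 : 0 <= \sum_i t i by apply: sumr_ge0.
have SC : \sum_i t i <= p%:R * (C * t j).
  have -> : p%:R * (C * t j) = \sum_(i < p) C * t j by rewrite sumr_const card_ord mulr_natl.
  exact: (ler_sum _ (fun i _ => tC i)).
apply: le_trans (ler_wpM2r S0 (ler_norm _)) _.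
apply: le_trans (ler_wpM2l (normr_ge0 _) SC) _.
rewrite [t j * N]mulrC; apply: le_trans _ (ler_wpM2r (t0 j) eN).
by rewrite !mulrA.
Qed.

(** Comparability survives bounded shifts, with [C + 1] for [C], as soon as [y] is large. *)
Lemma shift_cmp (C b y z v w : rat) : 0 <= C -> (C + 2) * b + 1 < y -> z <= C * y ->
  `|v| <= b -> `|w| <= b -> z - v <= (C + 1) * (y - w).
Proof.
move=> C0 hy hz hv hw; have h1 : C * w <= C * b by rewrite ler_wpM2l // (le_trans (ler_norm _)).
have := ler_norm (- v); rewrite normrN; have := ler_norm w; lra.
Qed.

(** * Absorbing a sequence by pumps *)

Section Absorption.

Variables (r : nat) (T : Type) (val : T -> 'rV[nat]_r) (leT : T -> T -> Prop).
Hypothesis leT_val : forall w w', leT w w' -> exists x, val w' = val w + x.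
Hypothesis leT_wqo : wqo leT.
Hypothesis leT_amalg : forall w w1 w2, leT w w1 -> leT w w2 -> exists w3,
  [/\ leT w1 w3, leT w2 w3 & val w3 + val w = val w1 + val w2].

Definition pump (w : T) (x : 'rV[nat]_r) : Prop := exists w', leT w w' /\ val w' = val w + x.

Hypothesis tame_pump : forall w, tame (qcone (pump w)).
Hypothesis val_surj : forall x, exists w, val w = x.

(** By amalgamation; it allows the base object to be chosen after the pumps. *)
Lemma pump_mono w w' x : leT w w' -> pump w x -> pump w' x.
Proof.
move=> ww' [w1 [ww1 e1]]; have [w3 [h1 h2 e3]] := leT_amalg ww' ww1.
by exists w3; split=> //; vnat.
Qed.

Variables (I : Type) (U : (I -> Prop) -> Prop).
Hypothesis uU : ultrafilter U.
Variable h : I -> nat.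
Hypothesis h_unbounded : forall B, U (fun n => (B <= h n)%N).

Lemma ultra_residue (a : I -> 'rV[nat]_r) m : (0 < m)%N ->
  U (fun k => U (fun n => congr_mod m (a n) (a k))).
Proof.
case: m => // m _.
have [v hv] := ultra_const uU (fun n => [ffun i => inord (a n 0 i %% m.+1)] : {ffun 'I_r -> 'I_m.+1}).
apply: (ultraS uU _ hv) => k ek; apply: (ultraS uU _ hv) => n en i.
move: ek; rewrite -en => /ffunP/(_ i); rewrite !ffunE => /(congr1 (@nat_of_ord _)).
by rewrite !inordK ?ltn_pmod.
Qed.

(* Along [U], [a] is covered by one object and finitely many of its pumps, which
   form a basis of [ker K], with multiplicities divisible by [M]. *)
Definition absorbed (a : I -> 'rV[rat]_r) p (K : 'M[rat]_(r, p)) (M : nat) (w : T) q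
    (f : 'I_q -> 'rV[nat]_r) : Prop :=
  [/\ row_free (rows_toQ f), rows_toQ f *m K = 0,
    forall v : 'rV[rat]_r, v *m K = 0 -> (v <= rows_toQ f)%MS,
    forall i, pump w (f i)
  & U (fun n => exists x : 'I_q -> nat, a n = toQ (val w + \sum_i f i *+ (M * x i)))].

Section Step.

Variables (a : I -> 'rV[nat]_r) (K : 'M[rat]_r) (c : 'rV[rat]_r).
Hypothesis constK : U (fun n => (toQ (a n) - c) *m K = 0).
Hypothesis ndK : nondegenerate U a K.
Variables (mu : 'cV[rat]_r) (K' : 'M[rat]_r).
Hypothesis muK : ~ colsub mu K.
Hypothesis K'P : forall l, colsub l K' <-> dominated U a l mu.
Hypothesis mu_dom : forall l, colsub l K' -> ~ colsub l K -> dominated U a mu l.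

Let Pi : 'M[rat]_r := K' *m pinvmx K'.

Lemma PiK' : Pi *m K' = K'.
Proof. exact: mulmxKpV. Qed.

Lemma colsub_KK' l : colsub l K -> colsub l K'.
Proof. by move=> lK; apply/K'P; exact (const_dominated uU ndK constK lK muK). Qed.

Lemma ker_K'K (v : 'rV[rat]_r) : v *m K' = 0 -> v *m K = 0.
Proof.
move=> vK'; apply/rowP=> j; rewrite -dot_col mxE; apply: (colsub_ker _ vK').
apply: colsub_KK'; rewrite colE; exact: colsub_mul.
Qed.

(** Since [Pi *m K' = K'], this moves [a n] to where the forms of [K'] take their values at [a k].
    Any form changes only by a form of [K'], that is, of slowest growth. *)
Definition slice (k n : I) : 'rV[rat]_r := toQ (a n) - (toQ (a n) - toQ (a k)) *m Pi.

Lemma sliceK' k n : (slice k n - toQ (a k)) *m K' = 0.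
Proof.
by rewrite /slice addrAC mulmxBl -mulmxA PiK' subrr.
Qed.

Lemma dot_Pi_dominated l : exists2 C, 0 <= C &
  U (fun n => `|dot (toQ (a n) *m Pi) l| <= C * `|dot (toQ (a n)) mu|).
Proof.
have hl : colsub (Pi *m l) K' by rewrite /Pi -mulmxA; exact: colsub_mul.
have [C C0 hC] := dominatedP uU (proj1 (K'P _) hl).
by exists C => //; apply: (ultraS uU _ hC) => n; rewrite dot_mulmx.
Qed.

(* Away from the slowest growth class the sequence outgrows its projection. *)
Lemma dot_outgrows l B k : ~ colsub l K' ->
  U (fun n => `|dot ((toQ (a n) - toQ (a k)) *m Pi) l| + B < `|dot (toQ (a n)) l|).
Proof.
move=> lK'; have [C C0 hC] := dot_Pi_dominated l.
pose b := `|dot (toQ (a k) *m Pi) l| + `|B|.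
have ndl : ~ dominated U a l mu by move=> /K'P.
have hl := not_dominated uU (C + b) ndl.
have hm := nondegenerate_unbounded uU ndK 1 muK.
apply: (ultraS uU _ (ultraI uU hC (ultraI uU hl hm))) => n [h1 [h2 h3]].
rewrite mulmxBl dotBl; apply: le_lt_trans h2; rewrite mulrDl.
apply: le_trans (lerD (ler_normB _ _) (ler_norm B)) _.
rewrite -addrA lerD // -/b ler_peMr ?addr_ge0 //; exact: ltW.
Qed.

(** Coordinates in [K'] are frozen at those of [a k], and the others outgrow the correction. For
    integrality [m] clears the denominators of [Pi]. *)
Lemma slice_nat : exists2 m : nat, (0 < m)%N & forall k,
  U (fun n => congr_mod m (a n) (a k)) -> U (fun n => exists y, slice k n = toQ y).
Proof.
have [m m0 hm] := clear_denoms Pi; exists m => // k hk.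
have hpos : U (fun n => forall i, 0 <= slice k n 0 i).
  apply: (ultra_all uU) => i.
  pose l : 'cV[rat]_r := delta_mx i 0.
  have dl (v : 'rV_r) : dot v l = v 0 i.
    rewrite /dot mxE (bigD1 i) //= big1 => [|j ji]; first by rewrite mxE !eqxx mulr1 addr0.
    by rewrite mxE (negbTE ji) mulr0.
  have [lK'|lK'] := pselect (colsub l K').
    apply: (ultraT uU) => n.
    have := colsub_ker lK' (sliceK' k n); rewrite dotBl !dl => /eqP.
    by rewrite subr_eq0 => /eqP ->; rewrite mxE.
  apply: (ultraS uU _ (dot_outgrows 0 k lK')) => n; rewrite /slice !dl addr0 => hn.
  rewrite mxE [X in _ + X]mxE subr_ge0; apply: le_trans (ler_norm _) (ltW (lt_le_trans hn _)).
  by rewrite ger0_norm // mxE.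
apply: (ultraS uU _ (ultraI uU hk hpos)) => n [/congr_mod_int[z hz] hp].
have hi i : exists y : nat, slice k n 0 i = y%:R.
  have [u hu] : exists u : int, slice k n 0 i = u%:~R.
    have [t ht] := choice (fun j => hm j i).
    exists ((a n 0 i)%:Z - \sum_j z j * t j).
    rewrite mxE [X in _ + X]mxE [toQ _ _ _]mxE rmorphB /=; congr (_ - _).
    rewrite mxE rmorph_sum; apply: eq_bigr => j _.
    by rewrite hz rmorphM /= -ht; ring.
  by have := hp i; rewrite hu ler0z; case: u {hu} => // u _; exists u.
have /fin_all_exists[y hy] := hi.
by exists (\row_i y i); apply/rowP=> i; rewrite hy !mxE.
Qed.

Hypothesis IH : forall (a' : I -> 'rV[nat]_r) c', U (fun n => (toQ (a' n) - c') *m K' = 0) ->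
  nondegenerate U a' K' -> forall M, (0 < M)%N ->
  exists w q (f : 'I_q -> 'rV[nat]_r), absorbed (fun n => toQ (a' n)) K' M w f.

(** If [l] is constant on the slices, then [l - Pi *m l] is constant along [a], hence in [K]. So the
    slices are nondegenerate for [K'] and the induction hypothesis applies. *)
Lemma slice_absorbed : exists2 m : nat, (0 < m)%N & forall k,
  U (fun n => congr_mod m (a n) (a k)) -> forall M, (0 < M)%N ->
  exists w q (f : 'I_q -> 'rV[nat]_r), absorbed (slice k) K' M w f.
Proof.
have [m m0 hm] := slice_nat; exists m => // k /hm hk M M0.
have /choice[a' ha'] : forall n, exists y, (exists y, slice k n = toQ y) -> slice k n = toQ y.
  by move=> n; have [[y e]|no] := pselect (exists y, slice k n = toQ y); [exists y | exists 0].
have ea' : U (fun n => slice k n = toQ (a' n)) by apply: (ultraS uU _ hk) => n /ha'.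
have h1 : U (fun n => (toQ (a' n) - toQ (a k)) *m K' = 0).
  by apply: (ultraS uU _ ea') => n <-; exact: sliceK'.
have h2 : nondegenerate U a' K'.
  move=> l b hb.
  have lK : colsub (l - Pi *m l) K.
    apply: (ndK (b := b - dot (toQ (a k) *m Pi) l)).
    apply: (ultraS uU _ (ultraI uU ea' hb)) => n [e1 e2].
    by rewrite -e2 -e1 /slice mulmxBl dotBr !dotBl !dot_mulmx; ring.
  have -> : l = (l - Pi *m l) + K' *m (pinvmx K' *m l) by rewrite mulmxA subrK.
  by apply: colsubD; [exact: colsub_KK' | exact: colsub_mul].
have [w [q [f [f1 f2 f3 f4 f5]]]] := IH h1 h2 M0.
exists w, q, f; split=> //.
by apply: (ultraS uU _ (ultraI uU ea' f5)) => n [-> ].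
Qed.

Lemma absorbed_val k M w q (f : 'I_q -> 'rV[nat]_r) : absorbed (slice k) K' M w f ->
  (toQ (val w) - toQ (a k)) *m K' = 0.
Proof.
move=> [_ fK' _ _ /(ultra_ex uU)[n [x e]]].
have := sliceK' k n; rewrite e toQD toQ_comb addrAC mulmxDl -mulmxA fK' mulmx0 addr0.
by [].
Qed.

(* The pumps that serve the slices at [k0] are completed to a basis by
   directions of the slowest growth class, taken from the tame cone of pumps.
   The base object [W k1] is chosen after the denominators of this basis are
   known, which makes the coordinates integral. *)
Lemma step_absorbed M : (0 < M)%N ->
  exists w q (f : 'I_q -> 'rV[nat]_r), absorbed (fun n => toQ (a n)) K M w f.
Proof.
move=> M0; have [m m0 hm] := slice_absorbed.
pose good k := (toQ (a k) - c) *m K = 0 /\ U (fun n => congr_mod m (a n) (a k)).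
have hgood : U good := ultraI uU constK (ultra_residue a m0).
have [w00 _] := val_surj 0.
(* The number that must divide the multiplicities is known only at the end; it divides the factorial
   of [h k] once [h k] is large. *)
have /choice[t ht] : forall k, exists t : T * {q & 'I_q -> 'rV[nat]_r},
    good k -> absorbed (slice k) K' (h k)`! t.1 (projT2 t.2).
  move=> k; have [gk|nk] := pselect (good k).
    have [w [q [f hf]]] := hm k (proj2 gk) _ (fact_gt0 (h k)).
    by exists (w, existT _ q f).
  by exists (w00, existT _ 0%N (fun _ => 0)).
pose W k := (t k).1.
have hW k : good k -> (toQ (val (W k)) - toQ (a k)) *m K' = 0.
  by move=> /ht; exact: absorbed_val.
have hchain := ultra_wqo uU W leT_wqo.
have [k0 [g0 c0]] := ultra_ex uU (ultraI uU hgood hchain).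
move: (ht k0 g0); rewrite -/(W k0); move: (t k0).2 => [q0 f0] /= [free0 F0K' span0 D0 U0].
set w0 := W k0 in c0 D0 U0; pose F0 := rows_toQ f0.
have [qF [F [s [Fi Fii]]]] := tame_pump w0 K.
(* [val (W n) - val w0] is a pump of [w0] with the same image under [K'] as [a n - a k0]. *)
have hcone : U (fun n => exists2 u, nonneg u & (toQ (a n) - toQ (a k0)) *m K' = u *m F *m K').
  apply: (ultraS uU _ (ultraI uU hgood c0)) => n [gn le0n].
  have [x ex] := leT_val le0n.
  have exQ : toQ x = toQ (val (W n)) - toQ (val w0) by rewrite ex toQD addrC addKr.
  have xK' : toQ x *m K' = (toQ (a n) - toQ (a k0)) *m K'.
    have -> : toQ x = (toQ (val (W n)) - toQ (a n)) - (toQ (val w0) - toQ (a k0))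
        + (toQ (a n) - toQ (a k0)).
      by rewrite exQ; apply/rowP=> i; rewrite !mxE; ring.
    by rewrite mulmxDl mulmxBl !hW // subrr add0r.
  have xK : toQ x *m K = 0.
    have -> : toQ x = (toQ x - (toQ (a n) - toQ (a k0))) + ((toQ (a n) - c) - (toQ (a k0) - c)).
      by apply/rowP=> i; rewrite !mxE; ring.
    rewrite mulmxDl (ker_K'K (v := _ - _)); last by rewrite mulmxBl xK' subrr.
    by rewrite mulmxBl (proj1 gn) (proj1 g0) subrr addr0.
  have [u hu eu] : cone F (toQ x) by apply: Fi => //; apply: qcone_toQ; exists (W n).
  by exists u; rewrite // -eu xK'.
have [p [FS [hFS freeB hB]]] := caratheodory_ultra uU hcone.
pose P := pinvmx (FS *m K').
have FSP : FS *m (K' *m P) = 1%:M by rewrite mulmxA mulmxVp.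
have sK : s *m K = 0 by have [_] := Fii 0 (cone0 F); rewrite addr0.
have coneK v : cone F v -> v *m K = 0 by move=> /Fii[_]; rewrite mulmxDl sK add0r.
have FSK : FS *m K = 0.
  by apply/row_matrixP=> i; rewrite row_mul row0; exact: coneK.
(* By [hB], a form of [K'] that vanishes on the rows of [FS] is constant along [U], hence belongs to
   [K]. *)
have span1 (v : 'rV_r) : v *m K = 0 -> (v *m K' <= FS *m K')%MS.
  move=> vK; rewrite submxE; apply/eqP/rowP=> j; rewrite -mulmxA -dot_col mxE.
  apply: (colsub_ker (K := K)) => //; apply: (ndK (b := dot (toQ (a k0)) (col j (K' *m cokermx (FS *m K'))))).
  apply: (ultraS uU _ hB) => n [u _ eu]; apply/eqP; rewrite -subr_eq0 -dotBl.
  by rewrite dot_col mulmxA eu -mulmxA mulmx_coker mulmx0 mxE.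
pose lam j : 'cV_r := col j (K' *m P).
have lamK' j : colsub (lam j) K' by rewrite /lam colE -mulmxA; exact: colsub_mul.
have lamK j : ~ colsub (lam j) K.
  move=> hl; have := colsub_ker hl (_ : row j FS *m K = 0); rewrite -row_mul FSK row0 => /(_ erefl).
  rewrite dot_col -row_mul FSP => /eqP.
  by rewrite !mxE eqxx oner_eq0.
have /fin_all_exists[C hC] : forall ij : 'I_p * 'I_p, exists C,
    0 <= C /\ U (fun n => `|dot (toQ (a n)) (lam ij.1)| <= C * `|dot (toQ (a n)) (lam ij.2)|).
  move=> [i j]; have [|C] := dominatedP uU (l := lam i) (m := lam j) (a := a); last by exists C.
  apply: (dominated_trans uU (m := mu)); first exact/K'P.
  exact: mu_dom.
pose Cm := \sum_ij C ij.
have Cm0 : 0 <= Cm by apply: sumr_ge0 => ij _; case: (hC ij).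
have hCm i j : U (fun n => `|dot (toQ (a n)) (lam i)| <= Cm * `|dot (toQ (a n)) (lam j)|).
  case: (hC (i, j)) => C0 hCij; apply: (ultraS uU _ hCij) => n hn; apply: le_trans hn _.
  rewrite ler_wpM2r // /Cm (bigD1 (i, j)) //= lerDl; apply: sumr_ge0 => ij _.
  by case: (hC ij).
pose e := s *m (K' *m P); pose E := \sum_j e 0 j.
(* [N] exceeds [|E|], so [N + E] is positive, and [N + E] meets the bound of [share_le] for the
   constant [Cm + 1] of [shift_cmp]. *)
pose N := 1 + `|E| + \sum_j `|e 0 j| * (p%:R * (Cm + 1)).
have sum0 : 0 <= \sum_j `|e 0 j| * (p%:R * (Cm + 1)).
  by apply: sumr_ge0 => j _; rewrite mulr_ge0 // mulr_ge0 // addr_ge0.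
have E0 : 0 <= `|E| + E by have := ler_norm (- E); rewrite normrN; lra.
have N0 : 0 < N by rewrite /N; have := normr_ge0 E; lra.
have NE0 : 0 < N + E by rewrite /N; lra.
have eN j : `|e 0 j| * (p%:R * (Cm + 1)) <= N + E.
  have hj : `|e 0 j| * (p%:R * (Cm + 1)) <= \sum_j `|e 0 j| * (p%:R * (Cm + 1)).
    rewrite [leRHS](bigD1 j) //= lerDl; apply: sumr_ge0 => i _.
    by rewrite mulr_ge0 // mulr_ge0 // addr_ge0.
  by rewrite /N; lra.
have /fin_all_exists[Mg hMg] : forall j, exists Mg : nat * 'rV[nat]_r,
    [/\ (0 < Mg.1)%N, pump w0 Mg.2 & Mg.1%:R *: (s + N *: row j FS) = toQ Mg.2].
  move=> j; have [[M' [x hx]] _] := Fii _ (coneZ (ltW N0) (hFS j)).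
  by exists (M', x).
pose f i := match split i with inl i => f0 i | inr j => (Mg j).2 end.
have ef : rows_toQ f = col_mx F0 (\matrix_j ((Mg j).1%:R *: (s + N *: row j FS))).
  apply/row_matrixP=> i; rewrite rowK /f -[in RHS](splitK i); case: split => j /=.
    by rewrite rowKu rowK.
  by rewrite rowKd rowK; case: (hMg j).
have Mg0 j : (Mg j).1%:R != 0 :> rat by rewrite pnatr_eq0 -lt0n; case: (hMg j).
have [] := extend_basis ker_K'K free0 F0K' span0 FSK sK FSP span1 (lt0r_neq0 N0) (lt0r_neq0 NE0) Mg0.
rewrite -/F0 -ef -/e => freeF FK spanF coordF.
pose X (v0 : 'rV_r) n := (toQ (a n) - v0) *m pinvmx (rows_toQ f).
(* The offset [v0] is arbitrary because the base object is chosen afterwards. *)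
have Xpos v0 : U (fun n => (toQ (a n) - v0) *m K = 0) -> U (fun n => forall j, 0 <= X v0 n 0 j).
  move=> hv0.
  have fV : rows_toQ f *m pinvmx (rows_toQ f) = 1%:M by exact: mulmxVp.
  apply: (ultra_all uU) => j; case: (split_ordP j) => [i ->|i ->].
    (* The coordinate form of a vector of [F0] is not in [K'], so it outgrows its projection; on the
       slices at [k0] it is bounded below by [U0], which fixes its sign. *)
    pose nu : 'cV_r := col (lshift p i) (pinvmx (rows_toQ f)).
    have F0nu (x : 'rV_q0) : dot (x *m F0) nu = x 0 i.
      have -> : x *m F0 = row_mx x 0 *m rows_toQ f by rewrite ef mul_row_col mul0mx addr0.
      by rewrite dot_col -mulmxA fV mulmx1 row_mxEl.
    have nuK' : ~ colsub nu K'.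
      move=> hn; have := colsub_ker hn (_ : delta_mx 0 i *m F0 *m K' = 0).
      rewrite -mulmxA F0K' mulmx0 F0nu => /(_ erefl) /eqP.
      by rewrite mxE !eqxx oner_eq0.
    have hout := dot_outgrows (`|dot v0 nu| + `|dot (toQ (val w0)) nu|) k0 nuK'.
    apply: (ultraS uU _ (ultraI uU U0 hout)) => n [[x ex] ho].
    rewrite /X -dot_col dotBl -/nu.
    have := congr1 (fun v => dot v nu) ex.
    rewrite /= /slice dotBl toQD toQ_comb dotDl F0nu mxE.
    set y := dot (toQ (a n)) nu in ho *; set z := dot (_ *m Pi) nu in ho *.
    set b := dot (toQ (val w0)) nu in ho * => ey.
    have xpos : 0 <= ((h k0)`! * x i)%N%:R :> rat by [].
    have := ler_norm (- z); have := ler_norm (dot v0 nu); have := ler_norm (- b); rewrite !normrN.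
    have := normr_ge0 (dot v0 nu).
    have [y0|y0] := ltP y 0; first by move: ho; rewrite (ltr0_norm y0); lra.
    by move: ho; rewrite (ger0_norm y0); have := normr_ge0 z; have := normr_ge0 b; lra.
  (* [beta] bounds the forms [lam] on both [v0] and [a k0]; it is the shift against which their
     values on [a n] must be large. *)
  pose beta := \sum_j (`|dot v0 (lam j)| + `|dot (toQ (a k0)) (lam j)|).
  have hbeta l : `|dot v0 (lam l)| + `|dot (toQ (a k0)) (lam l)| <= beta.
    rewrite /beta (bigD1 l) //= lerDl; apply: sumr_ge0 => l' _.
    by rewrite addr_ge0.
  have beta0 : 0 <= beta by apply: sumr_ge0 => l _; rewrite addr_ge0.
  have hbig : U (fun n => forall l, (Cm + 2) * beta + 1 < `|dot (toQ (a n)) (lam l)|).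
    by apply: (ultra_all uU) => l; apply: (nondegenerate_unbounded uU ndK).
  have hcmp : U (fun n => forall l, `|dot (toQ (a n)) (lam l)| <= Cm * `|dot (toQ (a n)) (lam i)|).
    by apply: (ultra_all uU) => l.
  apply: (ultraS uU _ (ultraI uU (ultraI uU hv0 hB) (ultraI uU hbig hcmp))).
  move=> n [[hn [u hu eu]] [hb hc]].
  have eX : X v0 n *m rows_toQ f = toQ (a n) - v0 by exact (mulmxKpV (spanF _ hn)).
  have := coordF (X v0 n) i; rewrite eX => ->.
  apply: divr_ge0; last by [].
  apply: divr_ge0; last exact: ltW.
  rewrite subr_ge0.
  have tl l : ((toQ (a n) - v0) *m (K' *m P)) 0 l = dot (toQ (a n)) (lam l) - dot v0 (lam l).
    by rewrite -dot_col dotBl.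
  (* On [a n - a k0] the form [lam l] is the nonnegative coefficient [u 0 l]; a large absolute value
     therefore means a positive value. *)
  have ypos l : - `|dot (toQ (a k0)) (lam l)| <= dot (toQ (a n)) (lam l).
    have : 0 <= dot (toQ (a n) - toQ (a k0)) (lam l).
      by rewrite dot_col mulmxA eu -mulmxA -mulmxA FSP mulmx1; exact: hu.
    by rewrite dotBl; have := ler_norm (- dot (toQ (a k0)) (lam l)); rewrite normrN; lra.
  have ybig l : dot (toQ (a n)) (lam l) = `|dot (toQ (a n)) (lam l)|.
    have [y0|y0] := ltP (dot (toQ (a n)) (lam l)) 0; last by rewrite ger0_norm.
    have := hb l; rewrite (ltr0_norm y0); have := ypos l; have := hbeta l.
    have := normr_ge0 (dot v0 (lam l)); have : 0 <= Cm * beta by exact: mulr_ge0.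
    by lra.
  have vle l : `|dot v0 (lam l)| <= beta.
    by have := hbeta l; have := normr_ge0 (dot (toQ (a k0)) (lam l)); lra.
  apply: (share_le (C := Cm + 1)) => //.
    move=> l; rewrite tl ybig; have := hb l; have := vle l; have := ler_norm (dot v0 (lam l)).
    by have : 0 <= Cm * beta by [exact: mulr_ge0]; lra.
  by move=> l; rewrite !tl (ybig l) (ybig i); exact: (shift_cmp Cm0 (hb i) (hc l) (vle l) (vle i)).
have [m1 m10 hm1] := clear_denoms (pinvmx (rows_toQ f)).
have [m2 m20 hm2] := clear_denoms Pi.
(* [m2] is spent on the denominators of [Pi], [m1] on those of the inverse basis, and the factor [M]
   remains in the coordinates. *)
pose m3 := (m2 * (M * m1))%N.
have m30 : (0 < m3)%N by rewrite !muln_gt0 m20 M0 m10.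
(* [k1] is taken above [k0], so that the pumps survive, and with [h k1] large enough for [M * m1] to
   divide the multiplicities on its slices. *)
have [k1 [[g1 le1] [hk1 res1]]] := ultra_ex uU (ultraI uU (ultraI uU hgood c0)
  (ultraI uU (h_unbounded (M * m1)) (ultra_residue a m30))).
have U1 := ht k1 g1; have {U1} := U1; case: (t k1).2 => [q1 f1] /= [_ _ _ _ U1].
pose v1 := toQ (val (W k1)).
have hv1 : U (fun n => (toQ (a n) - v1) *m K = 0).
  apply: (ultraS uU _ constK) => n hn.
  have -> : toQ (a n) - v1 = (toQ (a n) - c) - (toQ (a k1) - c) - (v1 - toQ (a k1)).
    by apply/rowP=> i; rewrite !mxE; ring.
  rewrite mulmxBl (ker_K'K (hW _ g1)) mulmxBl hn (proj1 g1).
  by rewrite !subr0.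
exists (W k1), (q0 + p)%N, f; split=> //.
  move=> i; apply: (pump_mono le1); rewrite /f; case: split => j; first exact: D0.
  by case: (hMg j).
apply: (ultraS uU _ (ultraI uU (ultraI uU hv1 (Xpos _ hv1)) (ultraI uU res1 U1))).
move=> n [[hn xpos] [/congr_mod_int[z hz] [x ex]]].
have eX : X v1 n *m rows_toQ f = toQ (a n) - v1 by exact (mulmxKpV (spanF _ hn)).
have Mm1 : (M * m1 %| (h k1)`!)%N.
  by apply: dvdn_fact; rewrite muln_gt0 M0 m10.
have hint i : exists y : int, (toQ (a n) - v1) 0 i = (M * m1)%:R * y%:~R.
  have [t2 ht2] := choice (fun j => hm2 j i).
  have [d hd] := dvdnP Mm1.
  exists (\sum_j z j * t2 j + \sum_j (d * x j * f1 j 0%R i)%N%:Z).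
  have -> : toQ (a n) - v1 = (toQ (a n) - toQ (a k1)) *m Pi + toQ (\sum_j f1 j *+ ((h k1)`! * x j)).
    have -> : toQ (a n) - v1 = slice k1 n - v1 + (toQ (a n) - toQ (a k1)) *m Pi.
      by rewrite /slice [_ - _ - v1]addrAC subrK.
    by rewrite ex toQD -/v1 [v1 + _]addrC addrK addrC.
  rewrite mxE rmorphD mulrDr; congr (_ + _).
    rewrite mxE rmorph_sum mulr_sumr; apply: eq_bigr => j _.
    by rewrite hz rmorphM /= -ht2 /m3 !natrM; ring.
  rewrite mxE summxE natr_sum rmorph_sum mulr_sumr; apply: eq_bigr => j _.
  by rewrite mulmxnE nat_mulrnE hd /= -pmulrn !natrM; ring.
have hX i : exists y : nat, X v1 n 0 i = (M * y)%:R.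
  have [y ey] : exists y : int, X v1 n 0 i = M%:R * y%:~R.
    have [u hu] := choice hint; have [t1 ht1] := choice (fun j => hm1 j i).
    exists (\sum_j u j * t1 j); rewrite mxE rmorph_sum mulr_sumr; apply: eq_bigr => j _.
    by rewrite hu rmorphM /= -ht1 natrM; ring.
  have := xpos i; rewrite ey pmulr_rge0 ?ltr0n // ler0z.
  by case: y {ey} => // y _; exists y; rewrite natrM.
have /fin_all_exists[y hy] := hX.
exists y; rewrite toQD toQ_comb -/v1.
have -> : \row_i (M * y i)%:R = X v1 n by apply/rowP=> i; rewrite mxE hy.
by rewrite eX addrC subrK.
Qed.

End Step.

End Absorption.

(** * From the ultrafilter to a finite cover *)

Section Cover.

Variables (r : nat) (T : Type) (val : T -> 'rV[nat]_r) (leT : T -> T -> Prop).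
Hypothesis leT_val : forall w w', leT w w' -> exists x, val w' = val w + x.
Hypothesis leT_wqo : wqo leT.
Hypothesis leT_amalg : forall w w1 w2, leT w w1 -> leT w w2 -> exists w3,
  [/\ leT w1 w3, leT w2 w3 & val w3 + val w = val w1 + val w2].
Local Notation pump := (@pump r T val leT).
Hypothesis tame_pump : forall w, tame (qcone (pump w)).
Hypothesis val_surj : forall x, exists w, val w = x.

(** Induction on the number of independent forms that are not constant; when none is left, the
    sequence is constant along [U] and one object without pumps suffices. *)
Lemma absorb I (U : (I -> Prop) -> Prop) (uU : ultrafilter U) (h : I -> nat) :
  (forall B, U (fun n => (B <= h n)%N)) ->
  forall (K : 'M[rat]_r) (a : I -> 'rV[nat]_r) c,
  U (fun n => (toQ (a n) - c) *m K = 0) -> nondegenerate U a K ->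
  forall M, (0 < M)%N ->
  exists w q (f : 'I_q -> 'rV[nat]_r), absorbed val leT U (fun n => toQ (a n)) K M w f.
Proof.
move=> hh K; have [m] := ubnP (r - \rank K)%N; elim: m K => // m IH K hm a c constK ndK M M0.
have [hmu|full] := pselect (exists mu, ~ colsub mu K).
  have [mu [K' [muK K'P mu_dom]]] := minimal_growth uU a hmu.
  apply: (step_absorbed leT_val leT_wqo leT_amalg tame_pump val_surj uU hh
    constK ndK muK K'P mu_dom _ M0) => a' c' constK' ndK'.
  apply: (IH K' _ a' c' constK' ndK'); apply: leq_trans (ltnSE hm).
  have KK' : (K^T <= K'^T)%MS.
    apply/rV_subP => v vK; rewrite -[v]trmxK; apply: (colsub_KK' uU constK ndK muK K'P).
    by rewrite /colsub trmxK.
  have ltK : (K^T < K'^T)%MS.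
    rewrite ltmxE KK'; apply/negP=> K'K; apply: muK; apply: submx_trans K'K.
    by apply/K'P; exact: dominated_refl.
  move: ltK; rewrite ltmxErank !mxrank_tr => /andP[_]; have := rank_leq_row K'; lia.
have allK mu : colsub mu K by apply: contrapT => hn; apply: full; exists mu.
have hc : U (fun n => toQ (a n) = c).
  apply: (ultraS uU _ constK) => n hn; apply/eqP; rewrite -subr_eq0; apply/eqP/rowP=> i.
  have := colsub_ker (allK (col i 1%:M)) hn.
  by rewrite dot_col mulmx1 => ->; rewrite mxE.
have [n0 en0] := ultra_ex uU hc; have [w ew] := val_surj (a n0).
exists w, 0%N, (fun _ => 0); split.
- by rewrite /row_free -leqn0 rank_leq_row.
- by apply/row_matrixP=> -[].
- move=> v vK; suff -> : v = 0 by exact: sub0mx.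
  apply/rowP=> i; have := colsub_ker (allK (col i 1%:M)) vK.
  by rewrite dot_col mulmx1 => ->; rewrite mxE.
- by case.
- apply: (ultraS uU _ hc) => n en; exists (fun _ => 0%N).
  by rewrite big_ord0 addr0 ew en0 en.
Qed.

Definition flat_set (w : T) q (f : 'I_q -> 'rV[nat]_r) (x : 'rV[nat]_r) : Prop :=
  exists n : 'I_q -> nat, x = val w + \sum_i f i *+ n i.

Record flat_index := FlatIndex {
  fi_base : T;
  fi_size : nat;
  fi_pump : 'I_fi_size -> 'rV[nat]_r;
  fi_ok : forall i, pump fi_base (fi_pump i)
}.

Lemma finite_flat_cover : exists s : seq flat_index, forall x, exists j,
  List.In j s /\ flat_set (fi_base j) (@fi_pump j) x.
Proof.
apply: contrapT => hn.
have [|U [uU hU]] := @ultrafilter_avoiding _ flat_index (fun j => flat_set (fi_base j) (@fi_pump j)).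
  move=> s; apply: contrapT => h; apply: hn; exists s => x; apply: contrapT => hx.
  by apply: h; exists x => j js jx; apply: hx; exists j.
(* Points are flat sets, so [U] is not principal; this makes the sum of the coordinates unbounded
   along [U]. *)
have point v : ~ U (fun n => n = v).
  move=> hv; have [w ew] := val_surj v.
  pose j := @FlatIndex w 0 (fun _ => 0) (fun i => match i with Ordinal _ h => False_ind _ (notF h) end).
  have [x [-> ]] := ultra_ex uU (ultraI uU hv (hU j)); apply.
  by exists (fun _ => 0%N); rewrite big_ord0 addr0.
pose a (n : 'rV[nat]_r) := n; pose h (n : 'rV[nat]_r) := (\sum_i n 0%R i)%N.
have hh B : U (fun n => (B <= h n)%N).
  case: (ultra_em uU (fun n => (B <= h n)%N)) => // hB.
  have /fin_all_exists[v hv] : forall i, exists v, U (fun n : 'rV[nat]_r => n 0 i = v).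
    move=> i; apply: (ultra_const_bounded uU (B := B)); apply: (ultraS uU _ hB) => n.
    move/negP; rewrite -ltnNge => /ltnW; apply: leq_trans.
    by rewrite /h (bigD1 i) //= leq_addr.
  case: (point (\row_i v i)); apply: (ultraS uU _ (ultra_all uU hv)) => n en.
  by apply/rowP=> i; rewrite mxE en.
have [K hK] : exists K : 'M[rat]_r, forall l, colsub l K <-> exists b, U (fun n => dot (toQ (a n)) l = b).
  apply: colspace_of.
  - by exists 0; apply: (ultraT uU) => n; rewrite dot0r.
  - move=> l l' [b hb] [b' hb']; exists (b + b').
    by apply: (ultraS uU _ (ultraI uU hb hb')) => n [<- <-]; rewrite dotDr.
  - by move=> k l [b hb]; exists (k * b); apply: (ultraS uU _ hb) => n <-; rewrite dotZr.
have ndK : nondegenerate U a K by move=> l b hb; apply/hK; exists b.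
have /fin_all_exists[b hb] : forall j, exists b, U (fun n => dot (toQ (a n)) (col j K) = b).
  by move=> j; apply/hK; rewrite colE; exact: colsub_mul.
have hb' := ultra_all uU hb; have [n0 hn0] := ultra_ex uU hb'.
have constK : U (fun n => (toQ (a n) - toQ (a n0)) *m K = 0).
  apply: (ultraS uU _ hb') => n hn'; apply/rowP=> j.
  by rewrite -dot_col dotBl hn' hn0 subrr mxE.
have [w [q [f [_ _ _ hf hw]]]] := absorb uU hh constK ndK (ltn0Sn 0).
have [n [[x ex] h']] := ultra_ex uU (ultraI uU hw (hU (FlatIndex hf))); apply: h'.
exists x; apply: toQ_inj; rewrite ex; congr toQ; congr (_ + _).
by apply: eq_bigr => i _; rewrite mul1n.
Qed.

End Cover.

(** * Linear sets of reachable pairs *)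

Section Linear.

Variables (d : nat) (E : finType) (eff : E -> 'rV[int]_d) (pri : E -> 'I_d.+1).

Local Notation vec := 'rV[nat]_d.
Local Notation flat_rel := (flat_rel eff pri).

Lemma flat_rel_refl ws x : flat_rel ws x x.
Proof. by elim: ws => //= w ws IH; exists x; split=> //; exact: rt_refl. Qed.

(** Starred words may be iterated zero times, so concatenating the lists covers the union. *)
Lemma flat_rel_union J (Q : J -> vec -> vec -> Prop) (s : seq J) :
  (forall j, exists ws, forall x y, Q j x y -> flat_rel ws x y) ->
  exists ws, forall j, List.In j s -> forall x y, Q j x y -> flat_rel ws x y.
Proof.
move=> h; elim: s => [|j s [ws IH]]; first by exists [::].
have [ws' h'] := h j; exists (ws' ++ ws) => i /= [<-|hi] x y Qxy; apply/flat_rel_cat.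
  by exists y; split; [exact: h' | exact: flat_rel_refl].
by exists x; split; [exact: flat_rel_refl | exact: IH hi _ _ Qxy].
Qed.

Variables (g : nat) (S : sys d).
Hypothesis gS : good eff pri g S.
Variables (n : nat) (b : 'rV[nat]_(d + d)) (p : 'I_n -> 'rV[nat]_(d + d)).

Definition comb (k : 'rV[nat]_n) : 'rV[nat]_(d + d) := \sum_i p i *+ k 0 i.

Lemma combD k k' : comb (k + k') = comb k + comb k'.
Proof. by rewrite -big_split; apply: eq_bigr => i _; rewrite mxE mulrnDr. Qed.

Lemma comb0 : comb 0 = 0.
Proof. by apply: big1 => i _; rewrite mxE mulr0n. Qed.

Lemma combMn k m : comb (k *+ m) = comb k *+ m.
Proof. by elim: m => [|m IH]; rewrite ?comb0 // !mulrS combD IH. Qed.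

Lemma comb_sum q (f : 'I_q -> 'rV_n) (m : 'I_q -> nat) :
  comb (\sum_i f i *+ m i) = \sum_i comb (f i) *+ m i.
Proof.
by elim/big_rec2: _ => [|i y x _ <-]; rewrite ?comb0 // combD combMn.
Qed.

Lemma toQ_combE k : toQ (comb k) = toQ k *m rows_toQ p.
Proof. by rewrite toQ_comb; congr (_ *m _). Qed.

(** A parameter is paired with a run for it, since pumps come from comparable runs. The order also
    compares the parameters, which the ends of the run need not determine. *)
Record lin_obj := LinObj {
  lin_val : 'rV[nat]_n;
  lin_run : obj S;
  lin_eq : row_mx (src lin_run) (tgt lin_run) = b + comb lin_val
}.

Definition lin_le (a a' : lin_obj) : Prop :=
  vle (lin_val a) (lin_val a') /\ le (lin_run a) (lin_run a').

Lemma lin_wqo : wqo lin_le.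
Proof.
apply: (wqo_map (h := fun a => (lin_val a, lin_run a)))
  (wqo_prod (@vle_trans n) (@wqo_vec n) (wqo_le gS)) => a a' //.
Qed.

Lemma lin_amalg a a1 a2 : lin_le a a1 -> lin_le a a2 -> exists a3,
  [/\ lin_le a1 a3, lin_le a2 a3 & lin_val a3 + lin_val a = lin_val a1 + lin_val a2].
Proof.
move=> [[x1 e1] l1] [[x2 e2] l2].
have [r [h1 h2 sr tr]] := amalg gS l1 l2.
have er : row_mx (src r) (tgt r) = b + comb (lin_val a + x1 + x2).
  have : row_mx (src r) (tgt r) + row_mx (src (lin_run a)) (tgt (lin_run a)) =
      row_mx (src (lin_run a1)) (tgt (lin_run a1)) + row_mx (src (lin_run a2)) (tgt (lin_run a2)).
    by rewrite !add_row_mx sr tr.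
  rewrite !lin_eq e1 e2 !combD; move: (row_mx _ _) (comb _) (comb _) (comb _) => R k k1 k2 e.
  by vnat.
exists (LinObj er); split; last by rewrite /= e1 e2; vnat.
  by split=> //=; exists x2; rewrite e1.
by split=> //=; exists x1; rewrite e2; vnat.
Qed.

Lemma lin_pumpP a x : pump lin_val lin_le a x <->
  inc (lin_run a) (lsubmx (comb x)) (rsubmx (comb x)).
Proof.
have E' (s t : vec) y : row_mx s t = b + comb (lin_val a) + y <->
    s = src (lin_run a) + lsubmx y /\ t = tgt (lin_run a) + rsubmx y.
  rewrite -lin_eq -{1}[y]hsubmxK add_row_mx; split; first by move=> /eq_row_mx.
  by move=> [-> ->].
split.
  move=> [a' [[_ l] ea]]; exists (lin_run a').
  have := lin_eq a'; rewrite ea combD addrA => /E'[-> ->].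
  by split.
move=> [r [l sr tr]].
have er : row_mx (src r) (tgt r) = b + comb (lin_val a + x) by rewrite combD addrA; apply/E'.
by exists (LinObj er); split=> //; split=> //; exists x.
Qed.

(** The cone is the preimage of the cone of increments under [rows_toQ p]: the kernel selects the
    graph of this map in a product, and the image keeps the parameter. *)
Lemma lin_tame a : tame (qcone (pump lin_val lin_le a)).
Proof.
have mI := inc_monoid (lin_run a) gS.
have mT : monoid (fun _ : 'rV[nat]_n => True) by [].
have t1 := tame_prod (convex_qcone mT) (convex_qcone (monoid2P mI)) (@tame_nonneg n) (tame_inc gS (lin_run a)).
apply: tame_ext (tame_img (col_mx 1%:M 0) (tame_ker (col_mx (rows_toQ p) (- 1%:M)) t1)) => v.
split.
  move=> [w [[h1 h2] h3] ->]; move: h3 h1 h2.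
  rewrite -[w]hsubmxK !mul_row_col mulmxN !mulmx1 mulmx0 addr0 row_mxKl row_mxKr.
  move=> /subr0_eq <-; move: (lsubmx w) => {w}{}v [M [x [M0 _ ex]]] [N [z [N0 Rz ez]]].
  exists (M * N)%N, (x *+ N); rewrite muln_gt0 M0; split=> //; last first.
    by rewrite toQMn -ex scalerA -natrM mulnC.
  apply/lin_pumpP; rewrite combMn.
  have -> : comb x *+ N = z *+ M.
    apply: toQ_inj; rewrite !toQMn -ez toQ_combE -ex -scalemxAl !scalerA.
    by rewrite mulrC.
  by rewrite !linearMn; exact: monoid2Mn mI Rz.
move=> [M [x [M0 /lin_pumpP hx ex]]].
exists (row_mx v (v *m rows_toQ p)); last by rewrite mul_row_col mulmx1 mulmx0 addr0.
rewrite row_mxKl row_mxKr mul_row_col mulmxN mulmx1 subrr; split=> //; split.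
  by exists M, x.
by exists M, (comb x); rewrite scalemxAl ex toQ_combE.
Qed.

Lemma linear_flat : (forall k, exists a : obj S, row_mx (src a) (tgt a) = b + comb k) ->
  exists ws, forall x y k, row_mx x y = b + comb k -> flat_rel ws x y.
Proof.
move=> surj.
have val_surj k : exists a, lin_val a = k.
  by have [a ea] := surj k; exists (LinObj ea).
have le_val a a' : lin_le a a' -> exists x, lin_val a' = lin_val a + x by case.
have [s hs] := finite_flat_cover le_val lin_wqo lin_amalg lin_tame val_surj.
pose Q (j : flat_index lin_val lin_le) x y := exists k,
  flat_set lin_val (fi_base j) (@fi_pump _ _ _ _ j) k /\ row_mx x y = b + comb k.
have [ws hws] : exists ws, forall j, List.In j s -> forall x y, Q j x y -> flat_rel ws x y.
  apply: flat_rel_union => -[a q f hf].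
  have [ws hws] := flat gS (fun i => proj1 (lin_pumpP a (f i)) (hf i)).
  exists ws => x y [_ [[m ->] /=]]; rewrite combD comb_sum addrA -lin_eq.
  have := hws m; set u := \sum_i _; set v := \sum_i _ => h.
  have -> : \sum_i comb (f i) *+ m i = row_mx u v.
    rewrite /u /v -[LHS]hsubmxK !linear_sum /=.
    by congr row_mx; apply: eq_bigr => i _; rewrite linearMn.
  by rewrite add_row_mx => /eq_row_mx[-> ->].
exists ws => x y k exy; have [j [js hj]] := hs k.
by apply: hws js _ _ _; exists k.
Qed.

End Linear.

Section Pvas.

Variables (d : nat) (V : pvass d).
Hypothesis HV : is_pvas V.

Lemma pvas_state (p q : state V) : p = q.
Proof. by have /fintype_le1P/(_ q p) : (#|state V| <= 1)%N by rewrite HV. Qed.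

Local Notation effV := (@effect d V).
Local Notation priV := (@priority d V).

Lemma flat_rel_config ws x y q : flat_rel effV priV ws x y ->
  rel_comps [seq word_reach w | w <- ws] (q, x) (q, y).
Proof.
have hword w x' y' : word_rel effV priV w x' y' -> word_step w (q, x') (q, y').
  elim: w x' => [|e w IH] x' /=; first by move=> ->.
  move=> [z [[he1 he2] /IH h]]; exists (q, z); split=> //.
  by split=> //=; [exact: pvas_state | exact: pvas_state].
have hstar w x' y' : word_star effV priV w x' y' -> word_reach w (q, x') (q, y').
  elim=> [? ? /hword h|?|? ? ? _ h1 _ h2]; [exact: rt_step | exact: rt_refl | exact: rt_trans h1 h2].
elim: ws x => [|w ws IH] x /=; first by move=> ->.
by move=> [z [/hstar h1 /IH h2]]; exists (q, z).
Qed.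

Lemma reach_low_step (c c' : config V) : reach c c' ->
  clos_refl_trans_1n _ (low_step effV priV d.+1) c.2 c'.2.
Proof.
move=> h; elim: (clos_rt_rt1n _ _ _ _ h) => [x|x y z [e [_ _ h1 h2]] _ IH]; first exact: rt1n_refl.
by apply: Relation_Operators.rt1n_trans IH; exists e; rewrite ?ltn_ord.
Qed.

End Pvas.

Theorem mainTheorem1 (d : nat) (V : pvass d) (HV : is_pvas V)
    (Hsl : semilinear_rel (vector_rel (@reach d V))) :
  flattable V.
Proof.
have [k [L [hL hR]]] := Hsl.
(* Priorities are at most [d], so level [d.+1] contains all runs. *)
have gS := good_level (@effect d V) (@priority d V) d.+1.
have [ws hws] : exists ws, forall i, List.In i (enum 'I_k) -> forall x y, L i x y ->
    flat_rel (@effect d V) (@priority d V) ws x y.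
  apply: flat_rel_union => i; have [b [r [p hp]]] := hL i.
  have [|ws hws] := linear_flat gS (b := b) (p := p).
    move=> m; rewrite -[b + _]hsubmxK; set x := lsubmx _; set y := rsubmx _.
    (* A linear component lies inside reachability, so each of its parameters has a run. *)
    have /hR[q [q' hq]] : exists i, L i x y.
      by exists i; apply/hp; exists (m 0); rewrite hsubmxK.
    by have [a [ex ey]] := level_complete (reach_low_step hq); exists a; rewrite ex ey.
  exists ws => x y /hp[c ec]; apply: (hws x y (\row_i c i)); rewrite ec; congr (_ + _).
  by apply: eq_bigr => j _; rewrite mxE.
exists ws => -[q x] [q' y] hxy; rewrite -(pvas_state HV q q'); apply: (flat_rel_config HV).
have /hR[i hi] : vector_rel (@reach d V) x y by exists q, q'.
apply: hws hi; elim: (enum 'I_k) (mem_enum 'I_k i) => //= j s IH.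
by rewrite inE => /orP[/eqP->|/IH]; [left | right].
Qed.
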